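(* In the setting described in the context, let $s$ satisfy $m-\sigma\le s\le m$ and let $h_{\max}:=\max_{T\in\mathcal T}\mathrm{diam}(T)$. There exist constants $C_2(s),C_3(s)>0$ such that for any $F\in H^{-s}(\Omega)$, the solution $u\in V$ to $a(u,v)=F(v)$ for all $v\in V$ and the solution $u_{\mathrm{nc}}\in V_{\mathrm{nc}}$ to $a_{\mathrm{pw}}(u_{\mathrm{nc}},v_{\mathrm{nc}})=F(Jv_{\mathrm{nc}})$ for all $v_{\mathrm{nc}}\in V_{\mathrm{nc}}$ satisfy (a) $\displaystyle\|u-Ju_{\mathrm{nc}}\|_{H^s(\Omega)}\le C_2(s)\,h_{\max}^{m-s}\,|\!|\!| u-u_{\mathrm{nc}}|\!|\!|_{\mathrm{pw}}$, and (b) $\displaystyle\|u-u_{\mathrm{nc}}\|_{H^s(\mathcal T)}\le C_3(s)\,h_{\max}^{m-s}\,|\!|\!| u-u_{\mathrm{nc}}|\!|\!|_{\mathrm{pw}}$. The constants $C_2(s),C_3(s)$ depend only on $s$, $m$, $\Omega$, the constants $\kappa_m,\Lambda_{\mathrm J},C_{\mathrm{reg}}(s),C_{\mathrm{int}}(s)$ of the context, and the shape regularity of $\mathcal T$ (in particular not on $F$, $u$, or the mesh-size).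
   Context: Let $m\in\mathbb N$, let $\Omega\subset\mathbb R^2$ be a planar bounded Lipschitz domain with polygonal boundary, $V:=H^m_0(\Omega)$, and $a(v,w):=\int_\Omega D^m v:D^m w\,dx$ for $v,w\in V$. $H^{-s}(\Omega)$ denotes the dual of $H^s_0(\Omega)$. Write $\|\cdot\|:=\|\cdot\|_{L^2(\Omega)}$. Let $\mathcal T$ be a shape-regular triangulation of $\Omega$ into triangles, $P_k(\mathcal T)$ the space of piecewise polynomials of total degree at most $k$, $H^s(\mathcal T):=\{v\in L^2(\Omega): v|_T\in H^s(T)\ \forall T\in\mathcal T\}$ with norm $\|v\|_{H^s(\mathcal T)}:=(\sum_{T\in\mathcal T}\|v\|_{H^s(T)}^2)^{1/2}$ (Sobolev–Slobodeckii norms for non-integer $s$), and $h_{\mathcal T}\in P_0(\mathcal T)$ with $h_{\mathcal T}|_T=\mathrm{diam}(T)$. Set $a_{\mathrm{pw}}(v,w):=\sum_{T\in\mathcal T}\int_T D^m v:D^m w\,dx$ for $v,w\in H^m(\mathcal T)$ and $|\!|\!| v|\!|\!|_{\mathrm{pw}}:=a_{\mathrm{pw}}(v,v)^{1/2}$. $V_{\mathrm{nc}}\subset P_m(\mathcal T)$ is a linear subspace, $V_{\mathrm{nc}}\neq\{0\}$, on which $|\!|\!|\cdot|\!|\!|_{\mathrm{pw}}$ is a norm. There are an interpolation operator $I_{\mathrm{nc}}:V\to V_{\mathrm{nc}}$ and a constant $\kappa_m>0$ with, for all $v\in V$ and $w_m\in P_m(\mathcal T)$, $$a_{\mathrm{pw}}(v-I_{\mathrm{nc}}v,w_m)=0,\qquad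 \|h_{\mathcal T}^{-m}(v-I_{\mathrm{nc}}v)\|\le\kappa_m|\!|\!| v-I_{\mathrm{nc}}v|\!|\!|_{\mathrm{pw}}.$$ There are a linear operator $J:V_{\mathrm{nc}}\to V$ and a constant $\Lambda_{\mathrm J}$ such that for all $v_{\mathrm{nc}}\in V_{\mathrm{nc}}$ and $v\in V$: $I_{\mathrm{nc}}Jv_{\mathrm{nc}}=v_{\mathrm{nc}}$ and $|\!|\!| v_{\mathrm{nc}}-Jv_{\mathrm{nc}}|\!|\!|_{\mathrm{pw}}\le\Lambda_{\mathrm J}|\!|\!| v_{\mathrm{nc}}-v|\!|\!|_{\mathrm{pw}}$. Elliptic regularity and approximation: there are $0<\sigma\le1$ and constants $0<C_{\mathrm{reg}}(s),C_{\mathrm{int}}(s)<\infty$ such that for any $G\in H^{-s}(\Omega)$ with $m-\sigma\le s\le m$, the weak solution $z\in V$ to $(-1)^m\Delta^m z=G$ (i.e. $a(z,v)=G(v)$ for all $v\in V$) belongs to $V\cap H^{2m-s}(\Omega)$ and $$\|z\|_{H^{2m-s}(\Omega)}\le C_{\mathrm{reg}}(s)\|G\|_{H^{-s}(\Omega)},\qquad |\!|\!| z-I_{\mathrm{nc}}z|\!|\!|_{\mathrm{pw}}\le C_{\mathrm{int}}(s)\,h_{\max}^{m-s}\|z\|_{H^{2m-s}(\Omega)}.$$ *)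

(* Defs.v *)
From HB Require Import structures.
From mathcomp Require Import all_boot all_order all_algebra.
From mathcomp Require Import all_classical all_reals all_analysis.

Set Implicit Arguments.
Unset Strict Implicit.
Unset Printing Implicit Defensive.

Import Order.TTheory GRing.Theory Num.Theory.
Import numFieldNormedType.Exports.

Local Open Scope classical_set_scope.
Local Open Scope ring_scope.

(* Functions on a subset D of the plane are represented by total functions     *)
(* whose values outside D are irrelevant; elements of L^2(D) and of Sobolev    *)
(* spaces are such functions, identified when they agree almost everywhere.    *)

(* measurableTypeR R is R, with the sigma-algebra carried by lebesgue_measure. *)
Notation plane R := (measurableTypeR R * measurableTypeR R)%type.

Section Plane.
Variable R : realType.
Local Notation plane := (plane R).

Definition mu2 : {measure set plane -> \bar R} :=
  (@lebesgue_measure R \x @lebesgue_measure R)%E.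

(* The norm of the library on R * R is the maximum norm; its topology is the   *)
(* Euclidean one, but distances and diameters have to be Euclidean.            *)
Definition eucl_dist (x y : plane) : R :=
  Num.sqrt ((x.1 - y.1) ^+ 2 + (x.2 - y.2) ^+ 2).

Definition diam (A : set plane) : R :=
  sup [set d | exists x y, [/\ A x, A y & d = eucl_dist x y]].

Definition lincomb (a : R) (f : plane -> R) (b : R) (g : plane -> R) :
  plane -> R := fun x => a * f x + b * g x.

Definition boundary (Om : set plane) : set plane := closure Om `\` interior Om.

Definition segment (p q : plane) : set plane :=
  [set x | exists2 t : R, 0 <= t <= 1 &
     x = (p.1 + t * (q.1 - p.1), p.2 + t * (q.2 - p.2))].

Definition polygonal_boundary (Om : set plane) : Prop :=
  exists ss : seq (plane * plane),
    boundary Om = [set x | exists2 pq, pq \in ss & segment pq.1 pq.2 x].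

(* Near each boundary point, in coordinates rotated by the angle with cosine c *)
(* and sine d, Om lies strictly above the graph of a Lipschitz function.       *)
Definition lipschitz_boundary (Om : set plane) : Prop :=
  forall x, boundary Om x -> exists (c d r L : R) (phi : R -> R),
    [/\ c ^+ 2 + d ^+ 2 = 1, 0 < r, L.-lipschitz phi &
     forall y, eucl_dist x y < r ->
       (Om y <-> phi (c * y.1 + d * y.2) < c * y.2 - d * y.1)].

Definition polygonal_lipschitz_domain (Om : set plane) : Prop :=
  [/\ open Om, connected Om, Om !=set0, bounded_set Om &
      lipschitz_boundary Om /\ polygonal_boundary Om].

Definition dir (b : bool) : plane := if b then (0, 1) else (1, 0).

(* For a word w = b_1 ... b_k in the letters false (first coordinate) and true *)
(* (second coordinate), the classical derivative d_{b_1} ... d_{b_k} f.        *)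
Definition pderiv (w : seq bool) (f : plane -> R) : plane -> R :=
  foldr (fun b (g : plane -> R) x => 'D_(dir b) g x) f w.

Definition smooth (f : plane -> R) : Prop :=
  forall (w : seq bool) (x : plane), differentiable (pderiv w f) x.

Definition test_function (D : set plane) (phi : plane -> R) : Prop :=
  let supp := closure [set x | phi x != 0] in
  [/\ smooth phi, compact supp & supp `<=` D].

Definition L2sq (D : set plane) (f : plane -> R) : \bar R :=
  (\int[mu2]_(x in D) (f x ^+ 2)%:E)%E.

Definition L2 (D : set plane) (f : plane -> R) : Prop :=
  measurable_fun D f /\ (L2sq D f < +oo)%E.

Definition L2norm (D : set plane) (f : plane -> R) : \bar R :=
  sqrte (L2sq D f).

Definition is_wderiv (D : set plane) (w : seq bool) (v g : plane -> R) : Prop :=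
  L2 D g /\ forall phi, test_function D phi ->
    (\int[mu2]_(x in D) (v x * pderiv w phi x)
     = (-1) ^+ size w * \int[mu2]_(x in D) (g x * phi x))%R.

(* A weak derivative in L^2(D), when there is one; unique almost everywhere.   *)
Definition wderiv (D : set plane) (w : seq bool) (v : plane -> R) : plane -> R :=
  xget (fun=> 0) [set g | is_wderiv D w v g].

Definition Hint (D : set plane) (k : nat) (v : plane -> R) : Prop :=
  L2 D v /\ forall w : seq bool, (size w <= k)%N -> exists g, is_wderiv D w v g.

(* int_D D^m v : D^m w, where D^m v is the m-tensor of all the derivatives     *)
(* d_{b_1} ... d_{b_m} v and the colon is the Euclidean product of tensors.    *)
Definition aform (D : set plane) (m : nat) (v w : plane -> R) : R :=
  \sum_(b : m.-tuple bool) \int[mu2]_(x in D) (wderiv D b v x * wderiv D b w x).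

Definition slobodeckii_sq (D : set plane) (theta : R) (g : plane -> R) : \bar R :=
  (\int[mu2]_(x in D) \int[mu2]_(y in D)
     ((g x - g y) ^+ 2 / (eucl_dist x y) `^ (2 + 2 * theta))%:E)%E.

(* The squared norm is +oo for functions which are not in the space.           *)
Definition Hsq (D : set plane) (s : R) (v : plane -> R) : \bar R :=
  let k := Num.truncn s in
  let theta := s - k%:R in
  (if `[< Hint D k v >] then
     \sum_(j < k.+1) \sum_(b : j.-tuple bool) L2sq D (wderiv D b v)
     + (if (0 < theta)%R then
          \sum_(b : k.-tuple bool) slobodeckii_sq D theta (wderiv D b v)
        else 0)
   else +oo)%E.

Definition Hnorm (D : set plane) (s : R) (v : plane -> R) : \bar R :=
  sqrte (Hsq D s v).

Definition Hs (D : set plane) (s : R) : set (plane -> R) :=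
  [set v | (Hnorm D s v < +oo)%E].

(* The closure of the test functions in H^s(D).                                *)
Definition H0 (D : set plane) (s : R) : set (plane -> R) :=
  [set v | Hs D s v /\ forall e : R, 0 < e ->
     exists2 phi, test_function D phi & (Hnorm D s (v \- phi)%R < e%:E)%E].

Definition dualnorm (D : set plane) (s : R) (G : (plane -> R) -> R) : \bar R :=
  ereal_sup [set `|G v|%:E | v in [set v | H0 D s v /\ (Hnorm D s v <= 1)%E]].

(* H^{-s}(D); boundedness makes G constant on almost-everywhere classes.       *)
Definition Hdual (D : set plane) (s : R) (G : (plane -> R) -> R) : Prop :=
  (forall a b f g, H0 D s f -> H0 D s g ->
     G (lincomb a f b g) = a * G f + b * G g) /\
  (dualnorm D s G < +oo)%E.

Definition weak_solution (D : set plane) (m : nat) (G : (plane -> R) -> R)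
    (z : plane -> R) : Prop :=
  H0 D m%:R z /\ forall v, H0 D m%:R v -> aform D m z v = G v.

Definition hull (T : 'I_3 -> plane) (K : set 'I_3) : set plane :=
  [set x | exists c : 'I_3 -> R,
     [/\ forall k, 0 <= c k, forall k, ~ K k -> c k = 0, \sum_k c k = 1 &
         x = (\sum_k c k * (T k).1, \sum_k c k * (T k).2)]].

Definition tri (T : 'I_3 -> plane) : set plane := hull T setT.

Definition otri (T : 'I_3 -> plane) : set plane := interior (tri T).

Definition nondegenerate_tri (T : 'I_3 -> plane) : Prop :=
  let A := T (inord 0%N) in let B := T (inord 1%N) in let C := T (inord 2%N) in
  (B.1 - A.1) * (C.2 - A.2) - (B.2 - A.2) * (C.1 - A.1) != 0.

(* Two distinct triangles meet in the convex hull of their common vertices,    *)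
(* i.e. in the empty set, a vertex or an edge.                                 *)
Definition triangulation (Om : set plane) (N : nat) (T : 'I_N -> 'I_3 -> plane) :
  Prop :=
  [/\ forall i, nondegenerate_tri (T i),
      closure Om = \bigcup_i tri (T i),
      forall i j, i != j -> otri (T i) `&` otri (T j) = set0 &
      forall i j, i != j ->
        tri (T i) `&` tri (T j) = hull (T i) [set k | range (T j) (T i k)]].

(* Each triangle contains a disc whose diameter is at least diam T / gam.      *)
Definition shape_regular (gam : R) (N : nat) (T : 'I_N -> 'I_3 -> plane) : Prop :=
  forall i, exists (c : plane) (r : R),
    [/\ 0 < r, [set x | eucl_dist c x <= r] `<=` tri (T i) &
        diam (tri (T i)) <= gam * (2 * r)].

Section Mesh.
Variables (N : nat) (T : 'I_N -> 'I_3 -> plane).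

Definition hmax : R := \big[Num.max/0]_(i < N) diam (tri (T i)).

(* The piecewise constant mesh-size (0 on the skeleton, a null set).           *)
Definition hmesh (x : plane) : R :=
  \sum_(i < N) diam (tri (T i)) * \1_(otri (T i)) x.

Definition Ppw (Om : set plane) (k : nat) : set (plane -> R) :=
  [set v | measurable_fun Om v /\
     forall i, exists c : nat -> nat -> R,
       ae_eq mu2 (otri (T i)) v
         (fun x => \sum_(p < k.+1) \sum_(q < k.+1 | (p + q <= k)%N)
                      c p q * x.1 ^+ p * x.2 ^+ q)].

Definition apw (m : nat) (v w : plane -> R) : R :=
  \sum_(i < N) aform (otri (T i)) m v w.

Definition enorm (m : nat) (v : plane -> R) : R := Num.sqrt (apw m v v).

Definition Hnorm_pw (s : R) (v : plane -> R) : \bar R :=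
  sqrte (\sum_(i < N) Hsq (otri (T i)) s v)%E.

End Mesh.

Definition linear_subspace (W : set (plane -> R)) : Prop :=
  W (fun=> 0) /\ forall a b f g, W f -> W g -> W (lincomb a f b g).

Definition norm_on (Om : set plane) (W : set (plane -> R))
    (n : (plane -> R) -> R) : Prop :=
  [/\ forall v, W v -> 0 <= n v,
      forall a v, W v -> n (fun x => a * v x) = `|a| * n v,
      forall v w, W v -> W w -> n (v \+ w) <= n v + n w &
      forall v, W v -> n v = 0 -> ae_eq mu2 Om v (fun=> 0)].

(* A map W1 -> W2 between spaces of almost-everywhere classes on Om.           *)
Definition operator (Om : set plane) (W1 W2 : set (plane -> R))
    (A : (plane -> R) -> plane -> R) : Prop :=
  (forall v, W1 v -> W2 (A v)) /\
  (forall v w, W1 v -> W1 w -> ae_eq mu2 Om v w -> ae_eq mu2 Om (A v) (A w)).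

Definition linear_operator (Om : set plane) (W1 W2 : set (plane -> R))
    (A : (plane -> R) -> plane -> R) : Prop :=
  operator Om W1 W2 A /\
  forall a b f g, W1 f -> W1 g ->
    ae_eq mu2 Om (A (lincomb a f b g)) (lincomb a (A f) b (A g)).

End Plane.

(* Main.v *)
From HB Require Import structures.
Require Import Defs.
From mathcomp Require Import all_boot all_order all_algebra.
From mathcomp Require Import all_classical all_reals all_analysis.
From mathcomp Require Import measurable_realfun ring lra.

Set Implicit Arguments.
Unset Strict Implicit.
Unset Printing Implicit Defensive.

Import Order.TTheory GRing.Theory Num.Theory.
Import numFieldNormedType.Exports.

Local Open Scope classical_set_scope.
Local Open Scope ring_scope.

(** Why the theorem is true.

    Write e = u - J unc. For (a) the norm of e in H^s is the value at e of a
    functional G of dual norm at most one, the inner product with e divided by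
    the norm of e (norm_by_duality). Let z be the weak solution for G. Then
    the norm of e is G(e) = a(z,e) = a_pw(e,z). Since J is a right inverse of
    the interpolation, v - J v is orthogonal to piecewise polynomials for v in
    Vnc, and since unc is tested with J, u - unc is orthogonal to J Vnc in the
    sense that a(u, J v) = a_pw(unc, v). With I = Inc these two facts give
      a_pw(e,z) = a_pw(e, z - J I z) - a_pw(J unc - unc, J I z - I z),
    and quasi-optimality of J bounds the right-hand side by a constant times
    the product of the energy norms of u - unc and z - I z (second_order).
    Elliptic regularity bounds the last factor by hmax^(m-s).

    For (b) split u - unc = e + w with w = J unc - unc. The function e lies in
    H^s of the whole domain, so that its broken norm is at most the norm
    bounded in (a) (Hsq_restrict). The function w is only piecewise in H^m. On
    one triangle K of diameter H, a scaled inequality bounds the norm of w in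
    H^s(K) by H^(m-s) times H^(-m) |w| plus the energy norm of w
    (local_Hs_estimate); summed over the mesh (broken_Hs_estimate), the first
    term is controlled by the weighted L2 estimate of the interpolation at
    J unc, because w = J unc - Inc (J unc) (weighted_companion), and the
    energy norm of w by quasi-optimality.

    The scaled inequality rests on two facts about a convex set K. Difference
    quotients are bounded by gradients: the Slobodeckii seminorm of a limit of
    smooth functions is at most the L2 norm of its gradient times H^(1-theta)
    up to a constant (slob_strong). Conversely an L2 norm is bounded by the
    seminorm with theta = 0 and one weighted mean (weighted_poincare). If the
    weight is a bump inside the inscribed disc of the triangle, the mean of a
    derivative of w is by parts a mean of w, whence every intermediate
    derivative is bounded by w and its derivatives of order m
    (local_estimate). If the weight lives in the outer part of a large square,
    where the zero extension of a function of H^m_0 vanishes, the same two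
    facts give the inequality of Friedrichs (friedrichs).

    The solution z exists by the theorem of Riesz in H^m_0, which is complete
    for the energy (H0_complete) by the completeness of L2 and the closedness
    of weak derivatives. That these are well defined almost everywhere is the
    fundamental lemma of the calculus of variations. By the
    Lipschitz property of the boundary the domain is the interior of its
    closure, so that it contains the open triangles, whose union it is up to a
    null set (lipschitz_interior_closure, mesh_null). *)

(** * Quadratic forms and square integrable functions *)

(** The operation of lincomb, over any domain: difference quotients are
    functions of two points of the plane. *)
Definition comb (X : Type) (R : pzRingType) (a : R) (f : X -> R) (b : R) (g : X -> R) :
  X -> R := fun x => a * f x + b * g x.

Section L2space.
Context d (T : measurableType d) (R : realType).
Variables (mu : {measure set T -> \bar R}) (D : set T).
Hypothesis mD : measurable D.
Implicit Types f g h : T -> R.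

Definition sqint (f : T -> R) : \bar R := (\int[mu]_(x in D) (f x ^+ 2)%:E)%E.

Definition inL2 (f : T -> R) : Prop := measurable_fun D f /\ (sqint f < +oo)%E.

Definition ip (f g : T -> R) : R := (\int[mu]_(x in D) (f x * g x))%R.

Lemma sqint_ge0 f : (0 <= sqint f)%E.
Proof. by apply: integral_ge0 => x _; rewrite lee_fin sqr_ge0. Qed.

Lemma measurable_sq f : measurable_fun D f ->
  measurable_fun D (fun x => (f x ^+ 2)%:E).
Proof. by move=> mf; apply/measurable_EFinP/measurable_funX. Qed.

Lemma sqint_comb_le (a b : R) f g : measurable_fun D f -> measurable_fun D g ->
  (sqint (comb a f b g)
   <= (2 * a ^+ 2)%:E * sqint f + (2 * b ^+ 2)%:E * sqint g)%E.
Proof.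
move=> mf mg.
have ha c : 0 <= 2 * c ^+ 2 :> R by rewrite mulr_ge0// sqr_ge0.
rewrite /sqint -!ge0_integralZl_EFin //; try by
  [move=> x _; rewrite lee_fin sqr_ge0 | exact: measurable_sq].
rewrite -ge0_integralD //; try by
  [move=> x _; rewrite mule_ge0 ?lee_fin ?sqr_ge0 |
   apply: measurable_funeM; exact: measurable_sq].
apply: ge0_le_integral => //.
- by move=> x _; rewrite lee_fin sqr_ge0.
- apply/measurable_EFinP/measurable_funX/measurable_funD;
    exact: measurable_funM.
- apply: emeasurable_funD; apply: measurable_funeM; exact: measurable_sq.
move=> x _; rewrite -!EFinM -EFinD lee_fin.
rewrite /comb; have := sqr_ge0 (a * f x - b * g x); nra.
Qed.

Lemma inL2_comb (a b : R) f g : inL2 f -> inL2 g -> inL2 (comb a f b g).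
Proof.
move=> [mf f2] [mg g2]; split.
  by apply: measurable_funD; apply: measurable_funM.
apply: le_lt_trans (sqint_comb_le a b mf mg) _.
by rewrite lte_add_pinfty// ?lte_mul_pinfty// lee_fin mulr_ge0// sqr_ge0.
Qed.

Lemma inL2Z (a : R) f : inL2 f -> inL2 (fun x => a * f x).
Proof.
move=> hf; have := inL2_comb a 0 hf hf.
by rewrite (_ : comb _ _ _ _ = fun x => a * f x)//; apply/funext => x; rewrite /comb mul0r addr0.
Qed.

Lemma inL2B f g : inL2 f -> inL2 g -> inL2 (fun x => f x - g x).
Proof.
move=> hf hg; have := inL2_comb 1 (-1) hf hg.
by rewrite (_ : comb _ _ _ _ = fun x => f x - g x)//; apply/funext => x; rewrite /comb mul1r mulN1r.
Qed.

Lemma integrable_sq f : inL2 f -> mu.-integrable D (EFin \o (fun x => f x ^+ 2)).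
Proof.
move=> [mf f2]; apply/integrableP; split; first exact: measurable_sq.
rewrite (_ : (\int[mu]_(x in D) _)%E = sqint f)//.
by apply: eq_integral => x _ /=; rewrite ger0_norm// sqr_ge0.
Qed.

Lemma integrable_prod f g : inL2 f -> inL2 g ->
  mu.-integrable D (EFin \o (fun x => f x * g x)).
Proof.
move=> hf hg; have [mf _] := hf; have [mg _] := hg.
apply: (@le_integrable _ _ _ mu D mD _
  ((EFin \o (fun x => (f x ^+ 2)%R)) \+ (EFin \o (fun x => (g x ^+ 2)%R)))%E).
- by apply/measurable_EFinP; exact: measurable_funM.
- move=> x _ /=; rewrite lee_fin [leRHS]ger0_norm ?addr_ge0 ?sqr_ge0//.
  rewrite ler_norml; have := sqr_ge0 (f x - g x); have := sqr_ge0 (f x + g x).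
  by move=> h1 h2; apply/andP; split; nra.
- by apply: integrableD => //; exact: integrable_sq.
Qed.

Lemma ipC f g : ip f g = ip g f.
Proof. by apply: eq_Rintegral => x _; rewrite mulrC. Qed.

Lemma ip_combl (a b : R) f g h : inL2 f -> inL2 g -> inL2 h ->
  ip (comb a f b g) h = a * ip f h + b * ip g h.
Proof.
move=> hf hg hh; rewrite /ip -!RintegralZl//; try exact: integrable_prod.
rewrite -RintegralD//; last 2 first.
- by apply: (@eq_integrable _ _ _ mu D mD (EFin \o (fun x => (a * f x) * h x)));
    [move=> x _ /=; rewrite mulrA | apply: integrable_prod => //; exact: inL2Z].
- by apply: (@eq_integrable _ _ _ mu D mD (EFin \o (fun x => (b * g x) * h x)));
    [move=> x _ /=; rewrite mulrA | apply: integrable_prod => //; exact: inL2Z].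
by apply: eq_Rintegral => x _; rewrite mulrDl !mulrA.
Qed.

Lemma ip_ge0 f : 0 <= ip f f.
Proof. by apply: Rintegral_ge0 => x _; rewrite -expr2 sqr_ge0. Qed.

Lemma sqintE f : inL2 f -> sqint f = (ip f f)%:E.
Proof.
move=> hf; rewrite /ip /Rintegral fineK; last first.
  by apply: integrable_fin_num => //; exact: integrable_prod.
by apply: eq_integral => x _; rewrite expr2.
Qed.

Lemma ip_ae f f' g g' : inL2 f -> inL2 f' -> inL2 g -> inL2 g' ->
  ae_eq mu D f f' -> ae_eq mu D g g' -> ip f g = ip f' g'.
Proof.
move=> hf hf' hg hg' ff gg; rewrite /ip /Rintegral; congr fine.
apply: ae_eq_integral => //.
- by apply/measurable_EFinP; apply: measurable_funM; [case: hf|case: hg].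
- by apply/measurable_EFinP; apply: measurable_funM; [case: hf'|case: hg'].
by apply: filterS2 ff gg => x h1 h2 Dx; rewrite h1// h2.
Qed.

Lemma sqint_ae f f' : measurable_fun D f -> measurable_fun D f' ->
  ae_eq mu D f f' -> sqint f = sqint f'.
Proof.
move=> mf mf' ff; apply: ae_eq_integral => //; try exact: measurable_sq.
by apply: filterS ff => x h1 Dx; rewrite h1.
Qed.

Lemma inL2_ae f f' : measurable_fun D f' -> ae_eq mu D f f' -> inL2 f -> inL2 f'.
Proof. by move=> mf' ff [mf f2]; split => //; rewrite -(sqint_ae mf). Qed.

End L2space.

Section forms.
Context (X : Type) (R : realType).
Implicit Types f g h : X -> R.
Implicit Types (V : set (X -> R)) (B : (X -> R) -> (X -> R) -> R).

Definition linear_set V := forall a b f g, V f -> V g -> V (comb a f b g).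

Definition psd_form V B :=
  [/\ forall a b f g h, V f -> V g -> V h ->
        B (comb a f b g) h = a * B f h + b * B g h,
      forall f g, V f -> V g -> B f g = B g f &
      forall f, V f -> 0 <= B f f].

Lemma combB f g : (f \- g)%R = comb 1 f (-1) g.
Proof. by apply/funext => x; rewrite /comb mul1r mulN1r. Qed.

Lemma combD f g : (f \+ g)%R = comb 1 f 1 g.
Proof. by apply/funext => x; rewrite /comb !mul1r. Qed.

Section theory.
Variables (V : set (X -> R)) (B : (X -> R) -> (X -> R) -> R).
Hypotheses (hV : linear_set V) (hB : psd_form V B).

Lemma form_combl a b f g h : V f -> V g -> V h ->
  B (comb a f b g) h = a * B f h + b * B g h.
Proof. by case: hB => + _ _; apply. Qed.

Lemma form_sym f g : V f -> V g -> B f g = B g f.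
Proof. by case: hB => _ + _; apply. Qed.

Lemma form_ge0 f : V f -> 0 <= B f f.
Proof. by case: hB => _ _; apply. Qed.

Lemma form_combr a b f g h : V f -> V g -> V h ->
  B h (comb a f b g) = a * B h f + b * B h g.
Proof.
move=> Vf Vg Vh; rewrite form_sym//; last exact: hV.
by rewrite form_combl// !(form_sym _ Vh).
Qed.

Lemma form_quad a b f g : V f -> V g ->
  B (comb a f b g) (comb a f b g) =
    a ^+ 2 * B f f + 2 * (a * b) * B f g + b ^+ 2 * B g g.
Proof.
move=> Vf Vg; rewrite form_combl ?form_combr//; last exact: hV.
rewrite (form_sym Vg Vf); ring.
Qed.

Lemma form_CS f g : V f -> V g -> B f g ^+ 2 <= B f f * B g g.
Proof.
move=> Vf Vg.
have q a b : 0 <= a ^+ 2 * B f f + 2 * (a * b) * B f g + b ^+ 2 * B g g.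
  by rewrite -form_quad//; apply: form_ge0; apply: hV.
have [Bg0|Bg0] := eqVneq (B g g) 0.
  rewrite Bg0 mulr0; have [->|Bfg] := eqVneq (B f g) 0; first by rewrite expr0n.
  have := q 1 (- (B f f + 1) / (2 * B f g)); rewrite Bg0.
  have -> : 1 ^+ 2 * B f f + 2 * (1 * (- (B f f + 1) / (2 * B f g))) * B f g +
    (- (B f f + 1) / (2 * B f g)) ^+ 2 * 0 = -1 by field.
  lra.
have Bgp : 0 < B g g by rewrite lt0r Bg0 form_ge0.
have := q (B g g) (- B f g); rewrite (_ : _ + _ =
  B g g * (B f f * B g g - B f g ^+ 2)); last by ring.
by rewrite pmulr_rge0// subr_ge0.
Qed.

Lemma form_CS_abs f g : V f -> V g ->
  `|B f g| <= Num.sqrt (B f f) * Num.sqrt (B g g).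
Proof.
move=> Vf Vg; rewrite -sqrtrM ?form_ge0// -sqrtr_sqr ler_wsqrtr//.
exact: form_CS.
Qed.

Lemma form_triangle f g : V f -> V g ->
  Num.sqrt (B (f \+ g)%R (f \+ g)%R) <= Num.sqrt (B f f) + Num.sqrt (B g g).
Proof.
move=> Vf Vg; set a := Num.sqrt (B f f); set b := Num.sqrt (B g g).
have a0 : 0 <= a by exact: sqrtr_ge0.
have b0 : 0 <= b by exact: sqrtr_ge0.
rewrite -[leRHS](ger0_norm (addr_ge0 a0 b0)) -sqrtr_sqr ler_wsqrtr//.
rewrite combD form_quad// !expr1n !mul1r mulr1 sqrrD !sqr_sqrtr ?form_ge0//.
rewrite lerD2r lerD2l -[leRHS]mulr_natl ler_wpM2l//.
exact: le_trans (ler_norm _) (form_CS_abs Vf Vg).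
Qed.

End theory.
End forms.

Section L2forms.
Context d (T : measurableType d) (R : realType).
Variables (mu : {measure set T -> \bar R}) (D : set T).
Hypothesis mD : measurable D.

Lemma inL2_linear : linear_set (inL2 mu D).
Proof. by move=> a f b g; exact: inL2_comb. Qed.

Lemma ip_psd : psd_form (inL2 mu D) (ip mu D).
Proof.
by split; [move=> *; exact: ip_combl | move=> *; exact: ipC | move=> *; exact: ip_ge0].
Qed.

Lemma ip_CS u v : inL2 mu D u -> inL2 mu D v ->
  ip mu D u v ^+ 2 <= ip mu D u u * ip mu D v v.
Proof. exact: (form_CS inL2_linear ip_psd). Qed.

End L2forms.

(** * Completeness of L2 and the theorem of Riesz *)

Lemma lee_limn_einf (R : realType) (u v : (\bar R)^nat) :
  (forall n, (u n <= v n)%E) -> (limn_einf u <= limn_einf v)%E.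
Proof.
move=> uv; rewrite !limn_einf_lim; apply: lee_lim; try exact: is_cvg_einfs.
apply: nearW => n; apply: le_ereal_inf_tmp => _ [k /= nk <-].
by apply: le_trans (uv k); apply: ereal_inf_lbound; exists k.
Qed.

Lemma limn_einf_cst (R : realType) (c : \bar R) : limn_einf (fun=> c) = c.
Proof. by apply: (cvg_limn_einf_sup _).1; exact: cvg_cst. Qed.

Section L2complete.
Context d (T : measurableType d) (R : realType).
Variables (mu : {measure set T -> \bar R}) (D : set T).
Hypothesis mD : measurable D.
Implicit Types f g h : T -> R.

(** By Cauchy and Schwarz against the summable weights 2^-i, the weighted sums
    of squares bound the total variation of the sequence. *)
Lemma summable_cvg (u : nat -> R) (S : R) :
  (forall n, \sum_(i < n) 2 ^+ i * (u i.+1 - u i) ^+ 2 <= S) ->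
  cvgn u.
Proof.
move=> hS.
have hn : cvgn [normed series (telescope u)].
  apply: nondecreasing_is_cvgn.
    apply/nondecreasing_seqP => n.
    by rewrite /normed_series_of seriesSr lerDl normr_ge0.
  exists (S + 1) => _ [n _ <-]; rewrite /normed_series_of seriesEnat /= big_mkord.
  have h2 : \sum_(i < n) (2^-1 : R) ^+ i.+1 <= 1.
    rewrite (_ : \sum_(i < n) _ = 1 - 2^-1 ^+ n); last first.
      elim: n => [|n IH]; first by rewrite big_ord0 expr0 subrr.
      by rewrite big_ord_recr/= IH exprS; field.
    by rewrite gerBl exprn_ge0// invr_ge0.
  apply: le_trans (lerD (hS n) h2); rewrite -big_split/=.
  apply: ler_sum => i _; rewrite /telescope.
  set x := u _ - u _; set p := 2 ^+ i.
  have p0 : 0 < p :> R by rewrite exprn_gt0.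
  have -> : 2^-1 ^+ i.+1 = p^-1 / 2 by rewrite exprSr exprVn.
  have e : (p * `|x| - 1) ^+ 2 >= 0 by exact: sqr_ge0.
  have xx : `|x| ^+ 2 = x ^+ 2 by rewrite real_normK// num_real.
  rewrite -xx; set y := `|x| in e *.
  (* 2 |x| <= 2^i x^2 + 2^-i, up to a square that is discarded. *)
  rewrite -subr_ge0 (_ : _ - _ = ((p * y - 1) ^+ 2 + (p * y) ^+ 2) / (2 * p)).
    by rewrite divr_ge0 ?addr_ge0 ?sqr_ge0// mulr_ge0// ltW.
  by field; rewrite gt_eqF.
have := normed_cvg hn; rewrite telescopeK => h.
have /= /(_ _ _) := is_cvgD h (is_cvg_cst (u 0%N)).
rewrite (_ : (_ + _)%R = u); first exact.
by apply/funext => n /=; rewrite fctE subrK.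
Qed.

(** The weights 2^i are still beaten by the rate 4^-i, so the series has a
    finite integral and is finite almost everywhere. *)
Lemma fast_series_ae (u : nat -> T -> R) (K : R) : 0 <= K ->
  (forall n, measurable_fun D (u n)) ->
  (forall n, (sqint mu D (u n) <= (K * (4^-1) ^+ n)%:E)%E) ->
  {ae mu, forall x, D x ->
    exists S, forall n, \sum_(i < n) 2 ^+ i * (u i x) ^+ 2 <= S}.
Proof.
move=> K0 mu_ uK.
pose s n x := (2 ^+ n * (u n x) ^+ 2)%:E.
have s0 n x : (0 <= s n x)%E by rewrite lee_fin mulr_ge0 ?sqr_ge0// exprn_ge0.
have ms n : measurable_fun D (s n).
  by apply/measurable_EFinP/measurable_funM => //; apply/measurable_funX.
pose S x := (\sum_(0 <= n <oo) s n x)%E.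
have mS : measurable_fun D S by apply: ge0_emeasurable_sum.
have intS : mu.-integrable D S.
  apply/integrableP; split => //.
  rewrite (_ : (\int[mu]_(x in D) _)%E = (\int[mu]_(x in D) S x)%E); last first.
    by apply: eq_integral => x _; rewrite gee0_abs// nneseries_ge0.
  rewrite integral_nneseries//.
  apply: (@le_lt_trans _ _ (\sum_(0 <= n <oo) ((4 * K) / (2 ^ (n + 0.+1))%:R)%:E)%E).
    apply: lee_nneseries => [n _ _|n _]; first exact: integral_ge0.
    rewrite /s (_ : (\int[mu]_(x in D) _)%E =
        (\int[mu]_(x in D) ((2 ^+ n)%:E * ((u n x) ^+ 2)%:E))%E); last first.
      by apply: eq_integral => x _; rewrite -EFinM.
    rewrite ge0_integralZl_EFin//; last 2 first.
    - by move=> x _; rewrite lee_fin sqr_ge0.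
    - exact: measurable_sq.
    apply: le_trans (lee_wpmul2l _ (uK n)) _; first by rewrite lee_fin exprn_ge0.
    rewrite -EFinM lee_fin natrX addn1 !exprVn !exprS.
    have -> : (4 : R) ^+ n = 2 ^+ n * 2 ^+ n by rewrite -exprMn -natrM.
    have p0 : 0 < (2 : R) ^+ n by rewrite exprn_gt0.
    rewrite -subr_ge0 (_ : _ - _ = K / 2 ^+ n); last by field; lra.
    by rewrite divr_ge0// ltW.
  have /cvg_lim := @cvg_geometric_eseries_half R (4 * K) 0.
  by rewrite /eseries/= => -> //; rewrite ltry.
apply: filterS (integrable_ae mD intS) => x Sx Dx; exists (fine (S x)) => n.
rewrite -lee_fin fineK; last exact: Sx.
apply: le_trans (@nneseries_lim_ge _ _ xpredT 0%N n _) => //.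
by rewrite big_mkord -sumEFin.
Qed.

(** At a geometric rate the squared errors are summable almost everywhere, so
    that the whole sequence converges there. *)
Lemma L2_fast_ae (f : nat -> T -> R) (g : T -> R) (K : R) : 0 <= K ->
  (forall n, measurable_fun D (f n)) -> measurable_fun D g ->
  (forall n, (sqint mu D (f n \- g)%R <= (K * (4^-1) ^+ n)%:E)%E) ->
  {ae mu, forall x, D x -> f ^~ x @ \oo --> g x}.
Proof.
move=> K0 mf mg fg.
have mu_ n : measurable_fun D (f n \- g)%R by exact: measurable_funB.
apply: filterS (fast_series_ae K0 mu_ fg) => x hS Dx; have [S {}hS] := hS Dx.
have S0 : 0 <= S by have := hS 0%N; rewrite big_ord0.
apply/cvgrPdist_le => e e0.
have lim0 : (fun n => S * (2^-1) ^+ n) @ \oo --> (0 : R).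
  rewrite -(mulr0 S); apply: cvgM; first exact: cvg_cst.
  by apply: cvg_expr; rewrite ger0_norm ?invr_ge0// invf_lt1// ltr1n.
have e20 : 0 < e ^+ 2 by rewrite exprn_gt0.
move/cvgrPdist_le : lim0 => /(_ _ e20); apply: filterS => n /=.
have p0 : 0 < (2 : R) ^+ n by rewrite exprn_gt0.
rewrite sub0r normrN ger0_norm ?mulr_ge0 ?exprn_ge0 ?invr_ge0// => h.
rewrite -ler_sqr ?nnegrE// ?(ltW e0)// real_normK ?num_real//.
apply: le_trans h; rewrite exprVn ler_pdivlMr// mulrC.
have := hS n.+1; rewrite big_ord_recr/= -(opprB (f n x)) sqrrN.
apply: le_trans; rewrite lerDr; apply: sumr_ge0 => i _.
by rewrite mulr_ge0 ?sqr_ge0// exprn_ge0.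
Qed.

(** The limit exists almost everywhere because the increments are summable
    against 2^i; the rate passes to it by the lemma of Fatou. *)
Lemma L2_complete (f : nat -> T -> R) (K : R) : 0 <= K ->
  (forall n, inL2 mu D (f n)) ->
  (forall n m, (sqint mu D (f n \- f m)%R
                <= (K * ((4^-1) ^+ n + (4^-1) ^+ m))%:E)%E) ->
  exists2 g, inL2 mu D g &
    forall n, (sqint mu D (f n \- g)%R <= (K * (4^-1) ^+ n)%:E)%E.
Proof.
move=> K0 fL2 fC.
have mf n : measurable_fun D (f n) by case: (fL2 n).
have msq n m : measurable_fun D (fun x => ((f n x - f m x) ^+ 2)%:E).
  by apply/measurable_EFinP/measurable_funX/measurable_funB.
have aeS : {ae mu, forall x, D x ->
    exists S, forall n, \sum_(i < n) 2 ^+ i * (f i.+1 x - f i x) ^+ 2 <= S}.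
  apply: (@fast_series_ae (fun n => (f n.+1 \- f n)%R) (2 * K)); first by rewrite mulr_ge0.
    by move=> n; exact: measurable_funB.
  move=> n; apply: le_trans (fC _ _) _; rewrite lee_fin exprS.
  have : 0 <= 4^-1 ^+ n :> R by rewrite exprn_ge0// invr_ge0.
  move: (4^-1 ^+ n) => p p0; have := mulr_ge0 K0 p0; lra.
(* The upper limit is measurable, and defined where the sequence diverges. *)
pose g x := fine (limn_esup (fun n => (f n x)%:E)).
have mg : measurable_fun D g.
  apply: (@measurableT_comp _ _ _ _ _ _ fine); first exact: fine_measurable.
  by apply: measurable_fun_limn_esup => n; exact/measurable_EFinP.
have fg x : (exists S, forall n, \sum_(i < n) 2 ^+ i * (f i.+1 x - f i x) ^+ 2 <= S) ->
    f ^~ x @ \oo --> g x.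
  move=> [S hS].
  have /cvg_ex[l hl] : cvgn (f ^~ x).
    exact: (@summable_cvg _ S).
  suff -> : g x = l by [].
  rewrite /g; have h : (fun n => (f n x)%:E) @ \oo --> l%:E by apply/fine_cvgP; split; [exact: nearW|].
  by rewrite (cvg_limn_einf_sup h).2.
have key n : (sqint mu D (f n \- g)%R <= (K * (4^-1) ^+ n)%:E)%E.
  have -> : sqint mu D (f n \- g)%R =
      (\int[mu]_(x in D) limn_einf (fun m => ((f n x - f m x) ^+ 2)%:E))%E.
    apply: ge0_ae_eq_integral => //.
    - by apply/measurable_EFinP/measurable_funX/measurable_funB.
    - have -> : (fun x => limn_einf (fun m => ((f n x - f m x) ^+ 2)%:E)) =
         (fun x => - limn_esup (fun m => - ((f n x - f m x) ^+ 2)%:E))%E.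
        apply/funext => x.
        have := limn_esupN (fun m => ((f n x - f m x) ^+ 2)%:E).
        by rewrite /comp => ->; rewrite oppeK.
      apply: measurableT_comp => //; apply: measurable_fun_limn_esup => m.
      by apply: measurableT_comp => //; exact: msq.
    - by move=> x _; rewrite lee_fin sqr_ge0.
    - by move=> x _; rewrite -(limn_einf_cst 0%E); apply: lee_limn_einf => m; rewrite lee_fin sqr_ge0.
    apply: filterS aeS => x Sx Dx; have {}Sx := Sx Dx.
    have h : (fun m => ((f n x - f m x) ^+ 2)%:E) @ \oo --> ((f n x - g x) ^+ 2)%:E.
      apply/fine_cvgP; split; first exact: nearW.
      rewrite /comp/=; apply: (@cvg_comp _ _ _ _ (fun y : R => y ^+ 2)); last exact: exprn_continuous.
      by apply: cvgB; [exact: cvg_cst | exact: fg].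
    by rewrite (cvg_limn_einf_sup h).1.
  apply: le_trans (fatou mu mD (msq n) _) _.
    by move=> m x _; rewrite lee_fin sqr_ge0.
  have h : (fun m => (K * ((4^-1) ^+ n + (4^-1) ^+ m))%:E) @ \oo --> (K * (4^-1) ^+ n)%:E.
    apply/fine_cvgP; split; first exact: nearW.
    rewrite -[X in _ --> X]addr0 -[X in _ --> _ + X](mulr0 K) -mulrDr.
    apply: cvgM; first exact: cvg_cst.
    apply: cvgD; first exact: cvg_cst.
    by apply: cvg_expr; rewrite ger0_norm// invf_lt1// ltr1n.
  rewrite -(cvg_limn_einf_sup h).1; apply: lee_limn_einf => m; exact: fC.
exists g => //.
have h0 : inL2 mu D (f 0 \- g)%R.
  split; first exact: measurable_funB.
  exact: le_lt_trans (key 0%N) (ltry _).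
have := inL2B mD (fL2 0%N) h0.
by rewrite (_ : (fun x => _) = g)//; apply/funext => x /=; rewrite subKr.
Qed.

End L2complete.

Section riesz.
Context (X : Type) (R : realType).
Variables (V : set (X -> R)) (a : (X -> R) -> (X -> R) -> R) (G : (X -> R) -> R).
Hypotheses (hV : linear_set V) (ha : psd_form V a) (v0 : X -> R) (Vv0 : V v0).
Hypothesis a_complete : forall (v : nat -> X -> R) (K : R), 0 <= K ->
  (forall n, V (v n)) ->
  (forall n m, a (v n \- v m)%R (v n \- v m)%R <= K * (4^-1 ^+ n + 4^-1 ^+ m)) ->
  exists2 z, V z & exists C, forall n, a (v n \- z)%R (v n \- z)%R <= C * 4^-1 ^+ n.
Hypothesis G_linear : forall b c f g, V f -> V g ->
  G (comb b f c g) = b * G f + c * G g.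
Variable M : R.
Hypothesis G_bounded : forall v, V v -> G v ^+ 2 <= M * a v v.

Let E v := a v v - 2 * G v.

Lemma energy_comb v w t : V v -> V w ->
  E (comb 1 v t w) = E v + 2 * t * (a v w - G w) + t ^+ 2 * a w w.
Proof. by move=> Vv Vw; rewrite /E (form_quad hV ha)// G_linear//; ring. Qed.

(** Minimise the quadratic polynomial in t. *)
Lemma quad_ge0_bound (A B d : R) : 0 <= A -> 0 <= d ->
  (forall t, - d <= 2 * t * B + t ^+ 2 * A) -> B ^+ 2 <= d * A.
Proof.
move=> A0 d0 h; have [A00|A00] := eqVneq A 0.
  rewrite A00 mulr0; have [->|B0] := eqVneq B 0; first by rewrite expr0n.
  have := h (- (d + 1) / (2 * B)); rewrite A00 mulr0 addr0.
  have -> : 2 * (- (d + 1) / (2 * B)) * B = - (d + 1) by field.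
  lra.
have Ap : 0 < A by rewrite lt0r A00.
have := h (- B / A).
have -> : 2 * (- B / A) * B + (- B / A) ^+ 2 * A = - (B ^+ 2 / A) by field.
by rewrite lerN2 ler_pdivrMr.
Qed.

(** Minimise E v = a v v - 2 G v. If v n is within 4^-n of the infimum, then
    comparison of E (v n + t w) with the infimum bounds the residual a (v n) w - G w
    by 2^-n times the energy norm of w: minimising sequences converge fast, and
    their limit has no residual. *)
Theorem riesz_representation : 0 <= M -> exists2 z, V z & forall v, V v -> a z v = G v.
Proof.
move=> M0.
have Elb v : V v -> - M <= E v.
  move=> Vv; rewrite /E; have := G_bounded Vv.
  have a0 := form_ge0 ha Vv; set A := a v v in a0 *; set g := G v => h.
  have h2 : `|g| <= (M + A) / 2.
    rewrite -ler_sqr ?nnegrE//; last by rewrite divr_ge0 ?addr_ge0.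
    by rewrite real_normK ?num_real//; have := sqr_ge0 (M - A); nra.
  have := ler_norm g; lra.
pose S := [set E v | v in V].
have hS : has_inf S.
  by split; [exists (E v0), v0 | exists (- M) => _ [v Vv <-]; exact: Elb].
have /choice[v hv] : forall n, exists v, V v /\ E v < inf S + 4^-1 ^+ n.
  move=> n; have e0 : 0 < 4^-1 ^+ n :> R by rewrite exprn_gt0// invr_gt0.
  by have [_ [v Vv <-] h] := inf_adherent e0 hS; exists v.
have Vv n : V (v n) by case: (hv n).
have p0 n : 0 <= 4^-1 ^+ n :> R by rewrite exprn_ge0// invr_ge0.
(* The residual at v n, by comparison with the infimum. *)
have near n w : V w -> (a (v n) w - G w) ^+ 2 <= 4^-1 ^+ n * a w w.
  move=> Vw; apply: quad_ge0_bound => //; first exact: (form_ge0 ha).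
  move=> t; have h1 : inf S <= E (comb 1 (v n) t w).
    by apply: ge_inf; [case: hS | exists (comb 1 (v n) t w) => //; exact: hV].
  have := (hv n).2; rewrite energy_comb// in h1; lra.
have Cv n m : a (v n \- v m)%R (v n \- v m)%R <= 2 * (4^-1 ^+ n + 4^-1 ^+ m).
  set w := (v n \- v m)%R; have Vw : V w by rewrite /w combB; exact: hV.
  have aw : a w w = (a (v n) w - G w) - (a (v m) w - G w).
    by rewrite {1}/w combB (form_combl ha)//; ring.
  have h1 := near n _ Vw; have h2 := near m _ Vw.
  have A0 := form_ge0 ha Vw.
  move: (a w w) A0 aw h1 h2 => A A0.
  move: (a (v n) w - G w) (a (v m) w - G w) (p0 n) (p0 m) => x y.
  move: (4^-1 ^+ n) (4^-1 ^+ m) => p q hp hq Axy h1 h2.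
  have h3 : A ^+ 2 <= 2 * (p + q) * A by have := sqr_ge0 (x + y); rewrite Axy; nra.
  have [->|An] := eqVneq A 0; first by rewrite mulr_ge0// addr_ge0.
  have Ap : 0 < A by rewrite lt0r An.
  by rewrite -(ler_pM2r Ap) -expr2.
have [z Vz [C hz]] := a_complete (ler0n _ 2) Vv Cv.
exists z => // w Vw.
apply/eqP; rewrite -subr_eq0 -sqrf_eq0; apply/eqP/le_anti; rewrite sqr_ge0 andbT.
have aw := form_ge0 ha Vw.
have bound n : (a z w - G w) ^+ 2 <= 2 * (C + 1) * a w w * 4^-1 ^+ n.
  have h1 := near n _ Vw.
  have Vd : V (v n \- z)%R by rewrite combB; exact: hV.
  have h2 := form_CS hV ha Vd Vw.
  have h3 := hz n.
  have e : a z w - G w = (a (v n) w - G w) - a (v n \- z)%R w.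
    by rewrite [X in _ - _ = _ - X](_ : _ = a (v n) w - a z w);
      [ring | rewrite combB (form_combl ha)//; ring].
  rewrite e; move: (a (v n) w - G w) (a (v n \- z)%R w) h1 h2 => x y h1 h2.
  have h4 : y ^+ 2 <= C * 4^-1 ^+ n * a w w.
    by apply: le_trans h2 _; apply: ler_wpM2r.
  have := sqr_ge0 (x + y); nra.
have lim0 : (fun n => 2 * (C + 1) * a w w * 4^-1 ^+ n) @ \oo --> (0 : R).
  rewrite -(mulr0 (2 * (C + 1) * a w w)); apply: cvgM; first exact: cvg_cst.
  by apply: cvg_expr; rewrite ger0_norm ?invr_ge0// invf_lt1// ltr1n.
rewrite -(cvg_lim (@Rhausdorff R) lim0).
apply: limr_ge; first by apply/cvg_ex; exists 0.
exact: nearW.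
Qed.

End riesz.

(** * The measure of the plane *)

Section plane_measure.
Context {R : realType}.

(** A copy of the measure of the plane which carries the sigma-finiteness that
    the theorem of Tonelli asks for on products of planes. *)
Definition leb2 : set (plane R) -> \bar R :=
  (@lebesgue_measure R \x @lebesgue_measure R)%E.

HB.instance Definition _ := Measure.on leb2.

Lemma leb2X (A B : set (measurableTypeR R)) : measurable A -> measurable B ->
  leb2 (A `*` B) = (lebesgue_measure A * lebesgue_measure B)%E.
Proof. by move=> mA mB; rewrite /leb2 product_measure1E. Qed.

Definition square (h : R) : set (plane R) :=
  `[- h, h]%classic `*` `[- h, h]%classic.

Lemma squareP h (x : plane R) : square h x <-> `|x.1| <= h /\ `|x.2| <= h.
Proof.
by split=> -[/= h1 h2]; split; move: h1 h2; rewrite /= ?in_itv /= ?ler_norml.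
Qed.

Lemma measurable_square h : measurable (square h).
Proof. by apply: measurableX; exact: measurable_itv. Qed.

Lemma leb2_square (h : R) : 0 <= h -> leb2 (square h) = ((2 * h) ^+ 2)%:E.
Proof.
move=> h0; rewrite leb2X//; try exact: measurable_itv.
rewrite lebesgue_measure_itv/= lte_fin.
case: ltP => h1; first by rewrite -EFinD opprK -EFinM -expr2 mulrDl mul1r.
have -> : h = 0 by lra.
by rewrite mulr0 expr0n mule0.
Qed.

Lemma leb2_sigma_finite : sigma_finite setT leb2.
Proof.
exists (fun n => square n%:R).
  apply/seteqP; split => // -[x y] _.
  exists (Num.trunc (Num.max `|x| `|y|)).+1 => //.
  have := truncnS_gt (Num.max `|x| `|y|).
  by rewrite gt_max => /andP[/ltW xn /ltW yn]; apply/squareP.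
move=> n; split; first exact: measurable_square.
by rewrite leb2_square// ltry.
Qed.

HB.instance Definition _ := Measure_isSigmaFinite.Build _ _ _ leb2
  leb2_sigma_finite.

Definition smu2 : {sigma_finite_measure set (plane R) -> \bar R} := leb2.

Lemma smu2E : (smu2 : {measure set (plane R) -> \bar R}) = mu2 R.
Proof. by []. Qed.

Lemma open_planeP (U : set (plane R)) : open U <->
  forall x, U x -> exists2 e : R, 0 < e &
    forall y : plane R, `|y.1 - x.1| < e -> `|y.2 - x.2| < e -> U y.
Proof.
split=> [oU x Ux|h].
  have := oU x Ux; rewrite -nbhs_ballE => -[e /= e0 sub]; exists e => // y h1 h2.
  by apply: sub; split; rewrite /ball/= distrC.
move=> x Ux; have [e e0 sub] := h x Ux.
rewrite -nbhs_ballE; exists e => //= y [h1 h2]; apply: sub.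
  by move: h1; rewrite /ball/= distrC.
by move: h2; rewrite /ball/= distrC.
Qed.

(** Rational corners make the open rectangles a countable base of the plane. *)
Definition orect (q : rat * rat * rat * rat) : set (plane R) :=
  `]ratr q.1.1.1, ratr q.1.1.2[%classic `*` `]ratr q.1.2, ratr q.2[%classic.

Definition crect (q : rat * rat * rat * rat) : set (plane R) :=
  `[ratr q.1.1.1, ratr q.1.1.2]%classic `*` `[ratr q.1.2, ratr q.2]%classic.

Lemma open_rects (U : set (plane R)) : open U ->
  U = \bigcup_(n in [set n | exists2 q, unpickle n = Some q & crect q `<=` U])
        (if unpickle n is Some q then orect q else set0).
Proof.
move=> /open_planeP oU; apply/seteqP; split=> [x Ux|x [n [q -> sub]]]; last first.
  move=> [/= h1 h2]; apply: sub; split => /=.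
    by move: h1; rewrite /= !in_itv/= => /andP[/ltW -> /ltW ->].
  by move: h2; rewrite /= !in_itv/= => /andP[/ltW -> /ltW ->].
have [e e0 sub] := oU x Ux.
have rat_near (t : R) : exists a b : rat,
    [/\ t - e < ratr a, ratr a < t, t < ratr b & ratr b < t + e].
  have [a] := @rat_in_itvoo R (t - e) t (ltac:(lra)).
  have [b] := @rat_in_itvoo R t (t + e) (ltac:(lra)).
  rewrite !in_itv/= => /andP[b1 b2] /andP[a1 a2].
  by exists a, b.
have [a [b [a1 a2 b1 b2]]] := rat_near x.1.
have [c [d [c1 c2 d1 d2]]] := rat_near x.2.
exists (pickle (a, b, c, d)); last first.
  by rewrite pickleK; split; rewrite /= in_itv/= ?a2 ?c2.
exists (a, b, c, d); first by rewrite pickleK.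
move=> y [/= y1 y2]; move: y1 y2; rewrite /= !in_itv/=.
move=> /andP[y1 y2] /andP[y3 y4].
by apply: sub; rewrite ltr_norml; apply/andP; split; lra.
Qed.

Lemma measurable_orect q : measurable (orect q).
Proof. by apply: measurableX; exact: measurable_itv. Qed.

Lemma open_measurable2 (U : set (plane R)) : open U -> measurable U.
Proof.
move=> /open_rects ->; rewrite bigcup_mkcond; apply: bigcupT_measurable => n.
by case: ifP => // _; case: unpickle => // q; exact: measurable_orect.
Qed.

Lemma continuous_measurable2 (D : set (plane R)) (f : plane R -> R) :
  continuous f -> measurable_fun D f.
Proof.
move=> cf; apply: measurable_funTS.
apply: (measurability _ (RGenOpens.measurableE R)).
move=> _ [_ [a [b ->] <-]]; rewrite setTI; apply: open_measurable2.
by move/continuousP : cf; apply; exact: interval_open.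
Qed.

(** Lebesgue measure is determined by the lengths of intervals, which translations
    preserve. *)
Lemma ge0_integral_shift1 (F : R -> \bar R) (h : R) :
  measurable_fun setT F -> (forall x, (0 <= F x)%E) ->
  (\int[lebesgue_measure]_x F (x + h)%R = \int[lebesgue_measure]_x F x)%E.
Proof.
move=> mF F0.
have mh : measurable_fun setT (fun x : R => x + h).
  by apply: measurable_funD.
rewrite [LHS](_ : _ = \int[pushforward lebesgue_measure
    (fun x : measurableTypeR R => (x + h : measurableTypeR R)%R)]_x F x)%E; last first.
  by rewrite ge0_integral_pushforward.
apply: eq_measure_integral => //= A mA _; apply/esym.
apply: lebesgue_measure_unique => //= _ [[a b]] _ <-.
rewrite /pushforward/= (_ : _ @^-1` _ = `](a - h), (b - h)]%classic); last first.
  by apply/seteqP; split => x /=; rewrite !in_itv/= ltrBlDr lerBrDr.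
rewrite !lebesgue_measure_itv/= !lte_fin ltrD2r; case: ifP => // _.
by rewrite -!EFinB; congr EFin; ring.
Qed.

Lemma ge0_integral_plane (F : plane R -> \bar R) :
  measurable_fun setT F -> (forall x, (0 <= F x)%E) ->
  (\int[mu2 R]_x F x =
   \int[lebesgue_measure]_a \int[lebesgue_measure]_b F (a, b))%E.
Proof. by move=> mF F0; rewrite -smu2E (fubini_tonelli1 _ mF F0). Qed.

Definition shift2 (h x : plane R) : plane R := (x.1 + h.1, x.2 + h.2).

Lemma measurable_shift2 h : measurable_fun setT (shift2 h).
Proof.
apply: measurable_fun_pair; apply: measurable_funD => //;
  by [exact: measurable_fst | exact: measurable_snd].
Qed.

Lemma ge0_integral_shift2 (F : plane R -> \bar R) (h : plane R) :
  measurable_fun setT F -> (forall x, (0 <= F x)%E) ->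
  (\int[mu2 R]_x F (shift2 h x) = \int[mu2 R]_x F x)%E.
Proof.
move=> mF F0.
have mFs : measurable_fun setT (F \o shift2 h).
  exact: (measurableT_comp mF (measurable_shift2 h)).
have /= -> := ge0_integral_plane mFs (fun x => F0 _).
rewrite (ge0_integral_plane mF F0).
have mF1 a : measurable_fun setT (fun b => F (a, b)).
  by apply: (measurableT_comp mF); exact: pair1_measurable.
pose G a := (\int[lebesgue_measure]_b F (a, b))%E.
have mG : measurable_fun setT G.
  exact: (@measurable_fun_fubini_tonelli_F _ _ _ _ _ (@lebesgue_measure R)).
rewrite -[RHS](ge0_integral_shift1 h.1 mG); last by move=> a; exact: integral_ge0.
apply: eq_integral => a _; rewrite /shift2/= /G.
by rewrite (ge0_integral_shift1 h.2 (mF1 _)).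
Qed.

Lemma vline_null (c : R) : (mu2 R).-negligible [set x : plane R | x.1 = c].
Proof.
exists ([set c] `*` setT); split.
- by apply: measurableX => //; exact: measurable_set1.
- rewrite [LHS](leb2X (measurable_set1 c) measurableT).
  by rewrite lebesgue_measure_set1 mul0e.
- by move=> x /= ->.
Qed.

(** Each vertical section of the line is a point. *)
Lemma graph_null (k c : R) :
  (mu2 R).-negligible [set x : plane R | x.2 = k * x.1 + c].
Proof.
pose A := [set x : plane R | x.2 - k * x.1 - c = 0].
have mf : measurable_fun setT (fun x : plane R => x.2 - k * x.1 - c).
  by apply: measurable_funB => //; apply: measurable_funB => //; exact: measurable_funM.
have mA : measurable A.
  by have := mf measurableT _ (measurable_set1 0); rewrite setTI.
exists A; split => //; last by move=> x /= h; rewrite /A/= h; ring.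
have e := integral_indic (mu2 R) measurableT mA; rewrite setIT in e.
have mI : measurable_fun setT (fun x : plane R => (\1_A x : R)%:E).
  by apply/measurable_EFinP; exact: measurable_indic.
rewrite -e (ge0_integral_plane mI (fun x => ltac:(by rewrite lee_fin))) {e mI}.
transitivity (\int[@lebesgue_measure R]_(a in setT) (cst 0%E : _ -> \bar R) a)%E; last by rewrite integral0.
apply: eq_integral => a _ /=.
transitivity (\int[@lebesgue_measure R]_b (\1_([set k * a + c]) b)%:E)%E.
  apply: eq_integral => b _; congr EFin; rewrite !indicE; congr (_%:R); congr nat_of_bool.
  by apply/idP/idP; rewrite !inE /A/= => h; [lra | rewrite h; ring].
have := integral_indic (@lebesgue_measure R) measurableT (measurable_set1 (k * a + c)).
by rewrite setIT => ->; exact: lebesgue_measure_set1.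
Qed.

Lemma line_null (a b c : R) : (a != 0) || (b != 0) ->
  (mu2 R).-negligible [set x : plane R | a * x.1 + b * x.2 = c].
Proof.
have [->|b0] := eqVneq b 0.
  rewrite orbF => a0; apply: negligibleS (vline_null (c / a)) => x /=.
  by rewrite mul0r addr0 => <-; rewrite mulrAC divff// mul1r.
move=> _; apply: negligibleS (graph_null (- a / b) (c / b)) => x /= <-.
by field.
Qed.

End plane_measure.

(** * Smooth functions of the plane *)
Section flat.
Context {R : realType}.

(** The derivatives of exp(-1/t) on the right half-line are combinations of
    these functions, whence a class stable under derivation. *)
Definition flat (k : nat) (t : R) : R :=
  if 0 < t then (t^-1) ^+ k * expR (- t^-1) else 0.

Lemma flat_ge0 k t : 0 <= flat k t.
Proof.
rewrite /flat; case: ifP => // t0.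
by rewrite mulr_ge0 ?expR_ge0// exprn_ge0// invr_ge0 ltW.
Qed.

(** The exponential of 1/t dominates the power of order k + 1 of 1/t. A
    bound linear in t is enough for the derivative at 0. *)
Lemma flat_bound k t : `|flat k t| <= (k.+1)`!%:R * `|t|.
Proof.
rewrite ger0_norm ?flat_ge0// /flat; case: ifP => t0; last first.
  by rewrite mulr_ge0 ?ler0n.
rewrite (gtr0_norm t0); set u := t^-1.
have u0 : 0 < u by rewrite invr_gt0.
have h := @expR_ge1Dxn R u k (ltW u0).
have f0 : 0 < (k.+1)`!%:R :> R by rewrite ltr0n fact_gt0.
have e0 := expR_gt0 u.
rewrite expRN -(invrK t) -/u ler_pdivrMr// mulrAC ler_pdivlMr// -exprSr.
rewrite -ler_pdivrMl//; apply: le_trans h; rewrite mulrC; lra.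
Qed.

Lemma is_derive_flat k (t : R) :
  is_derive t 1 (flat k) (- k%:R * flat k.+1 t + flat k.+2 t).
Proof.
have [t0|t0|->] := ltgtP t 0.
- have -> : - k%:R * flat k.+1 t + flat k.+2 t = 0.
    by rewrite /flat ltNge (ltW t0)/= mulr0 addr0.
  apply: (@near_eq_is_derive _ _ _ (cst 0 : R -> R) _ t 1 0 _ (is_derive_cst (0 : R) t (1 : R))).
  near=> s; rewrite /flat ltNge; have -> // : s <= 0.
  by apply/ltW; near: s; exact: lt_nbhsl.
- pose g := (fun s : R => (s^-1) ^+ k * expR (- s^-1)).
  apply: (@near_eq_is_derive _ _ _ g _ t 1).
    near=> s; rewrite /flat; have -> // : 0 < s.
    by near: s; exact: lt_nbhsr.
  have t00 : t != 0 by rewrite gt_eqF.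
  have dinv : is_derive t 1 (fun s : R => s^-1) (- (t^-1) ^+ 2).
    have := @is_deriveV R id t 1 1 t00 (@is_derive_id _ _ _ _).
    by move/is_derive_eq; apply; rewrite /GRing.scale/= mulr1 exprVn.
  have dX := @is_deriveX _ _ _ k _ _ _ dinv.
  have dN := @is_deriveN _ _ _ _ _ _ _ dinv.
  have dE := @is_derive1_comp R expR (fun s => - s^-1) t _ _ (is_derive_expR (- t^-1)) dN.
  have := @is_deriveM _ _ _ _ _ _ _ _ dX dE.
  rewrite (_ : _ * _ = g); last by apply/funext => s; rewrite /g !fctE /=; elim: (k).
  move/is_derive_eq; apply; rewrite /flat t0 /GRing.scale/= !fctE/=.
  clear g dX dinv dN dE; move: (t^-1) => u; case: k => [|k].
    by rewrite oppr0 !mul0r mulr0 addr0 add0r expr0 !exprS expr0; ring.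
  by rewrite -pred_Sn !exprS; ring.
- have -> : - k%:R * flat k.+1 0 + flat k.+2 0 = 0.
    by rewrite /flat ltxx mulr0 addr0.
  (* The difference quotients at 0 of flat k are the values of flat (k + 1). *)
  have e : (fun h : R => h^-1 *: ((flat k \o shift 0) (h *: 1) - flat k 0)) = flat k.+1.
    apply/funext => h; rewrite /= addr0 /GRing.scale/= mulr1 /flat ltxx subr0.
    by case: ifP => _; rewrite ?mulr0// exprS mulrA.
  have lim0 : flat k.+1 h @[h --> 0^'] --> (0 : R).
    apply/cvgr0Pnorm_le => e0 e0p.
    have c0 : 0 < (k.+2)`!%:R :> R by rewrite ltr0n fact_gt0.
    near=> h; apply: le_trans (flat_bound _ _) _.
    rewrite -ler_pdivlMl//.
    near: h; apply: dnbhs0_le; rewrite mulr_gt0// invr_gt0//.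
  by apply: DeriveDef; [apply/cvg_ex; exists 0; rewrite e | rewrite /derive e; exact: cvg_lim].
Unshelve. all: by end_near. Qed.

End flat.

(** * Calculus of smooth functions *)
Section smooth.
Context {R : realType}.
Local Notation plane := (plane R).
Implicit Types (f g : plane -> R) (w : seq bool) (b : bool).

Lemma pderiv_cat w1 w2 f : pderiv (w1 ++ w2) f = pderiv w1 (pderiv w2 f).
Proof. by rewrite /pderiv foldr_cat. Qed.

Lemma pderiv_rcons w b f : pderiv (rcons w b) f = pderiv w (pderiv [:: b] f).
Proof. by rewrite -cats1 pderiv_cat. Qed.

Lemma smooth_pderiv w f : smooth f -> smooth (pderiv w f).
Proof. by move=> sf w' x; rewrite -pderiv_cat; exact: sf. Qed.

Lemma smooth_differentiable f x : smooth f -> differentiable f x.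
Proof. by move=> /(_ [::] x). Qed.

Lemma smooth_continuous f : smooth f -> continuous f.
Proof. by move=> sf x; exact/differentiable_continuous/smooth_differentiable. Qed.

Lemma smooth_measurable D f : smooth f -> measurable_fun D f.
Proof. by move=> sf; apply: continuous_measurable2; exact: smooth_continuous. Qed.

Definition coordinate b (x : plane) : R := if b then x.2 else x.1.

Lemma differentiable_coordinate b x : differentiable (coordinate b) x.
Proof.
by case: b; [apply: (@linear_differentiable _ _ _ snd) |
  apply: (@linear_differentiable _ _ _ fst)] => z; [exact: cvg_snd|exact: cvg_fst].
Qed.

Lemma derive_coordinate b v x : 'D_v (coordinate b) x = coordinate b v.
Proof.
rewrite deriveE; last exact: differentiable_coordinate.
by case: b; [rewrite (@diff_lin _ _ _ snd) | rewrite (@diff_lin _ _ _ fst)] => // z;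
 [exact: cvg_snd|exact: cvg_fst].
Qed.

Lemma differentiable_flat k t : differentiable (flat k : R -> R) t.
Proof. by apply/derivable1_diffP; case: (is_derive_flat k t). Qed.

Lemma derive_flat_comp k f v x : differentiable f x ->
  'D_v (fun y => flat k (f y)) x =
  (- k%:R * flat k.+1 (f x) + flat k.+2 (f x)) * 'D_v f x.
Proof.
move=> df; have dF := differentiable_flat k (f x).
rewrite (deriveE _ (differentiable_comp df dF)) diff_comp//= diff1E// derive1E.
by rewrite (@derive_val _ _ _ _ _ _ _ (is_derive_flat k (f x))) -(deriveE v df) /GRing.scale/= mulrC.
Qed.

(** Smoothness asks for differentiability of all iterated derivatives at once,
    which no induction on the function gives directly. Membership in a class
    that is stable under partial derivatives is inherited by all of them. *)
Inductive smooth_class : (plane -> R) -> Prop :=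
| sc_smooth f : smooth f -> smooth_class f
| sc_cst c : smooth_class (fun=> c)
| sc_coordinate b : smooth_class (coordinate b)
| sc_add f g : smooth_class f -> smooth_class g -> smooth_class (fun x => f x + g x)
| sc_mul f g : smooth_class f -> smooth_class g -> smooth_class (fun x => f x * g x)
| sc_flat k f : smooth_class f -> smooth_class (fun x => flat k (f x)).

Lemma smooth_class_step f : smooth_class f ->
  (forall x, differentiable f x) /\ forall b, smooth_class (pderiv [:: b] f).
Proof.
elim=> {f} [f sf|c|b|f g sf [df Df] sg [dg Dg]|f g sf [df Df] sg [dg Dg]|k f sf [df Df]].
- split=> [x|b]; first exact: smooth_differentiable.
  by apply: sc_smooth; exact: smooth_pderiv.
- split=> [x|b]; first exact: differentiable_cst.
  rewrite (_ : pderiv _ _ = fun=> 0); first exact: sc_cst.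
  by apply/funext => x /=; rewrite derive_cst.
- split=> [x|b']; first exact: differentiable_coordinate.
  rewrite (_ : pderiv _ _ = fun=> coordinate b (dir R b')); first exact: sc_cst.
  by apply/funext => x /=; rewrite derive_coordinate.
- split=> [x|b]; first exact: differentiableD.
  rewrite (_ : pderiv _ _ = fun x => pderiv [:: b] f x + pderiv [:: b] g x); first exact: sc_add.
  by apply/funext => x /=; rewrite deriveD//; exact: diff_derivable.
- split=> [x|b]; first exact: differentiableM.
  rewrite (_ : pderiv _ _ = fun x => f x * pderiv [:: b] g x + g x * pderiv [:: b] f x).
    by apply: sc_add; exact: sc_mul.
  by apply/funext => x /=; rewrite deriveM//; exact: diff_derivable.
- split=> [x|b]; first by apply: (differentiable_comp (df x)); exact: differentiable_flat.
  rewrite (_ : pderiv _ _ = fun x =>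
    (- k%:R * flat k.+1 (f x) + flat k.+2 (f x)) * pderiv [:: b] f x).
    apply: sc_mul => //; apply: sc_add; last exact: sc_flat.
    by apply: sc_mul; [exact: sc_cst | exact: sc_flat].
  by apply/funext => x /=; rewrite derive_flat_comp.
Qed.

Lemma smooth_classP f : smooth_class f -> smooth f.
Proof.
move=> sf w; suff : smooth_class (pderiv w f) by move=> /smooth_class_step[].
by elim: w => //= b w /smooth_class_step[_ /(_ b)].
Qed.

Lemma smooth_comb (a : R) f (b : R) g : smooth f -> smooth g -> smooth (comb a f b g).
Proof.
move=> sf sg; apply: smooth_classP; apply: sc_add; apply: sc_mul;
  by [exact: sc_cst | exact: sc_smooth].
Qed.

Lemma smoothM f g : smooth f -> smooth g -> smooth (fun x => f x * g x).
Proof. by move=> sf sg; apply: smooth_classP; apply: sc_mul; exact: sc_smooth. Qed.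

Lemma pderiv_comb w (a : R) f (b : R) g : smooth f -> smooth g ->
  pderiv w (comb a f b g) = comb a (pderiv w f) b (pderiv w g).
Proof.
move=> sf sg; elim: w => //= c w ->; apply/funext => x.
have df : derivable (pderiv w f) x (dir R c) by apply: diff_derivable; exact: sf.
have dg : derivable (pderiv w g) x (dir R c) by apply: diff_derivable; exact: sg.
rewrite (_ : comb _ _ _ _ = (a *: pderiv w f + b *: pderiv w g)%R)//.
etransitivity.
  exact: (deriveD (@derivableZ _ _ _ _ a _ _ df) (@derivableZ _ _ _ _ b _ _ dg)).
by congr (_ + _); [exact: (@deriveZ _ _ _ _ a _ _ df)|exact: (@deriveZ _ _ _ _ b _ _ dg)].
Qed.

Lemma pderivM1 b f g x : smooth f -> smooth g ->
  pderiv [:: b] (fun x => f x * g x) x =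
  f x * pderiv [:: b] g x + pderiv [:: b] f x * g x.
Proof.
move=> sf sg; rewrite /= (@deriveM _ _ f g); last 2 first.
- exact/diff_derivable/smooth_differentiable.
- exact/diff_derivable/smooth_differentiable.
by rewrite /GRing.scale/=; congr (_ + _); rewrite mulrC.
Qed.

Lemma is_derive_line f (x h : plane) (t : R) : smooth f ->
  is_derive t 1 (fun t : R => f (x.1 + t * h.1, x.2 + t * h.2))
    (h.1 * pderiv [:: false] f (x.1 + t * h.1, x.2 + t * h.2)
     + h.2 * pderiv [:: true] f (x.1 + t * h.1, x.2 + t * h.2)).
Proof.
move=> sf; set y := (_, _).
pose ell (t : R) : plane := t *: h + x.
have ellE s : ell s = (x.1 + s * h.1, x.2 + s * h.2).
  by rewrite /ell; case: (x) (h) => [x1 x2] [h1 h2] /=; congr pair; rewrite addrC.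
have df := smooth_differentiable y sf.
have fy : 'd f y h = h.1 * pderiv [:: false] f y + h.2 * pderiv [:: true] f y.
  have hE : h = h.1 *: dir R false + h.2 *: dir R true.
    by apply: injective_projections; rewrite /dir/= /GRing.scale/= ?mulr0 ?mulr1 ?addr0 ?add0r.
  by rewrite {1}hE linearD !linearZ /= -!deriveE.
have der : is_derive y h f ('d f y h).
  by rewrite -deriveE//; apply/derivableP/diff_derivable.
have eq : (fun k : R => k^-1 *: (((fun t => f (x.1 + t * h.1, x.2 + t * h.2)) \o shift t) (k *: 1)
      - (fun t => f (x.1 + t * h.1, x.2 + t * h.2)) t)) =
    (fun k : R => k^-1 *: ((f \o shift y) (k *: h) - f y)).
  apply/funext => k; congr (_ *: (f _ - _)); rewrite /y.
  by apply: injective_projections; rewrite /= /GRing.scale/= mulr1 mulrDl addrCA addrA;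
    congr (_ + _); rewrite addrC.
rewrite -fy; case: der => d1 d2; apply: DeriveDef.
  by rewrite /derivable eq.
by rewrite /derive eq.
Qed.

End smooth.

(** * Test functions *)
Section test_functions.
Context {R : realType}.
Local Notation plane := (plane R).
Implicit Types (f g phi : plane -> R) (w : seq bool) (b : bool) (D : set plane).

Lemma compact_square (h : R) : compact (square h : set plane).
Proof. by apply: compact_setX; exact: segment_compact. Qed.

Lemma continuous_bounded_square f (h : R) : continuous f ->
  exists2 M, 0 <= M & forall x, square h x -> `|f x| <= M.
Proof.
move=> cf; have := @continuous_compact _ _ f (square h).
move=> /(_ (continuous_subspaceT cf) (compact_square (h := h))).
move=> /compact_bounded[M [_ /(_ (`|M| + 1))]] hM.
exists (`|M| + 1); first by rewrite addr_ge0.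
move=> x hx; apply: hM; last by exists x.
by rewrite (le_lt_trans (ler_norm _))// ltrDl.
Qed.

Lemma pderiv_zero_open (U : set plane) f w : open U -> (forall x, U x -> f x = 0) ->
  forall x, U x -> pderiv w f x = 0.
Proof.
move=> oU f0; elim: w => [|b w IH] x Ux /=; first exact: f0.
rewrite -[RHS](derive_cst (0 : R) x (dir R b)).
apply: near_eq_derive; near=> y; apply: IH; near: y; exact: oU.
Unshelve. all: by end_near. Qed.

Lemma pderiv_support f w (x : plane) :
  ~ closure [set x | f x != 0] x -> pderiv w f x = 0.
Proof.
move=> hx; apply: (@pderiv_zero_open (~` closure [set x | f x != 0])) => //.
  by apply: closed_openC; exact: closed_closure.
move=> y hy; apply/eqP; apply: contrapT => /negP fy; apply: hy.
exact: subset_closure.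
Qed.

Lemma test_smooth D phi : test_function D phi -> smooth phi.
Proof. by case. Qed.

Lemma test_outside D phi w x : test_function D phi -> ~ D x -> pderiv w phi x = 0.
Proof. by move=> [_ _ sub] Dx; apply: pderiv_support => /sub. Qed.

Lemma test_mono D D' phi : D `<=` D' -> test_function D phi -> test_function D' phi.
Proof. by move=> DD' [? ? sub]; split => //; exact: subset_trans DD'. Qed.

Lemma test_square D phi : test_function D phi ->
  exists2 h : R, 0 < h & forall w x, ~ square h x -> pderiv w phi x = 0.
Proof.
move=> [_ /compact_bounded[M [_ /(_ (`|M| + 1))]] hM _].
exists (`|M| + 1); first by rewrite ltr_wpDl.
move=> w x hx; apply: pderiv_support => cx; apply: hx; apply/squareP.
have := hM _ x cx; rewrite (le_lt_trans (ler_norm _)) ?ltrDl// => /(_ isT).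
by rewrite /= {1}/Num.norm/= ge_max => /andP[].
Qed.

Lemma test_pderiv D phi w : test_function D phi -> test_function D (pderiv w phi).
Proof.
move=> [sp cp sub].
have cc : closure [set x | pderiv w phi x != 0] `<=` closure [set x | phi x != 0].
  rewrite closureE; apply: smallest_sub; first exact: closed_closure.
  move=> x /= h; apply: contrapT => hx; move: h.
  by rewrite (pderiv_support _ hx) eqxx.
split; [exact: smooth_pderiv | | exact: subset_trans sub].
by apply: (subclosed_compact _ cp) => //; exact: closed_closure.
Qed.

Lemma test_bounded D phi : test_function D phi ->
  exists2 M, 0 <= M & forall x, `|phi x| <= M.
Proof.
move=> tp; have [h h0 hh] := test_square tp.
have [M M0 hM] := continuous_bounded_square h (smooth_continuous (test_smooth tp)).
exists M => // x; have [hx|hx] := pselect (square h x); first exact: hM.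
by have /= -> := hh [::] x hx; rewrite normr0.
Qed.

Lemma closure_support_sub f (K : set plane) : closed K ->
  (forall x, ~ K x -> f x = 0) -> closure [set x | f x != 0] `<=` K.
Proof.
move=> cK f0; rewrite closureE; apply: smallest_sub => // x /= fx; apply: contrapT => /f0 e.
by move: fx; rewrite e eqxx.
Qed.

Lemma test_comb D (a : R) f (b : R) g : test_function D f -> test_function D g ->
  test_function D (comb a f b g).
Proof.
move=> [sf cf subf] [sg cg subg].
have cc : closure [set x | comb a f b g x != 0] `<=`
    closure [set x | f x != 0] `|` closure [set x | g x != 0].
  apply: closure_support_sub; first by apply: closedU; exact: closed_closure.
  move=> x /not_orP[fx gx]; rewrite /comb.
  have /= -> := @pderiv_support f [::] x fx; have /= -> := @pderiv_support g [::] x gx.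
  by rewrite !mulr0 addr0.
split; [exact: smooth_comb | | by apply: (subset_trans cc) => x [/subf|/subg]].
apply: (subclosed_compact _ _ cc); first exact: closed_closure.
exact: compactU.
Qed.

Definition dilate (c : plane) (r : R) (y : plane) : plane :=
  ((y.1 - c.1) / r, (y.2 - c.2) / r).

(** Reduces directional derivatives to one variable, where the chain rule for
    a dilation is a rule for scaling. *)
Lemma derive_lineE f (y v : plane) :
  'D_v f y = 'D_1 (fun t : R => f (y.1 + t * v.1, y.2 + t * v.2)) 0.
Proof.
have eq : (fun k : R => k^-1 *: ((f \o shift y) (k *: v) - f y)) =
    (fun k : R => k^-1 *: (((fun t => f (y.1 + t * v.1, y.2 + t * v.2)) \o shift 0) (k *: 1)
      - (fun t => f (y.1 + t * v.1, y.2 + t * v.2)) 0)).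
  apply/funext => k; congr (_ *: (f _ - f _)); last by rewrite !mul0r !addr0; case: (y).
  rewrite /= addr0 /GRing.scale/= mulr1.
  by apply: injective_projections; rewrite /= addrC.
by rewrite /derive eq.
Qed.

Lemma pderiv_dilate c r f w y : smooth f ->
  pderiv w (f \o dilate c r) y = (r^-1) ^+ size w * pderiv w f (dilate c r y).
Proof.
move=> sf; elim: w y => [|b w IH] y /=; first by rewrite mul1r.
rewrite (_ : pderiv w (f \o dilate c r) =
   (fun z => (r^-1) ^+ size w * pderiv w f (dilate c r z))); last exact/funext.
set g := pderiv w f; have sg : smooth g by exact: smooth_pderiv.
rewrite derive_lineE.
have d := @is_derive_line _ g (dilate c r y)
  ((dir R b).1 / r, (dir R b).2 / r) 0 sg.
have -> : (fun t : R => (r^-1) ^+ size w *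
      g (dilate c r (y.1 + t * (dir R b).1, y.2 + t * (dir R b).2))) =
   ((r^-1) ^+ size w \*: (fun t : R => g ((dilate c r y).1 + t * ((dir R b).1 / r, (dir R b).2 / r).1,
        (dilate c r y).2 + t * ((dir R b).1 / r, (dir R b).2 / r).2)))%R.
  apply/funext => t; rewrite /dilate/= /GRing.scale/=; congr (_ * g _).
  by congr pair; rewrite addrAC mulrDl mulrA.
rewrite deriveZ ?derive_val; last by case: d.
rewrite /GRing.scale/= !mul0r !addr0 exprSr -[RHS]mulrA; congr (_ * _).
by rewrite /dilate; case: (b); rewrite /= !(mul0r, mul1r, add0r, addr0).
Qed.

Lemma flat0_le1 (t : R) : flat 0 t <= 1.
Proof.
rewrite /flat; case: ifP => // t0.
by rewrite expr0 mul1r expR_le1// oppr_le0 invr_ge0 ltW.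
Qed.

Lemma flat0_0 (t : R) : t <= 0 -> flat 0 t = 0.
Proof. by rewrite /flat leNgt => /negbTE ->. Qed.

(** With corners p and q, a product of four one-sided cut-offs, one for each
    side; as l grows they become steps. *)
Definition cutoff (p q : plane) (l : R) (x : plane) : R :=
  flat 0 (l * (x.1 + - p.1)) * flat 0 (l * (q.1 + - 1 * x.1)) *
  (flat 0 (l * (x.2 + - p.2)) * flat 0 (l * (q.2 + - 1 * x.2))).

Lemma smooth_cutoff p q l : smooth (cutoff p q l).
Proof.
apply: smooth_classP; apply: sc_mul; apply: sc_mul; apply: sc_flat;
  apply: sc_mul; try exact: sc_cst; apply: sc_add; try exact: sc_cst;
  try apply: sc_mul; try exact: sc_cst;
  by [exact: (sc_coordinate false) | exact: (sc_coordinate true)].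
Qed.

Lemma smooth_cutoff_dilate p q l c r : smooth (cutoff p q l \o dilate c r).
Proof.
apply: smooth_classP; apply: sc_mul; apply: sc_mul; apply: sc_flat;
  apply: sc_mul; try exact: sc_cst; apply: sc_add; try exact: sc_cst;
  try (apply: sc_mul; try exact: sc_cst); try (apply: sc_mul; try exact: sc_cst);
  apply: sc_add; try exact: sc_cst;
  by [exact: (sc_coordinate false) | exact: (sc_coordinate true)].
Qed.

Lemma cutoff_ge0 p q l x : 0 <= cutoff p q l x.
Proof. by rewrite /cutoff !mulr_ge0// flat_ge0. Qed.

Lemma cutoff_le1 p q l x : cutoff p q l x <= 1.
Proof. by rewrite /cutoff; rewrite !mulr_ile1 ?mulr_ge0 ?flat_ge0 ?flat0_le1. Qed.

Lemma cutoff_outside p q l x : 0 <= l -> ~ (`[p.1, q.1] `*` `[p.2, q.2])%classic x ->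
  cutoff p q l x = 0.
Proof.
move=> l0; have z t : t <= 0 -> flat 0 (l * t) = 0.
  by move=> t0; apply: flat0_0; rewrite mulr_ge0_le0.
rewrite /cutoff !mulN1r => h.
have [h1|h1] := lerP x.1 p.1; first by rewrite z ?mul0r// subr_le0.
have [h2|h2] := lerP q.1 x.1; first by rewrite [X in _ * X * _]z ?mulr0 ?mul0r// subr_le0.
have [h3|h3] := lerP x.2 p.2.
  by rewrite [X in _ * _ * (X * _)]z ?mul0r ?mulr0// subr_le0.
have [h4|h4] := lerP q.2 x.2.
  by rewrite [X in _ * _ * (_ * X)]z ?mulr0// subr_le0.
by exfalso; apply: h; split; rewrite /= in_itv/= ltW//= ltW.
Qed.

Lemma closed_rect (p q : plane) : closed ((`[p.1, q.1] `*` `[p.2, q.2])%classic : set plane).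
Proof.
apply: compact_closed; first exact: norm_hausdorff.
by apply: compact_setX; exact: segment_compact.
Qed.

Lemma test_cutoff (D : set plane) p q l : 0 <= l ->
  (`[p.1, q.1] `*` `[p.2, q.2])%classic `<=` D -> test_function D (cutoff p q l).
Proof.
move=> l0 sub.
have cc : closure [set x | cutoff p q l x != 0] `<=` (`[p.1, q.1] `*` `[p.2, q.2])%classic.
  by apply: closure_support_sub; [exact: closed_rect | move=> x; exact: cutoff_outside].
split; [exact: smooth_cutoff | | exact: subset_trans sub].
apply: (subclosed_compact _ _ cc); first exact: closed_closure.
by apply: compact_setX; exact: segment_compact.
Qed.

Lemma flat0_cvg (t : R) : (fun n => flat 0 (n%:R * t)) @ \oo --> ((0 < t)%R%:R : R).
Proof.
have [t0|t0] := ltP 0 t; last first.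
  rewrite (_ : (fun n => _) = cst 0); first exact: cvg_cst.
  by apply/funext => n; rewrite flat0_0// mulr_ge0_le0.
have -> : (true%:R : R) = expR (- (0 * t^-1)) by rewrite mul0r oppr0 expR0.
have h : (fun n : nat => expR (- (n%:R^-1 * t^-1))) @ \oo --> expR (- (0 * t^-1) : R).
  apply: (@cvg_comp _ _ _ _ expR); last exact: continuous_expR.
  apply: cvgN; apply: cvgM; last exact: cvg_cst.
  by rewrite -(cvg_shiftS (fun n : nat => n%:R^-1 : R)); exact: cvg_harmonic.
apply: cvg_trans h; apply: near_eq_cvg; near=> n.
have n0 : (0 < n)%N by near: n; exists 1%N.
by rewrite /flat mulr_gt0 ?ltr0n// expr0 mul1r invfM.
Unshelve. all: by end_near. Qed.

Lemma cutoff_cvg p q x : (fun n => cutoff p q n%:R x) @ \oo -->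
  (\1_((`]p.1, q.1[ `*` `]p.2, q.2[)%classic : set plane) x : R).
Proof.
have -> : (\1_((`]p.1, q.1[ `*` `]p.2, q.2[)%classic : set plane) x : R) =
   (0 < x.1 + - p.1)%R%:R * (0 < q.1 + -1 * x.1)%R%:R *
   ((0 < x.2 + - p.2)%R%:R * (0 < q.2 + -1 * x.2)%R%:R).
  rewrite -!natrM !mulnb indicE; congr (_%:R); congr nat_of_bool.
  rewrite !mulN1r !subr_gt0; apply/idP/idP.
    by rewrite inE => -[] /=; rewrite !in_itv/= => -> ->.
  by move=> h; rewrite inE; split; rewrite /= in_itv/=; case/andP: h.
by apply: cvgM; apply: cvgM; exact: flat0_cvg.
Qed.

End test_functions.

(** * Weak derivatives are unique *)
Section fundamental.
Context {R : realType}.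
Local Notation plane := (plane R).
Local Notation mu2 := (mu2 R).

Definition rect (p q : plane) : set plane :=
  (`]p.1, q.1[ `*` `]p.2, q.2[)%classic.

Definition rects : set (set plane) := [set A | exists p q, A = rect p q].

Lemma measurable_rect p q : measurable (rect p q).
Proof. by apply: measurableX; exact: measurable_itv. Qed.

Lemma rectI p q p' q' : rect p q `&` rect p' q' =
  rect (Num.max p.1 p'.1, Num.max p.2 p'.2) (Num.min q.1 q'.1, Num.min q.2 q'.2).
Proof.
apply/seteqP; split => x; rewrite /rect /setX /= !in_itv/= !gt_max !lt_min.
  by move=> [[/andP[-> ->] /andP[-> ->]] [/andP[-> ->] /andP[-> ->]]].
by move=> [/andP[/andP[-> ->] /andP[-> ->]] /andP[/andP[-> ->] /andP[-> ->]]].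
Qed.

Lemma setI_closed_rects : setI_closed rects.
Proof. by move=> _ _ [p [q ->]] [p' [q' ->]]; rewrite rectI; do 2 eexists. Qed.

(** The rectangles are stable under intersection, as an induction on measurable
    sets needs; the strips that generate the product are unions of them. *)
Lemma measurable_plane_rects : @measurable _ plane = <<s rects >>.
Proof.
apply/seteqP; split; last first.
  by apply: smallest_sub; [exact: sigma_algebra_measurable|
    move=> _ [p [q ->]]; exact: measurable_rect].
rewrite measurable_prod_measurableType; apply: smallest_sub.
  exact: smallest_sigma_algebra.
pose S := g_sigma_algebraType rects.
have m1 : measurable_fun setT (fst : S -> measurableTypeR R).
  apply: (measurability _ (RGenOpens.measurableE R)).
  move=> _ [_ [a [b ->] <-]]; rewrite setTI.
  rewrite (_ : _ @^-1` _ = \bigcup_n rect (a, - n%:R) (b, n%:R)).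
    by apply: bigcupT_measurable => n; apply: sub_sigma_algebra; do 2 eexists.
  apply/seteqP; split=> x; rewrite /= ?in_itv /=; last first.
    by move=> [n _ [/=]]; rewrite /= in_itv.
  move=> h; exists (Num.trunc `|x.2|).+1 => //; split; rewrite /= in_itv//=.
  by rewrite -ltr_norml truncnS_gt.
have m2 : measurable_fun setT (snd : S -> measurableTypeR R).
  apply: (measurability _ (RGenOpens.measurableE R)).
  move=> _ [_ [a [b ->] <-]]; rewrite setTI.
  rewrite (_ : _ @^-1` _ = \bigcup_n rect (- n%:R, a) (n%:R, b)).
    by apply: bigcupT_measurable => n; apply: sub_sigma_algebra; do 2 eexists.
  apply/seteqP; split=> x; rewrite /= ?in_itv /=; last first.
    by move=> [n _ [_ /=]]; rewrite /= in_itv.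
  move=> h; exists (Num.trunc `|x.1|).+1 => //; split; rewrite /= in_itv//=.
  by rewrite -ltr_norml truncnS_gt.
move=> _ [A mA [B mB <-]].
have h1 := m1 measurableT _ mA; have h2 := m2 measurableT _ mB.
rewrite !setTI in h1 h2.
exact: (@measurableI _ S _ _ h1 h2).
Qed.

(** By Dynkin's induction the integral over every measurable set vanishes. *)
Lemma null_on_rects_ae (g : plane -> R) (Q : set plane) : measurable Q ->
  mu2.-integrable Q (EFin \o g) ->
  (\int[mu2]_(x in Q) (g x)%:E = 0)%E ->
  (forall p q, \int[mu2]_(x in rect p q `&` Q) (g x)%:E = 0)%E ->
  ae_eq mu2 Q g (cst 0).
Proof.
move=> mQ ig gQ g0.
have P (E : set plane) : measurable E -> (\int[mu2]_(x in E `&` Q) (g x)%:E = 0)%E.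
  rewrite measurable_plane_rects; move: E.
  apply: (@dynkin_induction _ _ rects (fun E => \int[mu2]_(x in E `&` Q) (g x)%:E = 0)%E).
  - exact: measurable_plane_rects.
  - exact: setI_closed_rects.
  - by rewrite setTI.
  - by move=> _ [p [q ->]].
  - move=> S mS PS; rewrite setIC -setDE.
    have mSQ : measurable (S `&` Q) by exact: measurableI.
    have mQS : measurable (Q `\` S) by exact: measurableD.
    have SQ : (S `&` Q) `|` (Q `\` S) = Q by rewrite setIC setUIDK.
    have := gQ; rewrite -{1}SQ integral_setU//.
    + by rewrite PS add0e.
    + by rewrite SQ; exact: (measurable_int mu2 ig).
    + by apply/disj_setPS => x [[Sx _] []].
  - move=> F mF tF PF; rewrite setI_bigcupl integral_bigcup//.
    + by rewrite eseries0.
    + exact: trivIset_setIr.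
    + by move=> k; exact: measurableI.
    + apply: (integrableS mQ) => //; last by move=> x [k _ []].
      by apply: bigcupT_measurable => k; exact: measurableI.
have h : ae_eq mu2 Q (EFin \o g) (cst 0%E).
  apply: integral_ae_eq => // E EQ mE.
  by rewrite integral0 -(P E mE); congr integral; rewrite setIidl.
by apply: filterS h => x h /h /= -[].
Qed.

Lemma square_finite (D : set plane) (h : R) : measurable D -> D `<=` square h ->
  (mu2 D < +oo)%E.
Proof.
move=> mD Dh; apply: (@le_lt_trans _ _ (mu2 (square `|h|))).
  apply: le_measure; rewrite ?inE//; first exact: measurable_square.
  move=> x /Dh /squareP[h1 h2]; apply/squareP.
  by split; [apply: le_trans h1 _ | apply: le_trans h2 _]; exact: ler_norm.
by change (leb2 (square `|h|) < +oo)%E; rewrite leb2_square ?ltry.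
Qed.

Lemma inL2_bounded (D : set plane) (h M : R) (f : plane -> R) :
  measurable D -> D `<=` square h -> measurable_fun D f ->
  (forall x, D x -> `|f x| <= M) -> inL2 mu2 D f.
Proof.
move=> mD Dh mf fM; split => //.
apply: (@le_lt_trans _ _ (\int[mu2]_(x in D) (M ^+ 2)%:E)%E).
  apply: ge0_le_integral => //.
  - by move=> x _; rewrite lee_fin sqr_ge0.
  - exact: measurable_sq.
  move=> x Dx; rewrite lee_fin -real_normK ?num_real// lerXn2r ?nnegrE//.
    exact: le_trans (fM x Dx).
  exact: fM.
by rewrite integral_cst// lte_mul_pinfty ?lee_fin ?sqr_ge0// (square_finite mD Dh).
Qed.

Lemma inL2_test (D E : set plane) h phi w : measurable D -> D `<=` square h ->
  test_function E phi -> inL2 mu2 D (pderiv w phi).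
Proof.
move=> mD Dh /(test_pderiv w) tphi; have [M _ hM] := test_bounded tphi.
apply: (inL2_bounded mD Dh (M := M)) => //.
exact: smooth_measurable (test_smooth tphi).
Qed.

Lemma inL2_integrable (D : set plane) h g : measurable D -> D `<=` square h ->
  inL2 mu2 D g -> mu2.-integrable D (EFin \o g).
Proof.
move=> mD Dh hg; have h1 : inL2 mu2 D (cst 1).
  by apply: (inL2_bounded mD Dh (M := 1)) => // x _; rewrite normr1.
apply: (@eq_integrable _ _ _ mu2 D mD (EFin \o (fun x => g x * cst 1 x))).
  by move=> x _ /=; rewrite mulr1.
exact: (integrable_prod mD hg h1).
Qed.

(** The cut-offs of a rectangle that lies with its closure in D are bounded test
    functions converging to its indicator, so g has integral 0 over it. Countably
    many such rectangles cover D. *)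
Lemma fundamental_lemma (D : set plane) h g : open D -> D `<=` square h ->
  inL2 mu2 D g -> (forall phi, test_function D phi -> ip mu2 D g phi = 0) ->
  ae_eq mu2 D g (cst 0).
Proof.
move=> oD Dh hg g0.
have mD := open_measurable2 oD.
have ig := inL2_integrable mD Dh hg.
have mg : measurable_fun D g by case: hg.
have R0 p q : (`[p.1, q.1] `*` `[p.2, q.2])%classic `<=` D ->
    (\int[mu2]_(x in rect p q) (g x)%:E = 0)%E.
  move=> sub.
  have rD : rect p q `<=` D.
    apply: subset_trans sub => x [/= h1 h2]; split => /=;
      by move: h1 h2; rewrite !in_itv/= => /andP[/ltW ? /ltW ?] /andP[/ltW ? /ltW ?]; apply/andP.
  have mr := measurable_rect p q.
  pose u n (x : plane) := (g x * cutoff p q n%:R x)%:E.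
  have iu n : (\int[mu2]_(x in D) u n x = 0)%E.
    have tb := @test_cutoff _ D p q n%:R (ler0n _ _) sub.
    have := g0 _ tb; rewrite /ip /Rintegral => e.
    have fin := integrable_fin_num mD (integrable_prod mD hg (inL2_test [::] mD Dh tb)).
    by rewrite -(fineK fin) /= e.
  have := @dominated_convergence _ _ _ mu2 D mD u
    (fun x => (g x * \1_(rect p q) x)%:E) (fun x => `|g x|%:E).
  case.
  - move=> n; apply/measurable_EFinP/measurable_funM => //.
    by apply: smooth_measurable; exact: smooth_cutoff.
  - by apply/measurable_EFinP/measurable_funM => //; exact: measurable_indic.
  - apply: aeW => x Dx; apply/fine_cvgP; split; first exact: nearW.
    by apply: cvgM; [exact: cvg_cst | exact: cutoff_cvg].
  - exact: (integrable_norm ig).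
  - apply: aeW => x n Dx /=; rewrite lee_fin normrM ler_piMr//.
    by rewrite ger0_norm ?cutoff_ge0// cutoff_le1.
  move=> _ _ lim; have : (\int[mu2]_(x in D) (g x * \1_(rect p q) x)%:E = 0)%E.
    rewrite -(cvg_lim (@ereal_hausdorff R) lim); apply: lim_near_cst => //.
    by apply: nearW => n; exact: iu.
  move=> <-; rewrite -[in LHS](setIidr rD) integral_mkcondr; apply: eq_integral => x _.
  by rewrite patchE indicE; case: ifP => _; rewrite ?mulr1 ?mulr0.
(* Sub-rectangles of orect q have their closures in D too. *)
have Q0 q : crect q `<=` D -> ae_eq mu2 (orect q : set plane) g (cst 0).
  move=> qD; pose P : plane := (ratr q.1.1.1, ratr q.1.2).
  pose Q : plane := (ratr q.1.1.2, ratr q.2).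
  have oD' : orect q `<=` D.
    apply: subset_trans qD => x [/= h1 h2]; split => /=;
      by move: h1 h2; rewrite /= !in_itv/= => /andP[/ltW ? /ltW ?] /andP[/ltW ? /ltW ?]; apply/andP.
  apply: null_on_rects_ae.
  - exact: measurable_orect.
  - by apply: (integrableS mD) => //; exact: measurable_orect.
  - exact: (R0 P Q qD).
  - move=> p p'; have -> : (orect q : set plane) = rect P Q by [].
    rewrite rectI; apply: R0; apply: subset_trans qD => x; rewrite /setX /= !in_itv/= !ge_max !le_min.
    by move=> [/and3P[/andP[_ h1] _ h2] /and3P[/andP[_ h3] _ h4]];
      split; rewrite /= in_itv/= ?h1 ?h3.
have cover n : ae_eq mu2 (if unpickle n is Some q then
    (if `[< crect q `<=` D >] then (orect q : set plane) else set0) else set0) g (cst 0).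
  case: unpickle => [q|]; last exact: aeW.
  by case: asboolP => [/Q0//|_]; exact: aeW.
have := ae_foralln cover; apply: filterS => x hx Dx.
move: (Dx); rewrite {1}(open_rects oD) => -[n [q e qD]]; rewrite e => qx.
by apply: (hx n); rewrite e; case: asboolP.
Qed.

End fundamental.

(** * Integration by parts *)
Section parts.
Context {R : realType}.
Local Notation plane := (plane R).
Local Notation mu2 := (mu2 R).

Lemma FTC_R (f F : R -> R) (a b : R) : a < b -> continuous f ->
  (forall t : R, is_derive t (1 : R) F (f t)) ->
  (\int[lebesgue_measure]_(t in `[a, b]) (f t)%:E = (F b - F a)%:E)%E.
Proof.
move=> ab cf dF; rewrite EFinB; apply: continuous_FTC2 => //.
- exact: continuous_subspaceT.
- have cF t : {for t, continuous F}.
    apply: differentiable_continuous; apply/derivable1_diffP.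
    by case: (dF t).
  split.
  + by move=> t _; case: (dF t).
  + by apply: cvg_at_right_filter; exact: cF.
  + by apply: cvg_at_left_filter; exact: cF.
- by move=> t _; rewrite derive1E; case: (dF t).
Qed.

Lemma is_derive_fst (f : plane -> R) (y t : R) : smooth f ->
  is_derive t (1 : R) (fun t => f (t, y)) (pderiv [:: false] f (t, y)).
Proof.
move=> sf; have := @is_derive_line _ f (0, y) (1, 0) t sf.
rewrite /= !mulr0 !addr0 mulr1 !mul0r !addr0 !add0r mul1r.
by under eq_fun do rewrite mulr0 addr0 mulr1 add0r.
Qed.

Lemma is_derive_snd (f : plane -> R) (x t : R) : smooth f ->
  is_derive t (1 : R) (fun t => f (x, t)) (pderiv [:: true] f (x, t)).
Proof.
move=> sf; have := @is_derive_line _ f (x, 0) (0, 1) t sf.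
rewrite /= !mulr0 !addr0 mulr1 !mul0r !add0r mul1r.
by under eq_fun do rewrite mulr0 addr0 mulr1 add0r.
Qed.

Lemma is_derive_continuous (F dF : R -> R) :
  (forall t : R, is_derive t (1 : R) F (dF t)) -> continuous F.
Proof.
move=> d t; apply: differentiable_continuous; apply/derivable1_diffP.
by case: (d t).
Qed.

Lemma integral_itv_support (f : R -> R) (a b : R) :
  (forall t, ~ (a <= t <= b) -> f t = 0) ->
  (\int[@lebesgue_measure R]_t (f t)%:E =
   \int[@lebesgue_measure R]_(t in `[a, b]) (f t)%:E)%E.
Proof.
move=> f0; rewrite [RHS]integral_mkcond; apply: eq_integral => t _.
rewrite patchE; case: ifPn => // /negP h; rewrite f0// => h2; apply: h.
by rewrite inE /= in_itv.
Qed.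

(** Integrate first along the lines parallel to the direction b, where the
    primitive vanishes at both ends. *)
Lemma integral_pderiv_test (E : set plane) phi b : test_function E phi ->
  (\int[mu2]_x (pderiv [:: b] phi x)%:E = 0)%E.
Proof.
move=> tphi; have [h h0 hh] := test_square tphi.
have sphi := test_smooth tphi.
set g := pderiv [:: b] phi.
have sg : smooth g by exact: smooth_pderiv.
have ig : (smu2 (R := R)).-integrable setT (EFin \o g).
  have i1 : mu2.-integrable (square h) (EFin \o g).
    apply: (inL2_integrable (h := h)) => //; first exact: measurable_square.
    by apply: (inL2_test (E := E) (h := h)) => //; exact: measurable_square.
  have := integrable_mkcond (EFin \o g) (measurable_square h).
  move=> /(_ mu2)[+ _] => /(_ i1).
  rewrite (_ : (EFin \o g) \_ (square h) = EFin \o g)//.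
  apply/funext => x; rewrite patchE; case: ifPn => // /negP hx.
  by rewrite /= /g hh// => ?; apply: hx; rewrite inE.
have h1 : - (h + 1) < h + 1 by lra.
case: b @g sg ig => g sg ig.
  rewrite -smu2E -(integral12_prod_meas1 ig).
  under eq_integral => x _.
    have -> : fubini_F (lebesgue_measure (R:=R)) (EFin \o g) x = 0%E.
      rewrite /fubini_F /= (@integral_itv_support (fun y => g (x, y)) (- (h + 1)) (h + 1)).
        rewrite (FTC_R h1 (is_derive_continuous (fun t => is_derive_snd x t sg))
                  (fun t => is_derive_snd x t sphi)).
        have z t : h < `|t| -> phi (x, t) = 0.
          move=> ht; apply: (hh [::]) => /squareP[_ /=].
          by rewrite leNgt ht.
        by rewrite !z ?subrr// ?normrN ger0_norm; lra.
      move=> t ht; apply: hh => /squareP[_ /=]; rewrite ler_norml => h2; apply: ht.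
      by move: h2 => /andP[h3 h4]; apply/andP; split; lra.
    over.
  by rewrite integral0.
rewrite -smu2E -(integral21_prod_meas1 ig).
under eq_integral => y _.
  have -> : fubini_G (lebesgue_measure (R:=R)) (EFin \o g) y = 0%E.
    rewrite /fubini_G /= (@integral_itv_support (fun x => g (x, y)) (- (h + 1)) (h + 1)).
      rewrite (FTC_R h1 (is_derive_continuous (fun t => is_derive_fst y t sg))
                (fun t => is_derive_fst y t sphi)).
      have z t : h < `|t| -> phi (t, y) = 0.
        move=> ht; apply: (hh [::]) => /squareP[/= + _].
        by rewrite leNgt ht.
      by rewrite !z ?subrr// ?normrN ger0_norm; lra.
    move=> t ht; apply: hh => /squareP[/= + _]; rewrite ler_norml => h2; apply: ht.
    by move: h2 => /andP[h3 h4]; apply/andP; split; lra.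
  over.
by rewrite integral0.
Qed.

Lemma test_mulr (E : set plane) f phi : smooth f -> test_function E phi ->
  test_function E (fun x => f x * phi x).
Proof.
move=> sf [sp cp sub].
have cc : closure [set x | f x * phi x != 0] `<=` closure [set x | phi x != 0].
  apply: closure_support_sub; first exact: closed_closure.
  by move=> x hx; have /= -> := @pderiv_support _ phi [::] x hx; rewrite mulr0.
split; [exact: smoothM | | exact: subset_trans sub].
by apply: (subclosed_compact _ cp) => //; exact: closed_closure.
Qed.

Lemma inL2_smooth (D : set plane) h f : measurable D -> D `<=` square h ->
  smooth f -> inL2 mu2 D f.
Proof.
move=> mD Dh sf; have [M _ hM] := continuous_bounded_square h (smooth_continuous sf).
by apply: (inL2_bounded mD Dh (M := M)); [exact: smooth_measurable | move=> x /Dh /hM].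
Qed.

(** The derivative of a product with a test function has integral zero. *)
Lemma parts (D : set plane) h f phi b : open D -> D `<=` square h ->
  smooth f -> test_function D phi ->
  ip mu2 D f (pderiv [:: b] phi) = - ip mu2 D (pderiv [:: b] f) phi.
Proof.
move=> oD Dh sf tphi; have mD := open_measurable2 oD.
have sphi := test_smooth tphi.
have tF := test_mulr sf tphi.
have L2 g : smooth g -> inL2 mu2 D g by exact: inL2_smooth mD Dh.
apply/eqP; rewrite -subr_eq0 opprK /ip -RintegralD//; last 2 first.
- apply: (integrable_prod mD); apply: L2 => //; exact: smooth_pderiv.
- apply: (integrable_prod mD); apply: L2 => //; exact: smooth_pderiv.
rewrite (@eq_Rintegral _ _ _ mu2 D (pderiv [:: b] (fun x => f x * phi x))); last first.
  by move=> x _; rewrite pderivM1.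
rewrite Rintegral_mkcond.
rewrite (_ : _ \_ D = pderiv [:: b] (fun x => f x * phi x)); last first.
  apply/funext => x; rewrite patchE; case: ifPn => // /negP hx.
  by rewrite (test_outside [:: b] tF)// => ?; apply: hx; rewrite inE.
by rewrite /Rintegral (integral_pderiv_test b tF).
Qed.

End parts.

(** * Weak derivatives *)
Section weak.
Context {R : realType}.
Local Notation plane := (plane R).
Local Notation mu2 := (mu2 R).
Variables (D : set plane) (h : R).
Hypotheses (oD : open D) (Dh : D `<=` square h).
Implicit Types (v g : plane -> R) (w : seq bool).

Let mD : measurable D. Proof. exact: open_measurable2. Qed.

Lemma is_wderivE w v g : is_wderiv D w v g <->
  inL2 mu2 D g /\ forall phi, test_function D phi ->
    ip mu2 D v (pderiv w phi) = (-1) ^+ size w * ip mu2 D g phi.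
Proof. by []. Qed.

Lemma inL2_testD phi w : test_function D phi -> inL2 mu2 D (pderiv w phi).
Proof. by move=> t; exact: inL2_test mD Dh t. Qed.

Lemma is_wderiv_unique w v g g' :
  is_wderiv D w v g -> is_wderiv D w v g' -> ae_eq mu2 D g g'.
Proof.
move=> [hg eg] [hg' eg'].
have h0 : ae_eq mu2 D (fun x => g x - g' x) (cst 0).
  apply: (fundamental_lemma oD Dh); first exact: inL2B.
  move=> phi tphi; have tL2 := inL2_testD [::] tphi.
  have e : (fun x => g x - g' x) = comb 1 g (-1) g'.
    by apply/funext => x; rewrite /comb mul1r mulN1r.
  rewrite e ip_combl//.
  have := eg phi tphi; rewrite (eg' phi tphi) => /(congr1 (fun x => (-1) ^+ size w * x)).
  rewrite !mulrA -!exprMn mulrNN mulr1 !expr1n !mul1r /ip => ->.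
  by rewrite mulN1r subrr.
apply: filterS h0 => x hx Dx; apply/eqP; rewrite -subr_eq0; apply/eqP; exact: hx.
Qed.

Lemma wderivP w v : (exists g, is_wderiv D w v g) -> is_wderiv D w v (wderiv D w v).
Proof. by move=> [g hg]; apply: (xgetPex (fun=> 0)); exists g. Qed.

Lemma wderiv_ae w v g : is_wderiv D w v g -> ae_eq mu2 D (wderiv D w v) g.
Proof.
move=> hg; have h1 : is_wderiv D w v (wderiv D w v) by apply: wderivP; exists g.
exact: is_wderiv_unique h1 hg.
Qed.

Lemma is_wderiv_comb w (a : R) v (b : R) v' g g' : inL2 mu2 D v -> inL2 mu2 D v' ->
  is_wderiv D w v g -> is_wderiv D w v' g' ->
  is_wderiv D w (comb a v b v') (comb a g b g').
Proof.
move=> hv hv' /is_wderivE[hg eg] /is_wderivE[hg' eg']; apply/is_wderivE; split.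
  exact: inL2_comb.
move=> phi tphi; have t1 := inL2_testD [::] tphi; have t2 := inL2_testD w tphi.
by rewrite !ip_combl// eg// eg'//; ring.
Qed.

Lemma is_wderiv_ae w v v' g : inL2 mu2 D v -> inL2 mu2 D v' -> ae_eq mu2 D v v' ->
  is_wderiv D w v g -> is_wderiv D w v' g.
Proof.
move=> hv hv' vv' /is_wderivE[hg eg]; apply/is_wderivE; split => // phi tphi.
rewrite -eg//; apply: ip_ae => //; try exact: inL2_testD.
  exact: ae_eq_sym.
exact: ae_eq_refl.
Qed.

Lemma wderiv_ae_eq w v v' : inL2 mu2 D v -> inL2 mu2 D v' -> ae_eq mu2 D v v' ->
  wderiv D w v = wderiv D w v'.
Proof.
move=> hv hv' vv'; rewrite /wderiv; congr xget; apply/seteqP; split => g /=.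
  exact: is_wderiv_ae.
by apply: is_wderiv_ae => //; exact: ae_eq_sym.
Qed.

Lemma is_wderiv_nil v : inL2 mu2 D v -> is_wderiv D [::] v v.
Proof. by move=> hv; apply/is_wderivE; split => // phi _; rewrite /= expr0 mul1r. Qed.

(** Each integration by parts moves the outermost derivative of the test
    function to f, so that the derivatives arrive in the reversed order. *)
Lemma is_wderiv_smooth w f : smooth f -> is_wderiv D w f (pderiv (rev w) f).
Proof.
move=> sf; apply/is_wderivE; split.
  by apply: (inL2_smooth mD Dh); exact: smooth_pderiv.
elim: w f sf => [|b w IH] f sf phi tphi; first by rewrite /= expr0 mul1r.
have tw := test_pderiv w tphi.
rewrite (_ : pderiv (b :: w) phi = pderiv [:: b] (pderiv w phi))//.
rewrite (parts b oD Dh sf tw) IH//; last exact: smooth_pderiv.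
rewrite rev_cons pderiv_rcons /= exprS; ring.
Qed.

(** Both sides of the defining identity are continuous in L2. *)
Lemma is_wderiv_closed w v g : inL2 mu2 D v -> inL2 mu2 D g ->
  (forall e : R, 0 < e -> exists v' g', [/\ inL2 mu2 D v', is_wderiv D w v' g',
     (sqint mu2 D (v' \- v)%R <= e%:E)%E & (sqint mu2 D (g' \- g)%R <= e%:E)%E]) ->
  is_wderiv D w v g.
Proof.
move=> hv hg lim; apply/is_wderivE; split => // phi tphi.
have t0 := inL2_testD [::] tphi; have tw := inL2_testD w tphi.
apply/eqP; rewrite -subr_eq0; apply/eqP.
set d := _ - _.
set c := ip mu2 D (pderiv w phi) (pderiv w phi) + ip mu2 D phi phi.
have c0 : 0 <= c by rewrite addr_ge0// ip_ge0.
have bound e : 0 < e -> d ^+ 2 <= 2 * e * c.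
  move=> e0; have [v' [g' [hv' /is_wderivE[hg' eg'] ve ge]]] := lim e e0.
  have hdv := inL2B mD hv' hv; have hdg := inL2B mD hg' hg.
  have e1 : d = (-1) ^+ size w * ip mu2 D (g' \- g)%R phi - ip mu2 D (v' \- v)%R (pderiv w phi).
    rewrite /d !combB !ip_combl// eg'//; ring.
  have h1 := ip_CS mD hdg t0; have h2 := ip_CS mD hdv tw.
  move: ve ge; rewrite !sqintE// !lee_fin => ve ge.
  have i0 := ip_ge0 mu2 D phi; have i1 := ip_ge0 mu2 D (pderiv w phi).
  have j1 : ip mu2 D (g' \- g)%R phi ^+ 2 <= e * ip mu2 D phi phi.
    by apply: le_trans h1 _; rewrite ler_wpM2r.
  have j2 : ip mu2 D (v' \- v)%R (pderiv w phi) ^+ 2 <= e * ip mu2 D (pderiv w phi) (pderiv w phi).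
    by apply: le_trans h2 _; rewrite ler_wpM2r.
  rewrite e1 /c; move: (ip mu2 D (g' \- g)%R phi) (ip mu2 D (v' \- v)%R (pderiv w phi)) j1 j2 => x y j1 j2.
  have s2 : ((-1) ^+ size w * x) ^+ 2 = x ^+ 2.
    by rewrite exprMn exprAC sqrrN expr1n expr1n mul1r.
  have := sqr_ge0 ((-1) ^+ size w * x + y).
  move: s2; set z := (-1) ^+ size w * x => s2 h3; nra.
apply/eqP; rewrite -sqrf_eq0; apply/eqP/le_anti; rewrite sqr_ge0 andbT.
apply/ler_addgt0Pr => e e0; rewrite add0r.
have d0 : 0 < e / (2 * (c + 1)) by rewrite divr_gt0// mulr_gt0//; lra.
apply: le_trans (bound _ d0) _.
rewrite mulrA mulrAC ler_pdivrMr; last lra.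
nra.
Qed.

End weak.

Lemma is_wderiv_sub (R : realType) (D D' : set (plane R)) w v g : open D -> open D' ->
  D' `<=` D -> is_wderiv D w v g -> is_wderiv D' w v g.
Proof.
move=> oD oD' sub [[mg hg] eg].
have mD := open_measurable2 oD; have mD' := open_measurable2 oD'.
have key f phi : test_function D' phi ->
    (\int[mu2 R]_(x in D') (f x * pderiv w phi x) = \int[mu2 R]_(x in D) (f x * pderiv w phi x))%R
  /\ (\int[mu2 R]_(x in D') (f x * phi x) = \int[mu2 R]_(x in D) (f x * phi x))%R.
  move=> tphi; split; rewrite -(setIidr sub) Rintegral_mkcondr; apply: eq_Rintegral => x _;
    rewrite patchE; case: ifPn => // /negP hx.
    by rewrite (test_outside w tphi) ?mulr0// => ?; apply: hx; rewrite inE.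
  by have /= -> := test_outside [::] tphi (x := x); rewrite ?mulr0// => ?; apply: hx; rewrite inE.
split.
  split; first exact: measurable_funS mg.
  apply: le_lt_trans hg; apply: ge0_subset_integral => //.
  - exact: measurable_sq.
  - by move=> x _; rewrite lee_fin sqr_ge0.
move=> phi tphi; have [-> _] := key v phi tphi; have [_ ->] := key g phi tphi.
by apply: eg; exact: test_mono tphi.
Qed.

(** * Difference quotients on convex sets *)
Lemma limn_einf_ge0 (R : realType) (u : (\bar R)^nat) :
  (forall n, 0 <= u n)%E -> (0 <= limn_einf u)%E.
Proof. by move=> u0; rewrite -[leLHS](limn_einf_cst 0%E); exact: lee_limn_einf. Qed.

Lemma measurable_limn_einf d (T : measurableType d) (R : realType)
    (D : set T) (f : (T -> \bar R)^nat) :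
  (forall n, measurable_fun D (f n)) -> measurable_fun D (fun x => limn_einf (f ^~ x)).
Proof.
move=> mf; rewrite (_ : (fun x => _) =
  (fun x => - limn_esup (fun n => - f n x))%E).
  apply: measurableT_comp => //; apply: measurable_fun_limn_esup => n.
  exact: measurableT_comp.
by apply/funext => x; rewrite limn_esupN oppeK.
Qed.

Section kernel.
Context {R : realType}.

(** The primitive is a power too, but it is not differentiable at 0: integrate
    over [H/n, H] and let n grow. *)
Lemma integral_power (theta H : R) : 0 <= theta < 1 -> 0 < H ->
  (\int[@lebesgue_measure R]_(t in `]0%R, H]) (t `^ (- theta))%:E
     <= (H `^ (1 - theta) / (1 - theta))%:E)%E.
Proof.
move=> /andP[th0 th1] H0.
have c0 : 0 < 1 - theta by lra.
pose f (t : R) := t `^ (- theta).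
have mf : measurable_fun setT (EFin \o f).
  by apply/measurable_EFinP; exact: measurable_powR.
pose A n : set R := `](H * (n.+1%:R)^-1), H]%classic.
have UA : \bigcup_n A n = `]0%R, H]%classic.
  apply/seteqP; split=> [t [n _]|t]; rewrite /A/= !in_itv/= => /andP[t1 t2].
    by rewrite t2 andbT (le_lt_trans _ t1)// mulr_ge0 ?invr_ge0// ltW.
  exists (Num.trunc (H / t)) => //; rewrite /= in_itv/= t2 andbT.
  by rewrite ltr_pdivrMr// -ltr_pdivrMl// mulrC truncnS_gt.
have mA n : measurable (A n) by exact: measurable_itv.
have ndA : {homo A : n m / (n <= m)%N >-> (n <= m)%O}.
  move=> n m nm; apply/subsetPset => t; rewrite /A/= !in_itv/= => /andP[t1 ->].
  rewrite andbT (le_lt_trans _ t1)// ler_wpM2l ?(ltW H0)// lef_pV2 ?posrE ?ltr0n//.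
  by rewrite ler_nat ltnS.
have := @ge0_nondecreasing_set_cvg_integral _ (measurableTypeR R) R A (EFin \o f) (@lebesgue_measure R)
  ndA mA (fun n => measurable_funTS (mf)) _.
rewrite UA => /(_ (fun n x _ => ltac:(by rewrite lee_fin powR_ge0))) lim.
rewrite -(cvg_lim (@ereal_hausdorff R) lim); apply: lime_le.
  by apply/cvg_ex; eexists; exact: lim.
apply: nearW => n.
pose e := H * n.+1%:R^-1.
have An : A n = `]e, H]%classic by [].
rewrite An.
have e0 : 0 < e by rewrite mulr_gt0// invr_gt0.
have [eH|eH] := leP H e.
  rewrite (_ : `]e, H]%classic = set0) ?integral_set0 ?lee_fin ?divr_ge0 ?powR_ge0 ?(ltW c0)//.
  apply/seteqP; split => // t; rewrite /= in_itv/= => /andP[h1 h2].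
  by have := lt_le_trans h1 (le_trans h2 eH); rewrite ltxx.
apply: (@le_trans _ _ (\int[@lebesgue_measure R]_(t in `[e, H]) (f t)%:E)%E).
  apply: ge0_subset_integral => //; first exact: measurable_funTS.
    by move=> x _; rewrite lee_fin powR_ge0.
  by move=> t; rewrite /= !in_itv/= => /andP[/ltW -> ->].
have dF (t : R) : 0 < t -> is_derive t (1 : R) (fun t => t `^ (1 - theta) / (1 - theta)) (f t).
  move=> t0.
  have d := @is_derive1_powR R (1 - theta) t t0.
  have := @is_deriveZ _ _ _ _ ((1 - theta)^-1) _ _ _ d.
  rewrite (_ : _ \*: _ = (fun t => t `^ (1 - theta) / (1 - theta))); last first.
    by apply/funext => s; rewrite /= /GRing.scale/= mulrC.
  move/is_derive_eq; apply; rewrite /GRing.scale/= mulrA mulVf ?gt_eqF// mul1r /f.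
  by congr (_ `^ _); ring.
have cf (t : R) : 0 < t -> {for t, continuous f}.
  move=> t0; apply: differentiable_continuous; apply/derivable1_diffP.
  by case: (@is_derive1_powR R (- theta) t t0).
have cF (t : R) : 0 < t -> {for t, continuous (fun t => t `^ (1 - theta) / (1 - theta))}.
  move=> t0; apply: differentiable_continuous; apply/derivable1_diffP.
  by case: (dF t t0).
rewrite (@continuous_FTC2 _ _ (fun t => t `^ (1 - theta) / (1 - theta)))//.
- by rewrite -EFinB lee_fin gerBl divr_ge0 ?powR_ge0// ltW.
- apply: continuous_in_subspaceT => t; rewrite inE/= in_itv/= => /andP[h1 _].
  by apply: cf; exact: lt_le_trans h1.
- split.
  + by move=> t; rewrite in_itv/= => /andP[h1 _]; case: (dF t (lt_trans e0 h1)).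
  + by apply: cvg_at_right_filter; exact: cF.
  + by apply: cvg_at_left_filter; apply: cF.
- by move=> t; rewrite in_itv/= derive1E => /andP[h1 _]; case: (dF t (lt_trans e0 h1)).
Qed.

Lemma integral_abs_power (theta H : R) : 0 <= theta < 1 -> 0 < H ->
  (\int[@lebesgue_measure R]_(t in `[(- H)%R, H]) (`|t| `^ (- theta))%:E
     <= (2 * (H `^ (1 - theta) / (1 - theta)))%:E)%E.
Proof.
move=> hth H0.
pose f (t : R) := (`|t| `^ (- theta))%:E.
have f0 t : (0 <= f t)%E by rewrite lee_fin powR_ge0.
have mf : measurable_fun setT f.
  apply/measurable_EFinP; apply: (measurableT_comp (measurable_powR _)).
  exact: normr_measurable.
have half : (\int[@lebesgue_measure R]_(t in `[0%R, H]) f t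
     <= (H `^ (1 - theta) / (1 - theta))%:E)%E.
  rewrite -(@integral_itv_obnd_cbnd _ 0 (BRight H) f)//; last exact: measurable_funTS.
  apply: le_trans (integral_power hth H0); apply: ge0_le_integral => //.
  - exact: measurable_funTS.
  - apply/measurable_EFinP; apply: measurable_funTS; exact: measurable_powR.
  by move=> t; rewrite /= in_itv/= => /andP[t0 _]; rewrite /f gtr0_norm.
have neg : (\int[@lebesgue_measure R]_(t in `[(- H)%R, 0%R]) f t =
    \int[@lebesgue_measure R]_(t in `[0%R, H]) f t)%E.
  rewrite [RHS](@eq_measure_integral _ _ _ _
     (pushforward lebesgue_measure (-%R : R -> measurableTypeR R))); last first.
    by move=> A mA _; exact/esym/lebesgue_measureN.
  have mN : measurable_fun (setT : set (measurableTypeR R))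
      (-%R : measurableTypeR R -> measurableTypeR R) by exact: oppr_measurable.
  have mH : measurable (`[0%R, H]%classic : set (measurableTypeR R)) by exact: measurable_itv.
  have -> := ge0_integral_pushforward mN (@lebesgue_measure R) mH (measurable_funTS mf) (fun t _ => f0 t).
  rewrite (_ : _ @^-1` _ = `[(- H)%R, 0%R]%classic).
    by apply: eq_integral => t _; rewrite /f /= normrN.
  by apply/seteqP; split => t; rewrite /= !in_itv/= oppr_ge0 lerNl andbC.
have -> : `[(- H)%R, H]%classic = `[(- H)%R, 0%R[%classic `|` `[0%R, H]%classic.
  apply/seteqP; split => t; rewrite /= !in_itv/=.
    move=> /andP[h1 h2]; case: (ltP t 0) => h3; [left|right]; first by rewrite h1.
    by rewrite h2.
  by case=> /andP[h1 h2]; apply/andP; split; lra.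
rewrite ge0_integral_setU//; last 2 first.
- by apply: measurable_funTS.
- apply/disj_setPS => t; rewrite /= !in_itv/= => -[/andP[_ h1] /andP[h2 _]].
  by have := lt_le_trans h1 h2; rewrite ltxx.
rewrite (@integral_itv_bndo_bndc _ (BLeft (- H)) 0 f)//; last exact: measurable_funTS.
by rewrite neg mulrDl mul1r EFinD leeD.
Qed.

End kernel.

Section difference_quotients.
Context {R : realType}.
Local Notation plane := (plane R).
Local Notation mu2 := (mu2 R).

Definition convex2 (K : set plane) := forall x y t, K x -> K y -> 0 <= t <= 1 ->
  K (x.1 + t * (y.1 - x.1), x.2 + t * (y.2 - x.2)).

Definition grad_sq (f : plane -> R) (x : plane) : R :=
  pderiv [:: false] f x ^+ 2 + pderiv [:: true] f x ^+ 2.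

Definition norm2 (h : plane) : R := h.1 ^+ 2 + h.2 ^+ 2.

Lemma grad_sq_ge0 f x : 0 <= grad_sq f x.
Proof. by rewrite addr_ge0 ?sqr_ge0. Qed.

Lemma norm2_ge0 h : 0 <= norm2 h.
Proof. by rewrite addr_ge0 ?sqr_ge0. Qed.

(** The increment is the integral of the derivative along the segment; apply
    Cauchy and Schwarz to this integral and to the scalar product with h. *)
Lemma smooth_line_increment f x h : smooth f ->
  (((f (shift2 h x) - f x) ^+ 2)%:E <=
   (norm2 h)%:E * \int[@lebesgue_measure R]_(t in `[0%R, 1%R])
      (grad_sq f (x.1 + t * h.1, x.2 + t * h.2))%:E)%E.
Proof.
move=> sf; pose y t : plane := (x.1 + t * h.1, x.2 + t * h.2).
pose F t := f (y t).
pose dF t := h.1 * pderiv [:: false] f (y t) + h.2 * pderiv [:: true] f (y t).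
have dFP (t : R) : is_derive t (1 : R) F (dF t) by exact: is_derive_line.
have cont g : smooth g -> continuous (fun t => g (y t)).
  by move=> sg; apply: is_derive_continuous => t; exact: is_derive_line.
have cdF : continuous dF.
  have s1 := smooth_pderiv [:: false] sf; have s2 := smooth_pderiv [:: true] sf.
  have := cont _ (smooth_comb h.1 h.2 s1 s2).
  by rewrite /comb.
have mI : measurable (`[0%R, 1%R]%classic : set (measurableTypeR R)) by exact: measurable_itv.
have mdF : measurable_fun (`[0%R, 1%R]%classic : set (measurableTypeR R)) dF.
  by apply: measurable_funTS; exact: continuous_measurable_fun.
have mgrad : measurable_fun (`[0%R, 1%R]%classic : set (measurableTypeR R)) (fun t => grad_sq f (y t)).
  apply: measurable_funD; apply: measurable_funX; apply: measurable_funTS;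
    apply: continuous_measurable_fun; apply: cont; exact: smooth_pderiv.
have e1 : shift2 h x = y 1 by rewrite /y !mul1r.
have e0 : x = y 0 by rewrite /y !mul0r !addr0; case: (x).
have hF1 : f (shift2 h x) = F 1 by rewrite e1.
have hF0 : f x = F 0 by rewrite {1}e0.
have int1 : (\int[@lebesgue_measure R]_(t in `[0%R, 1%R]) (dF t)%:E = (F 1 - F 0)%:E)%E.
  by apply: FTC_R.
have leb1 : (@lebesgue_measure R `[0%R, 1%R] = 1)%E.
  by rewrite lebesgue_measure_itv/= lte_fin ltr01 -EFinB subr0.
have lebc (c : R) : (\int[@lebesgue_measure R]_(t in `[0%R, 1%R]) c%:E = c%:E)%E.
  by rewrite integral_cst// -[RHS]mule1; congr (_ * _)%E; exact: leb1.
apply: (@le_trans _ _ (\int[@lebesgue_measure R]_(t in `[0%R, 1%R]) (dF t ^+ 2)%:E)%E).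
  have [M hM] : exists M, forall t, `[0%R, 1%R]%classic t -> `|dF t| <= M.
    have := @continuous_compact _ _ dF `[0%R, 1%R] (continuous_subspaceT cdF) (segment_compact (a:=0) (b:=1)).
    move=> /compact_bounded[M [_ /(_ (`|M| + 1))]] hM.
    exists (`|M| + 1) => t ht; apply: hM; last by exists t.
    by rewrite (le_lt_trans (ler_norm _))// ltrDl.
  have L2dF : inL2 (@lebesgue_measure R) `[0%R, 1%R]%classic dF.
    split => //; apply: (@le_lt_trans _ _ (\int[@lebesgue_measure R]_(t in `[0%R, 1%R]) (M ^+ 2)%:E)%E).
      apply: ge0_le_integral => //.
      + by move=> t _; rewrite lee_fin sqr_ge0.
      + exact: measurable_sq.
      move=> t ht; rewrite lee_fin -real_normK ?num_real// lerXn2r ?nnegrE//.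
        exact: le_trans (hM t ht).
      exact: hM.
    by rewrite lebc ltry.
  have L21 : inL2 (@lebesgue_measure R) `[0%R, 1%R]%classic (fun=> 1 : R).
    by split => //; rewrite /sqint expr1n lebc ltry.
  have := ip_CS mI L2dF L21.
  have -> : ip (@lebesgue_measure R) `[0%R, 1%R]%classic dF (fun=> 1) = F 1 - F 0.
    rewrite /ip /Rintegral -[RHS]/(fine (F 1 - F 0)%:E) -int1; congr fine.
    by apply: eq_integral => t _; rewrite mulr1.
  have -> : ip (@lebesgue_measure R) `[0%R, 1%R]%classic (fun=> 1) (fun=> 1) = 1 :> R.
    by rewrite /ip /Rintegral mulr1 lebc.
  by rewrite mulr1 hF1 hF0 -lee_fin -sqintE.
rewrite -ge0_integralZl_EFin ?norm2_ge0//; last 2 first.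
- by move=> t _; rewrite lee_fin grad_sq_ge0.
- exact/measurable_EFinP.
apply: ge0_le_integral => //.
- by move=> t _; rewrite lee_fin sqr_ge0.
- exact: measurable_sq.
- by apply: measurable_funeM; exact/measurable_EFinP.
move=> t _; rewrite -EFinM lee_fin /dF /norm2 /grad_sq -/(y t).
move: (pderiv [:: false] f (y t)) (pderiv [:: true] f (y t)) (h.1 : R) (h.2 : R) => p q a b.
have := sqr_ge0 (a * q - b * p); nra.
Qed.

Lemma integral_indicM (K : set plane) (g : plane -> R) : measurable K ->
  (\int[mu2]_x (\1_K x * g x)%:E = \int[mu2]_(x in K) (g x)%:E)%E.
Proof.
move=> mK; rewrite [RHS]integral_mkcond; apply: eq_integral => x _.
by rewrite patchE indicE; case: ifP => _; rewrite ?mul1r ?mul0r.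
Qed.

Lemma measurable_grad_sq D f : smooth f -> measurable_fun D (grad_sq f).
Proof.
move=> sf; apply: measurable_funD; apply: measurable_funX;
  apply: smooth_measurable; exact: smooth_pderiv.
Qed.

(** Exchange the integral over the segments with the one over x. By convexity
    the segments stay in K, and translations preserve the measure. *)
Lemma shift_difference_bound (K : set plane) f h : measurable K -> convex2 K ->
  smooth f ->
  (\int[mu2]_x (\1_K x * \1_K (shift2 h x) * (f (shift2 h x) - f x) ^+ 2)%:E
   <= (norm2 h)%:E * \int[mu2]_(x in K) (grad_sq f x)%:E)%E.
Proof.
move=> mK cK sf.
pose G x := (\1_K x * grad_sq f x)%:E.
have G0 x : (0 <= G x)%E by rewrite lee_fin mulr_ge0// grad_sq_ge0.
have mK1 : measurable_fun setT (\1_K : plane -> R) by exact: measurable_indic.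
have mG : measurable_fun setT G.
  by apply/measurable_EFinP/measurable_funM => //; exact: measurable_grad_sq.
pose I01 : set (measurableTypeR R) := `[0%R, 1%R]%classic.
have mI : measurable I01 by exact: measurable_itv.
pose W (z : plane * measurableTypeR R) : \bar R :=
  ((\1_I01 z.2 : R)%:E * G (z.1.1 + z.2 * h.1, z.1.2 + z.2 * h.2)%R)%E.
have W0 z : (0 <= W z)%E by rewrite mule_ge0// lee_fin.
have mW : measurable_fun setT W.
  apply: emeasurable_funM.
    have mi : measurable_fun setT (\1_I01 : measurableTypeR R -> R) by exact: measurable_indic.
    apply/measurable_EFinP; exact: (measurableT_comp mi (@measurable_snd _ _ _ _)).
  apply: (measurableT_comp mG); apply: measurable_fun_pair; apply: measurable_funD.
  - by apply: (measurableT_comp (@measurable_fst _ _ _ _)).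
  - by apply: measurable_funM.
  - by apply: (measurableT_comp (@measurable_snd _ _ _ _)).
  - by apply: measurable_funM.
have mL : measurable_fun setT (fun x => (\1_K x * \1_K (shift2 h x) * (f (shift2 h x) - f x) ^+ 2)%:E).
  have ms := measurable_shift2 h.
  have mf := smooth_measurable (D := setT) sf.
  apply/measurable_EFinP; apply: measurable_funM.
    by apply: measurable_funM => //; exact: measurableT_comp.
  by apply/measurable_funX/measurable_funB => //; exact: measurableT_comp.
apply: (@le_trans _ _ (\int[mu2]_x ((norm2 h)%:E * \int[@lebesgue_measure R]_t W (x, t)))%E).
  apply: ge0_le_integral => //.
  - by move=> x _; rewrite lee_fin; apply: mulr_ge0; [exact: mulr_ge0 | exact: sqr_ge0].
  - apply: measurable_funeM.
    exact: (@measurable_fun_fubini_tonelli_F _ _ _ _ _ (@lebesgue_measure R) _ mW W0).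
  move=> x _; rewrite !indicE.
  have [xK|xK] := boolP (x \in K); last first.
    by rewrite !mul0r mule_ge0// ?lee_fin ?norm2_ge0// integral_ge0.
  have [yK|yK] := boolP (shift2 h x \in K); last first.
    by rewrite mulr0 mul0r mule_ge0// ?lee_fin ?norm2_ge0// integral_ge0.
  rewrite !mul1r; apply: le_trans (smooth_line_increment x h sf) _.
  rewrite lee_wpmul2l ?lee_fin ?norm2_ge0//.
  rewrite [X in (X <= _)%E]integral_mkcond le_eqVlt; apply/orP; left; apply/eqP.
  apply: eq_integral => t _; rewrite patchE /W /= indicE.
  case: ifPn => ht; last by rewrite mul0e.
  rewrite mul1e /G indicE mem_set ?mul1r//.
  have := cK x (shift2 h x) t (set_mem xK) (set_mem yK); rewrite /shift2 /=.
  rewrite (addrAC x.1) subrr add0r (addrAC x.2) subrr add0r; apply.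
  by move: ht; rewrite inE /= in_itv.
rewrite ge0_integralZl_EFin ?norm2_ge0//; last 2 first.
- by move=> x _; exact: integral_ge0.
- exact: (@measurable_fun_fubini_tonelli_F _ _ _ _ _ (@lebesgue_measure R) _ mW W0).
rewrite lee_wpmul2l ?lee_fin ?norm2_ge0//.
rewrite -smu2E (@fubini_tonelli _ _ _ _ _ smu2 (@lebesgue_measure R) W mW W0).
rewrite -(integral_indicM _ mK) -/G.
have -> : (\int[@lebesgue_measure R]_t \int[smu2]_x W (x, t) =
    \int[@lebesgue_measure R]_(t in I01) \int[mu2]_x G x)%E.
  rewrite [RHS]integral_mkcond; apply: eq_integral => t _; rewrite patchE /W /= indicE.
  case: ifPn => ht; last by under eq_integral do rewrite mul0e; rewrite integral0.
  under eq_integral do rewrite mul1e.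
  exact: (ge0_integral_shift2 (t * h.1, t * h.2) mG G0).
have leb1 : (@lebesgue_measure R I01 = 1)%E.
  by rewrite lebesgue_measure_itv/= lte_fin ltr01 -EFinB subr0.
have -> c : (\int[@lebesgue_measure R]_(t in I01) c = c)%E.
  by rewrite integral_cst// -[RHS]mule1; congr (_ * _)%E; exact: leb1.
exact: lexx.
Qed.

(** The cut-off to K by indicators makes it a function on the whole product, as
    the theorem of Tonelli and translations require. *)
Definition slob_kernel (K : set plane) (theta : R) (f : plane -> R) (x y : plane) : R :=
  \1_K x * \1_K y * ((f x - f y) ^+ 2 / eucl_dist x y `^ (2 + 2 * theta)).

Lemma slob_kernel_ge0 K theta f x y : 0 <= slob_kernel K theta f x y.
Proof.
by apply: mulr_ge0; [exact: mulr_ge0 | rewrite divr_ge0 ?sqr_ge0 ?powR_ge0].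
Qed.

Lemma slob_kernelE K theta f : measurable K ->
  slobodeckii_sq K theta f =
  (\int[mu2]_x \int[mu2]_y (slob_kernel K theta f x y)%:E)%E.
Proof.
move=> mK; rewrite /slobodeckii_sq [LHS]integral_mkcond; apply: eq_integral => x _.
rewrite patchE /slob_kernel indicE; case: ifPn => hx; last first.
  by under eq_integral do rewrite !mul0r; rewrite integral0.
rewrite -(integral_indicM (fun y => (f x - f y) ^+ 2 / eucl_dist x y `^ (2 + 2 * theta)) mK).
by apply: eq_integral => y _; rewrite mul1r.
Qed.

Lemma measurable_eucl_dist :
  measurable_fun setT (fun z : plane * plane => eucl_dist z.1 z.2).
Proof.
apply: (@measurableT_comp _ _ _ _ _ _ (@Num.sqrt R)).
  by apply: continuous_measurable_fun; exact: sqrt_continuous.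
have m1 : measurable_fun setT (fun z : plane * plane => z.1.1 : R).
  exact: (measurableT_comp (@measurable_fst _ _ _ _) (@measurable_fst _ _ _ _)).
have m2 : measurable_fun setT (fun z : plane * plane => z.1.2 : R).
  exact: (measurableT_comp (@measurable_snd _ _ _ _) (@measurable_fst _ _ _ _)).
have m3 : measurable_fun setT (fun z : plane * plane => z.2.1 : R).
  exact: (measurableT_comp (@measurable_fst _ _ _ _) (@measurable_snd _ _ _ _)).
have m4 : measurable_fun setT (fun z : plane * plane => z.2.2 : R).
  exact: (measurableT_comp (@measurable_snd _ _ _ _) (@measurable_snd _ _ _ _)).
by apply: measurable_funD; apply: measurable_funX; exact: measurable_funB.
Qed.

Lemma measurable_slob_kernel K theta f : measurable K -> measurable_fun K f ->
  measurable_fun setT (fun z : plane * plane => (slob_kernel K theta f z.1 z.2)%:E).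
Proof.
move=> mK mf; apply/measurable_EFinP.
have mK1 : measurable_fun setT (\1_K : plane -> R) by exact: measurable_indic.
have mfK : measurable_fun setT (f \_ K) by exact: ((measurable_restrictT f mK).1 mf).
have -> : (fun z : plane * plane => slob_kernel K theta f z.1 z.2) =
   (fun z => \1_K z.1 * \1_K z.2 * (((f \_ K) z.1 - (f \_ K) z.2) ^+ 2 *
       eucl_dist z.1 z.2 `^ (- (2 + 2 * theta)))).
  apply/funext => z; rewrite /slob_kernel powRN !indicE !patchE.
  by case: (z.1 \in K); case: (z.2 \in K); rewrite ?mul0r ?mulr0 ?mul0r.
have c1 g : measurable_fun setT g -> measurable_fun setT (fun z : plane * plane => g z.1 : R).
  by move=> mg; exact: (measurableT_comp mg (@measurable_fst _ _ _ _)).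
have c2 g : measurable_fun setT g -> measurable_fun setT (fun z : plane * plane => g z.2 : R).
  by move=> mg; exact: (measurableT_comp mg (@measurable_snd _ _ _ _)).
apply: measurable_funM; first by apply: measurable_funM; [exact: c1 | exact: c2].
apply: measurable_funM; first by apply/measurable_funX/measurable_funB; [exact: c1 | exact: c2].
exact: (measurableT_comp (measurable_powR _) measurable_eucl_dist).
Qed.

Definition diam_bound (K : set plane) (H : R) :=
  forall x y, K x -> K y -> `|x.1 - y.1| <= H /\ `|x.2 - y.2| <= H.

(** The square of the norm exceeds |h1| |h2|. The kernel of the seminorm is
    thereby bounded by a product of functions of one coordinate, and its
    integral near 0 by a product of two integrals over intervals. *)
Lemma norm2_kernel theta (h : plane) : 0 <= theta -> h.1 != 0 -> h.2 != 0 ->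
  norm2 h / (Num.sqrt (norm2 h)) `^ (2 + 2 * theta) <=
  `|h.1| `^ (- theta) * `|h.2| `^ (- theta).
Proof.
move=> th0 h1 h2; set a := `|h.1 : R|; set b := `|h.2 : R|.
have a0 : 0 < a by rewrite normr_gt0.
have b0 : 0 < b by rewrite normr_gt0.
have nE : norm2 h = a ^+ 2 + b ^+ 2 by rewrite /a /b !real_normK ?num_real.
have n0 : 0 < norm2 h by rewrite nE addr_gt0// exprn_gt0.
have r0 : 0 < Num.sqrt (norm2 h) by rewrite sqrtr_gt0.
have -> : Num.sqrt (norm2 h) `^ (2 + 2 * theta) = norm2 h * norm2 h `^ theta.
  rewrite powRD; last by rewrite (gt_eqF r0) implybT.
  rewrite powRrM !(powR_mulrn 2 (ltW r0)) sqr_sqrtr ?(ltW n0)//.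
rewrite invfM mulrA divff ?gt_eqF// mul1r !powRN.
rewrite -invfM -powRM ?(ltW a0) ?(ltW b0)//.
have ab0 : 0 < a * b by rewrite mulr_gt0.
rewrite lef_pV2 ?posrE ?powR_gt0//; apply: ge0_ler_powR => //; rewrite ?nnegrE ?(ltW n0) ?(ltW ab0)//.
rewrite nE; have := sqr_ge0 (a - b); nra.
Qed.

Definition slob_const (theta H : R) : R := (2 * (H `^ (1 - theta) / (1 - theta))) ^+ 2.

Lemma integral_square_power theta H : 0 <= theta < 1 -> 0 < H ->
  (\int[mu2]_(h in square H) (`|h.1| `^ (- theta) * `|h.2| `^ (- theta))%:E
    <= (slob_const theta H)%:E)%E.
Proof.
move=> hth H0; set c := 2 * (H `^ (1 - theta) / (1 - theta)).
pose I : set (measurableTypeR R) := `[- H, H]%classic.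
have mI : measurable I by exact: measurable_itv.
pose k (t : measurableTypeR R) := \1_I t * `|t| `^ (- theta) : R.
have k0 t : 0 <= k t by rewrite mulr_ge0// powR_ge0.
have mk : measurable_fun setT k.
  apply: measurable_funM; first exact: measurable_indic.
  by apply: (measurableT_comp (measurable_powR _)); exact: normr_measurable.
have ik : (\int[@lebesgue_measure R]_t (k t)%:E <= c%:E)%E.
  apply: le_trans (integral_abs_power hth H0).
  rewrite [leRHS]integral_mkcond le_eqVlt; apply/orP; left; apply/eqP.
  apply: eq_integral => t _; rewrite patchE /k indicE; case: ifP => _; by rewrite ?mul1r ?mul0r.
rewrite -integral_indicM; last exact: measurable_square.
have mF : measurable_fun setT (fun z : plane => (k z.1 * k z.2)%:E).
  apply/measurable_EFinP; apply: measurable_funM.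
    exact: (measurableT_comp mk (@measurable_fst _ _ _ _)).
  exact: (measurableT_comp mk (@measurable_snd _ _ _ _)).
have F0 z : (0 <= (k z.1 * k z.2)%:E)%E by rewrite lee_fin mulr_ge0.
rewrite (eq_integral (fun z : plane => (k z.1 * k z.2)%:E)); last first.
  move=> z _; congr EFin; rewrite /k !indicE mulrACA; congr (_ * _).
  rewrite -natrM mulnb; congr (_%:R); congr nat_of_bool.
  by apply/idP/andP; rewrite !inE.
rewrite (ge0_integral_plane mF F0) /=.
have kI : (0 <= \int[@lebesgue_measure R]_t (k t)%:E)%E.
  by apply: integral_ge0 => t _; rewrite lee_fin.
rewrite (eq_integral (fun a => (k a)%:E * \int[@lebesgue_measure R]_t (k t)%:E)%E); last first.
  move=> a _; under eq_integral do rewrite EFinM.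
  rewrite ge0_integralZl_EFin//; [by move=> t _; rewrite lee_fin | exact/measurable_EFinP].
rewrite ge0_integralZr//; [|exact/measurable_EFinP|by move=> a _; rewrite lee_fin].
by rewrite /slob_const expr2 EFinM lee_pmul.
Qed.

Lemma eucl_dist_shift (x h : plane) : eucl_dist x (shift2 h x) = Num.sqrt (norm2 h).
Proof. by rewrite /eucl_dist /norm2 /shift2/= !opprD !addrA !subrr !sub0r !sqrrN. Qed.

(** Substitute y = x + h and integrate over x first: for fixed h this is the
    bound of a difference by the gradient, with a factor |h|^2 that makes the
    kernel integrable in h. *)
Lemma slob_smooth (K : set plane) (theta H : R) f : measurable K -> convex2 K ->
  diam_bound K H -> 0 < H -> 0 <= theta < 1 -> smooth f ->
  (slobodeckii_sq K theta f <=
   (slob_const theta H)%:E * \int[mu2]_(x in K) (grad_sq f x)%:E)%E.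
Proof.
move=> mK cK dK H0 hth sf; have /andP[th0 th1] := hth.
have mf : measurable_fun K f by exact: smooth_measurable.
rewrite slob_kernelE//; set I := (\int[mu2]_(x in K) _)%E.
have I0 : (0 <= I)%E by apply: integral_ge0 => x _; rewrite lee_fin grad_sq_ge0.
have mk := measurable_slob_kernel theta mK mf.
pose V (z : plane * plane) := (slob_kernel K theta f z.1 (shift2 z.2 z.1))%:E.
have V0 z : (0 <= V z)%E by rewrite lee_fin slob_kernel_ge0.
have ms : measurable_fun setT (fun z : plane * plane => (z.1, shift2 z.2 z.1)).
  apply: measurable_fun_pair; first exact: measurable_fst.
  apply: measurable_fun_pair; apply: measurable_funD.
  - exact: (measurableT_comp (@measurable_fst _ _ _ _) (@measurable_fst _ _ _ _)).
  - exact: (measurableT_comp (@measurable_fst _ _ _ _) (@measurable_snd _ _ _ _)).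
  - exact: (measurableT_comp (@measurable_snd _ _ _ _) (@measurable_fst _ _ _ _)).
  - exact: (measurableT_comp (@measurable_snd _ _ _ _) (@measurable_snd _ _ _ _)).
have mV : measurable_fun setT V by exact: (measurableT_comp mk ms).
have -> : (\int[mu2]_x \int[mu2]_y (slob_kernel K theta f x y)%:E =
    \int[smu2]_x \int[smu2]_h V (x, h))%E.
  apply: eq_integral => x _.
  have mkx : measurable_fun setT (fun y => (slob_kernel K theta f x y)%:E).
    exact: (measurableT_comp mk (pair1_measurable x)).
  rewrite -(ge0_integral_shift2 x mkx); last by move=> y; rewrite lee_fin slob_kernel_ge0.
  apply: eq_integral => h _; rewrite /V /=; congr (slob_kernel _ _ _ _ _)%:E.
  by rewrite /shift2; congr pair; rewrite addrC.
rewrite (@fubini_tonelli _ _ _ _ _ (@smu2 R) (@smu2 R) V mV V0).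
pose kap (h : plane) := \1_(square H) h * (`|h.1| `^ (- theta) * `|h.2| `^ (- theta)) : R.
have kap0 h : 0 <= kap h by rewrite mulr_ge0// mulr_ge0// powR_ge0.
have mkap : measurable_fun setT kap.
  apply: measurable_funM; first by apply: measurable_indic; exact: measurable_square.
  apply: measurable_funM; apply: (measurableT_comp (measurable_powR _)).
    exact: (measurableT_comp (@normr_measurable R setT) (@measurable_fst _ _ _ _)).
  exact: (measurableT_comp (@normr_measurable R setT) (@measurable_snd _ _ _ _)).
apply: (@le_trans _ _ (\int[mu2]_h ((kap h)%:E * I))%E); last first.
  rewrite ge0_integralZr//; [|exact/measurable_EFinP|by move=> h _; rewrite lee_fin].
  rewrite lee_wpmul2r// integral_indicM; last exact: measurable_square.
  exact: integral_square_power.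
apply: ae_ge0_le_integral => //.
- by move=> h _; exact: integral_ge0.
- exact: (@measurable_fun_fubini_tonelli_G _ _ _ _ _ (@smu2 R) _ mV V0).
- by move=> h _; rewrite mule_ge0// lee_fin.
- by apply: emeasurable_funM => //; exact/measurable_EFinP.
(* The bound of the kernel by powers of the coordinates fails on the axes only. *)
have nul : mu2.-negligible ([set h : plane | h.1 = 0] `|` [set h : plane | h.2 = 0]).
  apply: negligibleU; first exact: vline_null.
  by apply: negligibleS (graph_null 0 0) => h /= ->; rewrite mul0r addr0.
apply: negligibleS nul => h; apply: contra_notP => /not_orP[/eqP h1 /eqP h2] _.
have Vh x : V (x, h) = ((Num.sqrt (norm2 h) `^ (2 + 2 * theta))^-1%:E *
    (\1_K x * \1_K (shift2 h x) * (f (shift2 h x) - f x) ^+ 2)%:E)%E.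
  rewrite /V /slob_kernel /= eucl_dist_shift -EFinM; congr EFin.
  by rewrite -(opprB (f (shift2 h x))) sqrrN [LHS]mulrA [RHS]mulrC.
under eq_integral do rewrite Vh.
have mL : measurable_fun setT (fun x => (\1_K x * \1_K (shift2 h x) * (f (shift2 h x) - f x) ^+ 2)%:E).
  have msh := measurable_shift2 h.
  have mfT := smooth_measurable (D := setT) sf.
  have mK1 : measurable_fun setT (\1_K : plane -> R) by exact: measurable_indic.
  apply/measurable_EFinP; apply: measurable_funM.
    by apply: measurable_funM => //; exact: measurableT_comp.
  by apply/measurable_funX/measurable_funB => //; exact: measurableT_comp.
have L0 x : (0 <= (\1_K x * \1_K (shift2 h x) * (f (shift2 h x) - f x) ^+ 2)%:E)%E.
  by rewrite lee_fin; apply: mulr_ge0; [exact: mulr_ge0 | exact: sqr_ge0].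
rewrite /kap indicE; have [hsq|hsq] := boolP (h \in square H); last first.
  rewrite mul0r mul0e (eq_integral (fun=> 0%E)) ?integral0// => x _.
  have [xK|xK] := boolP (x \in K); last by rewrite indicE (negbTE xK) !mul0r mule0.
  have [yK|yK] := boolP (shift2 h x \in K); last first.
    by rewrite [\1_K (shift2 h x)]indicE (negbTE yK) mulr0n mulr0 mul0r mule0.
  exfalso; move/negP : hsq; apply; rewrite inE; apply/squareP.
  have := dK _ _ (set_mem yK) (set_mem xK); rewrite /shift2 /=.
  by rewrite (addrAC x.1) subrr add0r (addrAC x.2) subrr add0r.
rewrite mul1r ge0_integralZl_EFin ?invr_ge0 ?powR_ge0//.
apply: le_trans (lee_wpmul2l _ (shift_difference_bound h mK cK sf)) _.
  by rewrite lee_fin invr_ge0 powR_ge0.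
rewrite muleA lee_wpmul2r// -EFinM lee_fin mulrC.
exact: norm2_kernel.
Qed.

(** Two situations have to be covered: zero extensions of functions of H^1_0,
    and derivatives on a triangle of functions smooth up to small errors.
    Density of smooth functions is all they share. *)
Definition strong_gradient (K : set plane) (g g0 g1 : plane -> R) : Prop :=
  [/\ inL2 mu2 K g, inL2 mu2 K g0, inL2 mu2 K g1 &
    forall e : R, 0 < e -> exists f, [/\ smooth f, (sqint mu2 K (f \- g)%R <= e%:E)%E,
      (sqint mu2 K (pderiv [:: false] f \- g0)%R <= e%:E)%E &
      (sqint mu2 K (pderiv [:: true] f \- g1)%R <= e%:E)%E]].

Lemma sqint_near (K : set plane) (f g : plane -> R) (e : R) : measurable K -> measurable_fun K f ->
  measurable_fun K g -> (sqint mu2 K (f \- g)%R <= e%:E)%E ->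
  (sqint mu2 K f <= 2%:E * sqint mu2 K g + (2 * e)%:E)%E.
Proof.
move=> mK mf mg he.
have -> : f = comb 1 g 1 (f \- g)%R.
  by apply/funext => x; rewrite /comb !mul1r addrC subrK.
apply: le_trans (sqint_comb_le mu2 mK 1 1 mg (measurable_funB mf mg)) _.
rewrite expr1n mulr1 leeD2l// EFinM lee_wpmul2l//.
Qed.

(** Approximations at a geometric rate converge almost everywhere; apply the
    lemma of Fatou to the inner and to the outer integral. *)
Theorem slob_strong (K : set plane) (theta H : R) g g0 g1 : measurable K -> convex2 K ->
  diam_bound K H -> 0 < H -> 0 <= theta < 1 -> strong_gradient K g g0 g1 ->
  (slobodeckii_sq K theta g <=
   (2 * slob_const theta H)%:E * (sqint mu2 K g0 + sqint mu2 K g1))%E.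
Proof.
move=> mK cK dK H0 hth [hg hg0 hg1 lim].
have [mg _] := hg; have [mg0 _] := hg0; have [mg1 _] := hg1.
have p0 n : 0 < 4^-1 ^+ n :> R by rewrite exprn_gt0// invr_gt0.
have /choice[f hf] n := lim _ (p0 n).
have sf n : smooth (f n) by case: (hf n).
have mf n D : measurable_fun D (f n) by exact: smooth_measurable.
set C := slob_const theta H.
have C0 : 0 <= C by exact: sqr_ge0.
have bound n : (slobodeckii_sq K theta (f n) <=
    (2 * C)%:E * (sqint mu2 K g0 + sqint mu2 K g1) + (4 * C * 4^-1 ^+ n)%:E)%E.
  have [_ h h0 h1] := hf n.
  apply: le_trans (slob_smooth mK cK dK H0 hth (sf n)) _.
  have s0 := smooth_pderiv [:: false] (sf n); have s1 := smooth_pderiv [:: true] (sf n).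
  have -> : (\int[mu2]_(x in K) (grad_sq (f n) x)%:E =
     sqint mu2 K (pderiv [:: false] (f n)) + sqint mu2 K (pderiv [:: true] (f n)))%E.
    rewrite /grad_sq; under eq_integral do rewrite EFinD.
    rewrite ge0_integralD//; try (by move=> x _; rewrite lee_fin sqr_ge0);
      by apply: measurable_sq; exact: smooth_measurable.
  have b0 := sqint_near mK (smooth_measurable s0) mg0 h0.
  have b1 := sqint_near mK (smooth_measurable s1) mg1 h1.
  apply: le_trans (lee_wpmul2l _ (leeD b0 b1)) _; first by rewrite lee_fin.
  rewrite !(sqintE mK hg0) !(sqintE mK hg1) -/C !(=^~ EFinM, =^~ EFinD) lee_fin.
  move: (ip _ _ _ _) (ip _ _ _ _) (4^-1 ^+ n) => a b p; lra.
have ae1 : {ae mu2, forall x, K x -> f ^~ x @ \oo --> g x}.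
  apply: (@L2_fast_ae _ _ _ mu2 K mK f g 1) => //.
  by move=> n; rewrite mul1r; case: (hf n).
have kcvg x y : K x -> K y -> f ^~ x @ \oo --> g x -> f ^~ y @ \oo --> g y ->
    (fun n => (slob_kernel K theta (f n) x y)%:E) @ \oo --> (slob_kernel K theta g x y)%:E.
  move=> Kx Ky fx fy; apply/fine_cvgP; split; first exact: nearW.
  apply: cvgM; first exact: cvg_cst.
  apply: cvgM; last exact: cvg_cst.
  rewrite /comp/=.
  have c : (fun n => f n x - f n y) @ \oo --> g x - g y by exact: (@cvgB _ _ _ _ _ _ _ _ _ fx fy).
  exact: (cvgM c c).
have k0 h x y : (0 <= (slob_kernel K theta h x y)%:E)%E by rewrite lee_fin slob_kernel_ge0.
have mk h : measurable_fun K h -> measurable_fun setT (fun z : plane * plane => (slob_kernel K theta h z.1 z.2)%:E).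
  by move=> mh; exact: measurable_slob_kernel.
have mF h : measurable_fun K h -> measurable_fun setT (fun x => \int[mu2]_y (slob_kernel K theta h x y)%:E)%E.
  move=> mh; exact: (@measurable_fun_fubini_tonelli_F _ _ _ _ _ (@smu2 R) _ (mk h mh) (fun z => k0 h z.1 z.2)).
have mkx h x : measurable_fun K h -> measurable_fun setT (fun y => (slob_kernel K theta h x y)%:E).
  by move=> mh; exact: (measurableT_comp (mk h mh) (pair1_measurable x)).
have kout h x y : ~ K x \/ ~ K y -> slob_kernel K theta h x y = 0.
  by move=> [hx|hx]; rewrite /slob_kernel !indicE (memNset hx) ?mul0r ?mulr0 ?mul0r.
rewrite slob_kernelE//.
have inner : {ae mu2, forall x, setT x -> (\int[mu2]_y (slob_kernel K theta g x y)%:E <=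
    limn_einf (fun n => \int[mu2]_y (slob_kernel K theta (f n) x y)%:E))%E}.
  apply: (filterS _ (ae1)) => x fx _.
  apply: le_trans (fatou mu2 measurableT (fun n => mkx (f n) x (mf n K)) (fun n y _ => k0 (f n) x y)).
  apply: ae_ge0_le_integral => //.
  - exact: mkx.
  - by move=> y _; apply: limn_einf_ge0 => n.
  - apply: measurable_limn_einf => n; exact: mkx.
  apply: (filterS _ (ae1)) => y fy _.
  have [Kx|Kx] := pselect (K x); last first.
    by rewrite kout; [exact: limn_einf_ge0 | left].
  have [Ky|Ky] := pselect (K y); last first.
    by rewrite kout; [exact: limn_einf_ge0 | right].
  by rewrite (cvg_limn_einf_sup (kcvg x y Kx Ky (fx Kx) (fy Ky))).1.
pose u n x := (\int[mu2]_y (slob_kernel K theta (f n) x y)%:E)%E.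
have u0 n x : (0 <= u n x)%E by apply: integral_ge0 => y _; exact: k0.
apply: (@le_trans _ _ (\int[mu2]_x limn_einf (u ^~ x))%E).
  apply: ae_ge0_le_integral => //.
  - by move=> x _; apply: integral_ge0 => y _; exact: k0.
  - exact: mF.
  - by move=> x _; apply: limn_einf_ge0 => n.
  - apply: measurable_limn_einf => n; exact: mF.
apply: le_trans (fatou mu2 measurableT (fun n => mF (f n) (mf n K)) (fun n x _ => u0 n x)) _.
set B := ((2 * C)%:E * _)%E.
have Bfin : B \is a fin_num.
  by rewrite /B (sqintE mK hg0) (sqintE mK hg1) -EFinD -EFinM.
have limB : (fun n => B + (4 * C * 4^-1 ^+ n)%:E)%E @ \oo --> B.
  rewrite -[X in _ --> X]adde0; apply: cvgeD; first by rewrite fin_num_adde_defr.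
    exact: cvg_cst.
  apply/fine_cvgP; split; first exact: nearW.
  rewrite -[X in _ --> X](mulr0 (4 * C)); apply: cvgM; first exact: cvg_cst.
  by apply: cvg_expr; rewrite ger0_norm ?invr_ge0// invf_lt1// ltr1n.
rewrite -[leRHS](cvg_limn_einf_sup limB).1; apply: lee_limn_einf => n.
by rewrite -slob_kernelE.
Qed.

End difference_quotients.

(** * Sobolev spaces as form spaces *)
Section form_constructions.
Context (X : Type) (R : realType).
Implicit Type V : set (X -> R).

Lemma psd_form0 V : psd_form V (fun _ _ => 0).
Proof. by split => // *; rewrite !mulr0 addr0. Qed.

Lemma psd_formD V B1 B2 : psd_form V B1 -> psd_form V B2 ->
  psd_form V (fun v w => B1 v w + B2 v w).
Proof.
move=> [l1 s1 p1] [l2 s2 p2]; split.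
- by move=> a b f g h Vf Vg Vh; rewrite l1// l2//; ring.
- by move=> f g Vf Vg; rewrite s1// s2.
- by move=> f Vf; rewrite addr_ge0 ?p1 ?p2.
Qed.

Lemma psd_form_sum V (I : Type) (r : seq I) (P : pred I)
    (B : I -> (X -> R) -> (X -> R) -> R) :
  (forall i, P i -> psd_form V (B i)) ->
  psd_form V (fun v w => \sum_(i <- r | P i) B i v w).
Proof.
move=> hB; elim: r => [|i r IH].
  rewrite (_ : (fun _ _ => _) = (fun _ _ => 0)); first exact: psd_form0.
  by apply/funext => v; apply/funext => w; rewrite big_nil.
rewrite (_ : (fun _ _ => _) = (fun v w => (if P i then B i v w else 0) +
    \sum_(i <- r | P i) B i v w)); last first.
  by apply/funext => v; apply/funext => w; rewrite big_cons; case: ifP; rewrite ?add0r.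
apply: psd_formD => //; case: (boolP (P i)) => Pi; last exact: psd_form0.
exact: hB.
Qed.

Lemma sub_psd_form V V' B : V' `<=` V -> psd_form V B -> psd_form V' B.
Proof.
move=> sub [l s p]; split.
- by move=> a b f g h /sub Vf /sub Vg /sub Vh; exact: l.
- by move=> f g /sub Vf /sub Vg; exact: s.
- by move=> f /sub; exact: p.
Qed.

(** The map L is linear only up to null sets, as derivatives are. *)
Lemma pull_form V d (Y : measurableType d) (nu : {measure set Y -> \bar R})
    (E : set Y) (L : (X -> R) -> Y -> R) : measurable E -> linear_set V ->
  (forall v, V v -> inL2 nu E (L v)) ->
  (forall a b v w, V v -> V w ->
     ae_eq nu E (L (comb a v b w)) (comb a (L v) b (L w))) ->
  psd_form V (fun v w => ip nu E (L v) (L w)).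
Proof.
move=> mE hV hL lin; split.
- move=> a b f g h Vf Vg Vh; rewrite -ip_combl//; try exact: hL.
  apply: ip_ae => //; try exact: hL.
  + exact/hL/hV.
  + by apply: inL2_comb => //; exact: hL.
  + exact: lin.
  + exact: ae_eq_refl.
- by move=> f g _ _; exact: ipC.
- by move=> f _; exact: ip_ge0.
Qed.

End form_constructions.

Section slobodeckii.
Context {R : realType}.
Local Notation plane := (plane R).
Local Notation mu2 := (mu2 R).

Definition mu4 : {measure set (plane * plane) -> \bar R} :=
  (@smu2 R \x @smu2 R)%E.

(** Its L2 norm on D x D is the Slobodeckii seminorm, which makes the norm of
    H^s a Hilbert norm. *)
Definition quotient (theta : R) (f : plane -> R) (z : plane * plane) : R :=
  (f z.1 - f z.2) * eucl_dist z.1 z.2 `^ (- (1 + theta)).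

Lemma quotient_comb theta (a : R) f (b : R) g :
  quotient theta (comb a f b g) = comb a (quotient theta f) b (quotient theta g).
Proof. by apply/funext => z; rewrite /quotient /comb; ring. Qed.

Lemma sqr_quotient theta f z : quotient theta f z ^+ 2 =
  (f z.1 - f z.2) ^+ 2 / eucl_dist z.1 z.2 `^ (2 + 2 * theta).
Proof.
rewrite exprMn; congr (_ * _).
rewrite -powRN -(powR_mulrn 2) ?powR_ge0// -powRrM; congr (_ `^ _); ring.
Qed.

Lemma measurable_quotient (D : set plane) theta f : measurable D ->
  measurable_fun D f -> measurable_fun (D `*` D) (quotient theta f).
Proof.
move=> mD mf; have mDD : measurable (D `*` D) by exact: measurableX.
have mfD : measurable_fun setT (f \_ D) by exact: ((measurable_restrictT f mD).1 mf).
apply: (eq_measurable_fun (quotient theta (f \_ D))).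
  by move=> z; rewrite inE => -[/= h1 h2]; rewrite /quotient !patchE !mem_set.
apply: measurable_funTS; apply: measurable_funM.
  apply: measurable_funB.
    exact: (measurableT_comp mfD (@measurable_fst _ _ _ _)).
  exact: (measurableT_comp mfD (@measurable_snd _ _ _ _)).
exact: (measurableT_comp (measurable_powR _) measurable_eucl_dist).
Qed.

Lemma slobodeckii_sqint (D : set plane) theta f : measurable D ->
  measurable_fun D f ->
  slobodeckii_sq D theta f = sqint mu4 (D `*` D) (quotient theta f).
Proof.
move=> mD mf; rewrite slob_kernelE//.
have mk := measurable_slob_kernel theta mD mf.
have k0 (z : plane * plane) : (0 <= (slob_kernel D theta f z.1 z.2)%:E)%E.
  by rewrite lee_fin slob_kernel_ge0.
have /= <- := @fubini_tonelli1 _ _ _ _ _ (@smu2 R) (@smu2 R) _ mk k0.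
rewrite /sqint [RHS]integral_mkcond; apply: eq_integral => z _.
rewrite patchE /slob_kernel sqr_quotient !indicE.
case: ifPn => [|hz].
  by rewrite inE => -[/= h1 h2]; rewrite !mem_set// !mul1r.
case: (boolP (z.1 \in D)) => h1; last by rewrite !mul0r.
case: (boolP (z.2 \in D)) => h2; last by rewrite mulr0 mul0r.
by case/negP : hz; rewrite inE; split; exact: set_mem.
Qed.

(** A null set of D gives two null strips in D x D. *)
Lemma quotient_ae (D : set plane) theta f g : ae_eq mu2 D f g ->
  ae_eq mu4 (D `*` D) (quotient theta f) (quotient theta g).
Proof.
move=> [N [mN N0 sub]].
have N0' : (@smu2 R) N = 0%E by [].
have n1 : mu4.-negligible (N `*` setT).
  exists (N `*` setT); split => //; first exact: measurableX.
  have /= -> := @product_measure1E _ _ _ _ _ (@smu2 R) (@smu2 R) N setT mN measurableT.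
  by rewrite N0' mul0e.
have n2 : mu4.-negligible (setT `*` N).
  exists (setT `*` N); split => //; first exact: measurableX.
  have /= -> := @product_measure1E _ _ _ _ _ (@smu2 R) (@smu2 R) setT N measurableT mN.
  by rewrite N0' mule0.
apply: negligibleS (negligibleU n1 n2) => z /= hz.
have [h1|h1] := pselect (N z.1); first by left.
have [h2|h2] := pselect (N z.2); first by right.
exfalso; apply: hz => -[/= D1 D2]; rewrite /quotient.
have e x : ~ N x -> D x -> f x = g x.
  by move=> hN Dx; apply: contrapT => hfg; apply: hN; apply: sub => /= /(_ Dx).
by rewrite !e.
Qed.

End slobodeckii.

Section sobolev.
Context {R : realType}.
Local Notation plane := (plane R).
Local Notation mu2 := (mu2 R).
Variables (D : set plane) (h : R).
Hypotheses (oD : open D) (Dh : D `<=` square h).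
Let mD := open_measurable2 oD.

Lemma Hint_L2 k v : Hint D k v -> inL2 mu2 D v.
Proof. by case. Qed.

Lemma Hint_wderiv k v w : Hint D k v -> (size w <= k)%N ->
  is_wderiv D w v (wderiv D w v).
Proof. by move=> [_ hv] wk; apply: wderivP; exact: hv. Qed.

Lemma Hint_wderivL2 k v w : Hint D k v -> (size w <= k)%N ->
  inL2 mu2 D (wderiv D w v).
Proof. by move=> hv wk; case: (Hint_wderiv hv wk). Qed.

Lemma Hint_le k k' v : (k' <= k)%N -> Hint D k v -> Hint D k' v.
Proof. by move=> kk [hv hw]; split => // w wk; apply: hw; exact: leq_trans kk. Qed.

Lemma Hint_linear k : linear_set (Hint D k).
Proof.
move=> a b f g hf hg; split; first exact: inL2_comb (Hint_L2 hf) (Hint_L2 hg).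
move=> w wk; eexists; apply: (is_wderiv_comb oD Dh).
- exact: Hint_L2 hf.
- exact: Hint_L2 hg.
- exact: Hint_wderiv hf wk.
- exact: Hint_wderiv hg wk.
Qed.

Lemma wderiv_comb k w (a : R) f (b : R) g : Hint D k f -> Hint D k g -> (size w <= k)%N ->
  ae_eq mu2 D (wderiv D w (comb a f b g)) (comb a (wderiv D w f) b (wderiv D w g)).
Proof.
move=> hf hg wk; apply: (wderiv_ae oD Dh); apply: (is_wderiv_comb oD Dh).
- exact: Hint_L2 hf.
- exact: Hint_L2 hg.
- exact: Hint_wderiv hf wk.
- exact: Hint_wderiv hg wk.
Qed.

Lemma Hint_smooth k f : smooth f -> Hint D k f.
Proof.
move=> sf; split; first exact: (inL2_smooth mD Dh).
by move=> w _; eexists; exact: (is_wderiv_smooth oD Dh).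
Qed.

Lemma Hint_ae k v v' : inL2 mu2 D v' -> ae_eq mu2 D v v' -> Hint D k v -> Hint D k v'.
Proof.
move=> hv' vv' hv; split => // w wk; eexists.
exact: (is_wderiv_ae oD Dh (Hint_L2 hv) hv' vv' (Hint_wderiv hv wk)).
Qed.

Lemma wderiv_psd k w : (size w <= k)%N ->
  psd_form (Hint D k) (fun v v' => ip mu2 D (wderiv D w v) (wderiv D w v')).
Proof.
move=> wk; apply: pull_form => //; first exact: Hint_linear.
  by move=> v hv; exact: Hint_wderivL2 hv wk.
by move=> a b v v' hv hv'; exact: wderiv_comb hv hv' wk.
Qed.

Lemma aform_psd k : psd_form (Hint D k) (aform D k).
Proof.
apply: (@psd_form_sum _ _ _ _ _ _ (fun (b : k.-tuple bool) v w =>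
  ip mu2 D (wderiv D b v) (wderiv D b w))) => b _.
by apply: wderiv_psd; rewrite size_tuple.
Qed.

(** With k the integer part of s and theta the rest, the inner product of H^s. *)
Definition hform_of (k : nat) (theta : R) (v w : plane -> R) : R :=
  \sum_(j < k.+1) \sum_(b : j.-tuple bool) ip mu2 D (wderiv D b v) (wderiv D b w) +
  \sum_(b : k.-tuple bool | 0 < theta) ip mu4 (D `*` D)
      (quotient theta (wderiv D b v)) (quotient theta (wderiv D b w)).

Definition hform (s : R) := hform_of (Num.truncn s) (s - (Num.truncn s)%:R).

Definition Hspace k theta : set (plane -> R) :=
  [set v | Hint D k v /\ (0 < theta -> forall b : k.-tuple bool,
     (slobodeckii_sq D theta (wderiv D b v) < +oo)%E)].

Lemma Hspace_quotient k theta v (b : k.-tuple bool) : 0 < theta -> Hspace k theta v ->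
  inL2 mu4 (D `*` D) (quotient theta (wderiv D b v)).
Proof.
move=> th0 [hv hs].
have [mw _] : inL2 mu2 D (wderiv D b v) by apply: Hint_wderivL2 hv _; rewrite size_tuple.
split; first exact: measurable_quotient.
by rewrite -slobodeckii_sqint//; exact: hs.
Qed.

Lemma Hspace_linear k theta : linear_set (Hspace k theta).
Proof.
move=> a b f g hf hg; have [[if_ _] [ig _]] := (hf, hg).
have hc : Hint D k (comb a f b g) by exact: Hint_linear.
split => // th0 c; have ck : (size c <= k)%N by rewrite size_tuple.
have [mf _] := Hint_wderivL2 if_ ck; have [mg _] := Hint_wderivL2 ig ck.
have [mc _] := Hint_wderivL2 hc ck.
have mDD : measurable (D `*` D) by exact: measurableX.
have [qf qg] := (Hspace_quotient c th0 hf, Hspace_quotient c th0 hg).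
rewrite slobodeckii_sqint//.
have := wderiv_comb a b if_ ig ck => /(quotient_ae theta); rewrite quotient_comb => e.
rewrite (@sqint_ae _ _ _ mu4 _ mDD _ _ _ _ e).
- by case: (inL2_comb mDD a b qf qg).
- exact: measurable_quotient.
- by case: (inL2_comb mDD a b qf qg).
Qed.

Lemma hform_of_psd k theta : psd_form (Hspace k theta) (hform_of k theta).
Proof.
apply: psd_formD.
  apply: (@psd_form_sum _ _ _ _ _ _ (fun (j : 'I_k.+1) v w => \sum_(b : j.-tuple bool)
     ip mu2 D (wderiv D b v) (wderiv D b w))) => j _.
  apply: (@psd_form_sum _ _ _ _ _ _ (fun (b : j.-tuple bool) v w =>
     ip mu2 D (wderiv D b v) (wderiv D b w))) => b _.
  apply: sub_psd_form (wderiv_psd (k := k) _); first by move=> v [].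
  by rewrite size_tuple -ltnS.
apply: (@psd_form_sum _ _ _ _ _ _ (fun (b : k.-tuple bool) v w => ip mu4 (D `*` D)
      (quotient theta (wderiv D b v)) (quotient theta (wderiv D b w)))) => b th0.
apply: (pull_form (L := fun v => quotient theta (wderiv D b v))).
- exact: measurableX.
- exact: Hspace_linear.
- by move=> v hv; exact: Hspace_quotient.
move=> a c v w [hv _] [hw _]; rewrite -quotient_comb; apply: quotient_ae.
by apply: wderiv_comb hv hw _; rewrite size_tuple.
Qed.

Lemma HsqE s v : Hspace (Num.truncn s) (s - (Num.truncn s)%:R) v ->
  Hsq D s v = (hform s v v)%:E.
Proof.
rewrite /Hsq /hform; set k := Num.truncn s; set theta := s - k%:R => hv.
have [iv _] := hv; rewrite asboolT// EFinD; congr (_ + _)%E.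
  rewrite -sumEFin; apply: eq_bigr => j _; rewrite -sumEFin; apply: eq_bigr => b _.
  apply: (sqintE mD); apply: Hint_wderivL2 iv _.
  by rewrite size_tuple -ltnS.
case: ifPn => [th0|/negbTE th0]; last by rewrite big1// => b; rewrite th0.
rewrite -sumEFin (eq_bigl xpredT)//; apply: eq_bigr => b _.
have mDD : measurable (D `*` D) by exact: measurableX.
rewrite slobodeckii_sqint//; first by apply: (sqintE mDD); exact: Hspace_quotient.
by case: (@Hint_wderivL2 k v b iv) => //; rewrite size_tuple.
Qed.

Lemma Hsq_lty s v : (Hsq D s v < +oo)%E <->
  Hspace (Num.truncn s) (s - (Num.truncn s)%:R) v.
Proof.
split; last by move=> hv; rewrite HsqE// ltry.
rewrite /Hsq; set k := Num.truncn s; set theta := s - k%:R.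
case: ifPn => [/asboolP hv|_]; last by rewrite ltxx.
move=> lt; split => // th0 b; move: lt; rewrite th0 => lt.
have S0 (c : k.-tuple bool) : (0 <= slobodeckii_sq D theta (wderiv D c v))%E.
  rewrite slobodeckii_sqint ?sqint_ge0//.
  by case: (@Hint_wderivL2 k v c hv) => //; rewrite size_tuple.
apply: le_lt_trans lt; rewrite (bigD1 b)//=.
apply: (@le_trans _ _ (slobodeckii_sq D theta (wderiv D b v) +
   \sum_(i | i != b) slobodeckii_sq D theta (wderiv D i v))%E).
  by rewrite leeDl// sume_ge0.
rewrite leeDr//; apply: sume_ge0 => j _; apply: sume_ge0 => c _.
by apply: sqint_ge0.
Qed.

Lemma sqrte_lty (x : \bar R) : (sqrte x < +oo)%E <-> (x < +oo)%E.
Proof. by case: x => [r| |] //=; rewrite !ltry. Qed.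

Lemma HsP s v : Hs D s v <-> Hspace (Num.truncn s) (s - (Num.truncn s)%:R) v.
Proof. by rewrite -Hsq_lty -sqrte_lty. Qed.

Lemma Hs_linear s : linear_set (Hs D s).
Proof. by move=> a b f g /HsP hf /HsP hg; apply/HsP; exact: Hspace_linear. Qed.

Lemma hform_psd s : psd_form (Hs D s) (hform s).
Proof. by apply: sub_psd_form (hform_of_psd _ _) => v /HsP. Qed.

Lemma HnormE s v : Hs D s v -> Hnorm D s v = (Num.sqrt (hform s v v))%:E.
Proof. by move=> /HsP hv; rewrite /Hnorm HsqE. Qed.

Lemma Hint_Hs k v : Hs D k%:R v <-> Hint D k v.
Proof. by rewrite HsP /Hspace /= natrK subrr; split => [[]//|hv]; split => //; rewrite ltxx. Qed.

End sobolev.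

(** * Zero boundary values *)
Section form_bounds.
Context (X : Type) (R : realType).
Variables (V : set (X -> R)) (B : (X -> R) -> (X -> R) -> R).
Hypotheses (hV : linear_set V) (hB : psd_form V B).

Lemma form_comb_le a b f g : V f -> V g ->
  B (comb a f b g) (comb a f b g) <= 2 * a ^+ 2 * B f f + 2 * b ^+ 2 * B g g.
Proof.
move=> Vf Vg; have h1 := form_ge0 hB (hV a (- b) Vf Vg).
move: h1; rewrite !(form_quad hV hB)// sqrrN.
move: (B f f) (B f g) (B g g) => p q r; lra.
Qed.

Lemma form_sub_le f g k : V f -> V g -> V k ->
  B (f \- k)%R (f \- k)%R <= 2 * B (f \- g)%R (f \- g)%R + 2 * B (g \- k)%R (g \- k)%R.
Proof.
move=> Vf Vg Vk.
have -> : (f \- k)%R = comb 1 (f \- g)%R 1 (g \- k)%R.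
  by apply/funext => x; rewrite /comb /=; ring.
have V1 : V (f \- g)%R by rewrite combB; exact: hV.
have V2 : V (g \- k)%R by rewrite combB; exact: hV.
by apply: le_trans (form_comb_le 1 1 V1 V2) _; rewrite expr1n !mulr1.
Qed.

End form_bounds.

Section poincare.
Context {R : realType}.
Local Notation plane := (plane R).
Local Notation mu2 := (mu2 R).

Lemma convex_square h : convex2 (square h : set plane).
Proof.
move=> x y t /squareP[x1 x2] /squareP[y1 y2] /andP[t0 t1]; apply/squareP => /=.
by move: x1 x2 y1 y2; rewrite !ler_norml => /andP[? ?] /andP[? ?] /andP[? ?] /andP[? ?];
  split; apply/andP; split; nra.
Qed.

Lemma diam_square h : diam_bound (square h : set plane) (2 * h).
Proof.
move=> x y /squareP[x1 x2] /squareP[y1 y2].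
by move: x1 x2 y1 y2; rewrite !ler_norml => /andP[? ?] /andP[? ?] /andP[? ?] /andP[? ?];
  split; apply/andP; split; lra.
Qed.

Lemma slobodeckii_mono (D K : set plane) theta f : measurable D -> measurable K ->
  D `<=` K -> measurable_fun K f -> (slobodeckii_sq D theta f <= slobodeckii_sq K theta f)%E.
Proof.
move=> mD mK sub mf; rewrite !slobodeckii_sqint//; last exact: measurable_funS mf.
apply: ge0_subset_integral.
- exact: measurableX.
- exact: measurableX.
- by apply: measurable_sq; exact: measurable_quotient.
- by move=> z _; rewrite lee_fin sqr_ge0.
- by move=> z [/= /sub h1 /sub h2].
Qed.

Lemma sqr_sum_eq0 (p q : R) : p ^+ 2 + q ^+ 2 = 0 -> p = 0 /\ q = 0.
Proof.
by move/eqP; rewrite paddr_eq0 ?sqr_ge0// !sqrf_eq0 => /andP[/eqP -> /eqP ->].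
Qed.

(** With c the integral of psi, the function c g(x) - (g, psi) is the integral
    over y of psi(y) (g(x) - g(y)). Apply Cauchy and Schwarz, then insert
    |x - y|^2 <= 2 H^2 to obtain the kernel of the seminorm with theta = 0. *)
Theorem weighted_poincare (K : set plane) (h H : R) (g psi : plane -> R) :
  measurable K -> K `<=` square h -> diam_bound K H ->
  inL2 mu2 K g -> inL2 mu2 K psi ->
  (((\int[mu2]_(x in K) psi x) ^+ 2)%:E * sqint mu2 K g <=
   (4 * H ^+ 2 * ip mu2 K psi psi)%:E * slobodeckii_sq K 0 g +
   (2 * (ip mu2 K g psi) ^+ 2)%:E * mu2 K)%E.
Proof.
move=> mK Kh dK hg hp; set c := (\int[mu2]_(x in K) psi x)%R.
set a := ip mu2 K g psi; set P := ip mu2 K psi psi.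
have [mg _] := hg; have [mp _] := hp.
have P0 : 0 <= P by exact: ip_ge0.
have L2c (b : R) : inL2 mu2 K (fun=> b).
  by apply: (@inL2_bounded _ K h `|b|) => // x _.
have ipc (b : R) : ip mu2 K (fun=> b) psi = b * c.
  have -> : (fun=> b) = comb b (fun=> 1) 0 (fun=> 0) :> (plane -> R).
    by apply/funext => x; rewrite /comb; ring.
  rewrite ip_combl// mul0r addr0; congr (_ * _).
  by rewrite /ip /c; apply: eq_Rintegral => x _; rewrite mul1r.
pose d x := c * g x - a.
have hd : inL2 mu2 K d.
  have -> : d = comb c g (-1) (fun=> a) by apply/funext => x; rewrite /d /comb; ring.
  exact: inL2_comb.
have mk := measurable_slob_kernel 0 mK mg.
have k0 x y : 0 <= slob_kernel K 0 g x y by exact: slob_kernel_ge0.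
pose S x := (\int[mu2]_y (slob_kernel K 0 g x y)%:E)%E.
have S0 x : (0 <= S x)%E by apply: integral_ge0 => y _; rewrite lee_fin.
have mS : measurable_fun setT S.
  exact: (@measurable_fun_fubini_tonelli_F _ _ _ _ _ (@smu2 R) _ mk (fun z => k0 z.1 z.2)).
have pt x : K x -> ((d x ^+ 2)%:E <= (2 * H ^+ 2 * P)%:E * S x)%E.
  move=> Kx; have hgx : inL2 mu2 K (fun y => g x - g y).
    exact: (inL2B mK (L2c (g x)) hg).
  have -> : d x = ip mu2 K (fun y => g x - g y) psi.
    have -> : (fun y => g x - g y) = comb 1 (fun=> g x) (-1) g.
      by apply/funext => y; rewrite /comb; ring.
    by rewrite ip_combl// ipc /d -/a; ring.
  have cs := ip_CS mK hgx hp; rewrite -/P in cs.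
  apply: (@le_trans _ _ (P%:E * sqint mu2 K (fun y => (g x - g y)%R))%E).
    by rewrite (sqintE mK hgx) -EFinM lee_fin mulrC.
  rewrite (mulrC _ P) EFinM -muleA lee_wpmul2l//.
  rewrite /S -(ge0_integralZl_EFin); last 4 first.
  - exact: measurableT.
  - by move=> y _; rewrite lee_fin.
  - exact: (measurableT_comp mk (pair1_measurable x)).
  - by rewrite mulr_ge0// sqr_ge0.
  rewrite /sqint [X in (X <= _)%E]integral_mkcond; apply: ge0_le_integral => //.
  - by move=> y _; rewrite patchE; case: ifP => _//; rewrite lee_fin sqr_ge0.
  - apply/(measurable_restrictT _ mK); apply: measurable_sq; by case: hgx.
  - by apply: measurable_funeM; exact: (measurableT_comp mk (pair1_measurable x)).
  move=> y _; rewrite patchE; case: ifPn => [|_]; last first.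
    by rewrite mule_ge0// lee_fin// mulr_ge0// sqr_ge0.
  rewrite inE => Ky; rewrite -EFinM lee_fin /slob_kernel !indicE !mem_set//= !mul1r.
  rewrite mulr0 addr0 powR_mulrn ?sqrtr_ge0// sqr_sqrtr ?addr_ge0 ?sqr_ge0//.
  set N : R := ((x.1 - y.1) ^+ 2 + (x.2 - y.2) ^+ 2).
  have [/eqP N0|N0] := eqVneq N 0.
    have : x = y.
      have [e1 e2] := sqr_sum_eq0 (eqP N0).
      have e3 : (x.1 : R) = y.1 by apply/eqP; rewrite -subr_eq0 e1.
      have e4 : (x.2 : R) = y.2 by apply/eqP; rewrite -subr_eq0 e2.
      by case: (x) (y) e3 e4 => [? ?] [? ?] /= -> ->.
    by move=> ->; rewrite subrr expr0n mul0r mulr0.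
  have Np : 0 < N by rewrite lt0r N0 addr_ge0 ?sqr_ge0.
  rewrite mulrA ler_pdivlMr// [leLHS]mulrC ler_wpM2r ?sqr_ge0// /N.
  have [] := dK x y Kx Ky; rewrite !ler_norml => /andP[? ?] /andP[? ?]; nra.
have int : (sqint mu2 K d <= (2 * H ^+ 2 * P)%:E * slobodeckii_sq K 0 g)%E.
  rewrite slob_kernelE// -/S.
  have H2 := sqr_ge0 H; have C0 : 0 <= 2 * H ^+ 2 * P by do 2! apply: mulr_ge0 => //.
  rewrite -(ge0_integralZl_EFin _ measurableT); [|by move=> x _; exact: S0|exact: mS|exact: C0].
  apply: (@le_trans _ _ (\int[mu2]_(x in K) ((2 * H ^+ 2 * P)%:E * S x))%E).
    apply: ge0_le_integral => //.
    - by move=> x _; rewrite lee_fin sqr_ge0.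
    - by apply: measurable_sq; case: hd.
    - by apply: measurable_funeM; exact: measurable_funTS.
  apply: ge0_subset_integral => //; first exact: measurable_funeM.
  by move=> x _; rewrite mule_ge0// lee_fin.
have e1 : ((c ^+ 2)%:E * sqint mu2 K g)%E = sqint mu2 K (comb 1 d 1 (fun=> a)).
  rewrite (_ : comb _ _ _ _ = (fun x => c * g x)); last first.
    by apply/funext => x; rewrite /comb /d; ring.
  have hcg := inL2Z mK c hg; rewrite (sqintE mK hg) (sqintE mK hcg) -EFinM; congr EFin.
  have -> : (fun x => c * g x) = comb c g 0 g by apply/funext => x; rewrite /comb; ring.
  by rewrite (form_quad (inL2_linear mK) (ip_psd _ mK))//; ring.
have md : measurable_fun K d by case: hd.
apply: (@le_trans _ _ (sqint mu2 K (comb 1 d 1 (fun=> a)))).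
  by rewrite le_eqVlt; apply/orP; left; apply/eqP; exact: e1.
have := sqint_comb_le mu2 mK 1 1 md (measurable_cst (a : R)).
move/le_trans; apply; rewrite expr1n mulr1; apply: leeD.
  apply: (@le_trans _ _ (2%:E * ((2 * H ^+ 2 * P)%:E * slobodeckii_sq K 0 g))%E).
    by rewrite lee_wpmul2l.
  by rewrite muleA -EFinM !mulrA -natrM.
have -> : sqint mu2 K (cst a) = ((a ^+ 2)%:E * mu2 K)%E by exact: (@integral_cst _ _ _ mu2 K mK (a ^+ 2)%:E).
by rewrite muleA -EFinM.
Qed.

End poincare.

Section approximation.
Context {R : realType}.
Local Notation plane := (plane R).
Local Notation mu2 := (mu2 R).

(** Enough regularity to apply estimates for smooth functions, and preserved
    both by restriction of functions of H^m_0 to a triangle and by subtraction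
    of polynomials. *)
Definition approximable (K : set plane) (m : nat) (w : plane -> R) : Prop :=
  Hint K m w /\ forall e : R, 0 < e -> exists2 f, smooth f &
    forall b, (size b <= m)%N -> (sqint mu2 K (pderiv (rev b) f \- wderiv K b w)%R <= e%:E)%E.

End approximation.

Section zero_boundary.
Context {R : realType}.
Local Notation plane := (plane R).
Local Notation mu2 := (mu2 R).
Variables (D : set plane) (h : R).
Hypotheses (oD : open D) (Dh : D `<=` square h) (h0 : 0 < h).
Let mD := open_measurable2 oD.

Lemma strong_gradient_smooth f : smooth f ->
  strong_gradient (square h) f (pderiv [:: false] f) (pderiv [:: true] f).
Proof.
move=> sf.
have L2 g : smooth g -> inL2 mu2 (square h) g.
  by move=> sg; exact: (inL2_smooth (measurable_square h) (fun x => id)).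
split; try exact: L2; try by apply: L2; exact: smooth_pderiv.
move=> e e0; exists f; split => //.
all: rewrite (_ : (_ \- _)%R = (fun=> 0)); last by apply/funext => x /=; rewrite subrr.
all: by rewrite /sqint expr0n integral0 lee_fin ltW.
Qed.

Lemma slob_finite (K theta : R) (g g0 g1 : plane -> R) : 0 <= theta < 1 -> strong_gradient (square K) g g0 g1 ->
  0 < K -> (slobodeckii_sq (square K) theta g < +oo)%E.
Proof.
move=> hth hg K0; have [_ hg0 hg1 _] := hg; have mS := measurable_square K.
have H0 : 0 < 2 * K by rewrite mulr_gt0.
apply: le_lt_trans (slob_strong mS (@convex_square _ K) (@diam_square _ K) H0 hth hg) _.
by rewrite (sqintE mS hg0) (sqintE mS hg1) -EFinD -EFinM ltry.
Qed.

Lemma truncn_theta (s : R) : 0 < s - (Num.truncn s)%:R -> 0 <= s - (Num.truncn s)%:R < 1.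
Proof.
move=> th0; rewrite (ltW th0)/= ltrBlDr addrC.
have := truncnS_gt s; rewrite -addn1 natrD; lra.
Qed.

Lemma Hs_smooth s f : smooth f -> Hs D s f.
Proof.
move=> sf; apply/(HsP oD); split; first exact: (Hint_smooth oD Dh _ sf).
move=> th0 b; have hth := truncn_theta th0.
have sb : smooth (pderiv (rev b) f) by exact: smooth_pderiv.
have mS := measurable_square h.
have hw := is_wderiv_smooth oD Dh b sf.
have e := wderiv_ae oD Dh hw.
have [mw _] : inL2 mu2 D (wderiv D b f) by case: (wderivP (ex_intro _ _ hw)).
have mDD : measurable (D `*` D) by exact: measurableX.
rewrite slobodeckii_sqint// (@sqint_ae _ _ _ mu4 _ mDD _ _ _ _ (quotient_ae _ e)); last 2 first.
- exact: measurable_quotient.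
- by apply: measurable_quotient => //; exact: smooth_measurable.
rewrite -slobodeckii_sqint//; last exact: smooth_measurable.
apply: le_lt_trans (slobodeckii_mono _ mD mS Dh (smooth_measurable sb)) _.
exact: slob_finite hth (strong_gradient_smooth sb) h0.
Qed.

Lemma sqrte_lt (x : \bar R) (e : R) : 0 < e -> (0 <= x)%E ->
  (sqrte x < e%:E)%E <-> (x < (e ^+ 2)%:E)%E.
Proof.
move=> e0; case: x => [r| |]//; rewrite !lte_fin lee_fin => r0.
rewrite -[in X in _ <-> X](sqr_sqrtr r0); split => hlt.
  by rewrite ltrXn2r ?sqrtr_ge0// ltW.
by move: hlt; rewrite ltr_pXn2r// ?nnegrE ?sqrtr_ge0// ltW.
Qed.

Lemma H0P s v : H0 D s v <-> Hs D s v /\ forall e : R, 0 < e ->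
  exists2 phi, test_function D phi & hform D s (v \- phi)%R (v \- phi)%R <= e.
Proof.
have B phi : Hs D s v -> test_function D phi -> Hs D s (v \- phi)%R.
  move=> hv /test_smooth sp; rewrite combB; apply: (Hs_linear oD Dh (s := s) 1 (-1) hv).
  exact: Hs_smooth.
have p0 u : Hs D s u -> 0 <= hform D s u u.
  by move=> hu; exact: (form_ge0 (hform_psd oD Dh s) hu).
split=> -[hv app]; split => // e e0.
  have q0 : 0 < Num.sqrt e by rewrite sqrtr_gt0.
  have [phi tphi hlt] := app _ q0; exists phi => //.
  have hd := B _ hv tphi; move: hlt; rewrite (HnormE oD hd) lte_fin ltr_sqrt//.
  exact: ltW.
have q0 : 0 < e ^+ 2 / 2 by rewrite divr_gt0// exprn_gt0.
have [phi tphi hle] := app _ q0; exists phi => //.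
have hd := B _ hv tphi; rewrite (HnormE oD hd).
apply/(@sqrte_lt (hform D s (v \- phi)%R (v \- phi)%R)%:E) => //; rewrite ?lee_fin ?p0//.
by rewrite lte_fin (le_lt_trans hle)// ltr_pdivrMr// ltr_pMr ?exprn_gt0// ltr1n.
Qed.

Lemma H0_Hs s v : H0 D s v -> Hs D s v.
Proof. by case. Qed.

Lemma H0_linear s : linear_set (H0 D s).
Proof.
move=> a b f g /H0P[hf af] /H0P[hg ag]; apply/H0P; split; first exact: (Hs_linear oD Dh (s := s) a b hf hg).
move=> e e0; pose c := 2 * a ^+ 2 + 2 * b ^+ 2 + 1.
have c0 : 0 < c by rewrite /c; have := sqr_ge0 a; have := sqr_ge0 b; lra.
have [p tp hp] := af _ (divr_gt0 e0 c0); have [q tq hq] := ag _ (divr_gt0 e0 c0).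
exists (comb a p b q); first exact: test_comb.
have Hp : Hs D s p by apply: Hs_smooth; exact: test_smooth tp.
have Hq : Hs D s q by apply: Hs_smooth; exact: test_smooth tq.
have L := Hs_linear oD Dh (s := s).
have -> : (comb a f b g \- comb a p b q)%R = comb a (f \- p)%R b (g \- q)%R.
  by apply/funext => x; rewrite /comb/=; ring.
have H1 : Hs D s (f \- p)%R by rewrite combB; exact: L.
have H2 : Hs D s (g \- q)%R by rewrite combB; exact: L.
apply: le_trans (form_comb_le L (hform_psd oD Dh s) a b H1 H2) _.
have a2 := sqr_ge0 a; have b2 := sqr_ge0 b.
apply: (@le_trans _ _ (2 * a ^+ 2 * (e / c) + 2 * b ^+ 2 * (e / c))).
  have a3 : 0 <= 2 * a ^+ 2 by exact: mulr_ge0.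
  have b3 : 0 <= 2 * b ^+ 2 by exact: mulr_ge0.
  exact: (lerD (ler_wpM2l a3 hp) (ler_wpM2l b3 hq)).
rewrite -mulrDl mulrA ler_pdivrMr// mulrC ler_wpM2l ?(ltW e0)//.
by rewrite /c lerDl.
Qed.

Lemma H0_smooth s phi : test_function D phi -> H0 D s phi.
Proof.
move=> tp; have Hp : Hs D s phi by apply: Hs_smooth; exact: test_smooth tp.
apply/H0P; split => // e e0; exists phi => //.
have -> : (phi \- phi)%R = comb 0 phi 0 phi by apply/funext => x; rewrite /comb/=; ring.
rewrite (form_quad (Hs_linear oD Dh (s:=s)) (hform_psd oD Dh s))//.
by rewrite expr0n/= !mul0r mulr0 mul0r !addr0 ltW.
Qed.

Lemma H0B s f g : H0 D s f -> H0 D s g -> H0 D s (f \- g)%R.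
Proof. by move=> hf hg; rewrite combB; exact: (H0_linear 1 (-1) hf hg). Qed.

Lemma H0_Hint m v : H0 D m%:R v -> Hint D m v.
Proof. by move=> /H0_Hs /(Hint_Hs oD). Qed.

Lemma hform_nat m (v w : plane -> R) : hform D m%:R v w =
  \sum_(j < m.+1) \sum_(b : j.-tuple bool) ip mu2 D (wderiv D b v) (wderiv D b w).
Proof.
rewrite /hform /hform_of natrK subrr [X in _ + X]big1 ?addr0// => b.
by rewrite ltxx.
Qed.

Lemma sqint_le_hform m w v : (size w <= m)%N -> Hint D m v ->
  ip mu2 D (wderiv D w v) (wderiv D w v) <= hform D m%:R v v.
Proof.
move=> wm hv; rewrite hform_nat.
have wm' : (size w < m.+1)%N by [].
rewrite (bigD1 (Ordinal wm'))//= (bigD1 (in_tuple w))//= -addrA lerDl addr_ge0//.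
  by apply: sumr_ge0 => b _; exact: ip_ge0.
by apply: sumr_ge0 => j _; apply: sumr_ge0 => b _; exact: ip_ge0.
Qed.

Lemma H0_limit m v (e : R) : H0 D m%:R v -> 0 < e -> exists2 phi, test_function D phi &
  forall b, (size b <= m)%N -> (sqint mu2 D (pderiv (rev b) phi \- wderiv D b v)%R <= e%:E)%E.
Proof.
move=> /H0P[/(Hint_Hs oD) hv app] e0; have [phi tp le] := app e e0; exists phi => // b bm.
have sp := test_smooth tp; have hphi := Hint_smooth oD Dh m sp.
have hd : Hint D m (v \- phi)%R by rewrite combB; exact: (Hint_linear oD Dh).
apply: (@le_trans _ _ (sqint mu2 D (wderiv D b (v \- phi)%R))); last first.
  rewrite (sqintE mD (Hint_wderivL2 hd bm)) lee_fin.
  exact: le_trans (sqint_le_hform bm hd) le.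
have e1 : ae_eq mu2 D (wderiv D b (v \- phi)%R) (wderiv D b v \- pderiv (rev b) phi)%R.
  apply: (wderiv_ae oD Dh); rewrite !combB; apply: (is_wderiv_comb oD Dh).
  + exact: Hint_L2 hv.
  + exact: Hint_L2 hphi.
  + exact: (Hint_wderiv hv bm).
  + exact: (is_wderiv_smooth oD Dh).
have [mw _] := Hint_wderivL2 hv bm; have [mw' _] := Hint_wderivL2 hd bm.
have mp : measurable_fun D (pderiv (rev b) phi) by apply: smooth_measurable; exact: smooth_pderiv.
rewrite (sqint_ae mD mw' (measurable_funB mw mp) e1).
rewrite le_eqVlt; apply/orP; left; apply/eqP; apply: eq_integral => x _.
by rewrite /= -opprB sqrrN.
Qed.

Lemma H0_approximable m v : H0 D m%:R v -> approximable D m v.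
Proof.
move=> hv; split; first exact: H0_Hint.
move=> e e0; have [phi tp h1] := H0_limit hv e0; exists phi => //.
exact: test_smooth tp.
Qed.

Lemma sqint_extension (K : R) (f : plane -> R) : D `<=` square K ->
  sqint mu2 (square K) (f \_ D) = sqint mu2 D f.
Proof.
move=> DK; rewrite /sqint [RHS]integral_mkcond [LHS]integral_mkcond.
apply: eq_integral => x _; rewrite !patchE; case: (boolP (x \in D)) => xD.
  by rewrite mem_set//; apply: DK; exact: set_mem.
by rewrite expr0n if_same.
Qed.

(** Test functions approximate the derivatives on D and vanish, with all their
    derivatives, outside: the zero extensions are approximated as well. *)
Lemma H0_strong_gradient m w v (K : R) : H0 D m%:R v -> (size w < m)%N -> D `<=` square K ->
  strong_gradient (square K) (wderiv D w v \_ D)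
     (wderiv D (rcons w false) v \_ D) (wderiv D (rcons w true) v \_ D).
Proof.
move=> hv wm DK; have hi := H0_Hint hv; have mS := measurable_square K.
have ext w' : (size w' <= m)%N -> inL2 mu2 (square K) (wderiv D w' v \_ D).
  move=> w'm; have [mw fw] := Hint_wderivL2 hi w'm; split.
    by apply: measurable_funTS; exact: ((measurable_restrictT _ mD).1 mw).
  by rewrite sqint_extension.
split.
- by apply: ext; exact: ltnW.
- by apply: ext; rewrite size_rcons.
- by apply: ext; rewrite size_rcons.
move=> e e0; have [phi tp lim] := H0_limit hv e0; have sp := test_smooth tp.
have key w' : (size w' <= m)%N ->
    (sqint mu2 (square K) (pderiv (rev w') phi \- (wderiv D w' v \_ D))%R <= e%:E)%E.
  move=> w'm; rewrite (_ : (_ \- _)%R = (pderiv (rev w') phi \- wderiv D w' v)%R \_ D).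
    by rewrite sqint_extension//; exact: lim.
  apply/funext => x; rewrite /= !patchE; case: ifPn => //= xD.
  by rewrite (test_outside _ tp) ?subr0// => Dx; move/negP : xD; apply; rewrite inE.
exists (pderiv (rev w) phi); split.
- exact: smooth_pderiv.
- by apply: key; exact: ltnW.
- by have := key (rcons w false); rewrite size_rcons rev_rcons; exact.
- by have := key (rcons w true); rewrite size_rcons rev_rcons; exact.
Qed.

Lemma slobodeckii_extension (K theta : R) (f : plane -> R) : D `<=` square K ->
  measurable_fun D f -> (slobodeckii_sq D theta f <= slobodeckii_sq (square K) theta (f \_ D))%E.
Proof.
move=> DK mf; have mS := measurable_square K.
have mfD : measurable_fun setT (f \_ D) by exact: ((measurable_restrictT f mD).1 mf).
have -> : slobodeckii_sq D theta f = slobodeckii_sq D theta (f \_ D).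
  apply: eq_integral => x xD; apply: eq_integral => y yD.
  by rewrite !patchE xD yD.
by apply: slobodeckii_mono => //; exact: measurable_funTS.
Qed.

(** The domain is not convex; its large square is. *)
Lemma H0_slobodeckii m w v theta : H0 D m%:R v -> (size w < m)%N -> 0 <= theta < 1 ->
  (slobodeckii_sq D theta (wderiv D w v) <=
   (2 * slob_const theta (2 * h))%:E *
   (sqint mu2 D (wderiv D (rcons w false) v) + sqint mu2 D (wderiv D (rcons w true) v)))%E.
Proof.
move=> hv wm hth; have hi := H0_Hint hv.
have [mw _] := Hint_wderivL2 hi (ltnW wm).
apply: le_trans (slobodeckii_extension theta Dh mw) _.
have H0 : 0 < 2 * h by rewrite mulr_gt0.
have := slob_strong (measurable_square h) (@convex_square _ h) (@diam_square _ h) H0 hth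
   (H0_strong_gradient hv wm Dh).
by rewrite !sqint_extension.
Qed.

(** Zero extensions vanish between the square of half-width h and the one of
    half-width 2h. With this region as weight the mean is zero. *)
Lemma H0_poincare : exists2 C : R, 0 <= C & forall m w v, H0 D m%:R v -> (size w < m)%N ->
  (sqint mu2 D (wderiv D w v) <= C%:E *
   (sqint mu2 D (wderiv D (rcons w false) v) + sqint mu2 D (wderiv D (rcons w true) v)))%E.
Proof.
pose K : set plane := square (2 * h); have mK : measurable K by exact: measurable_square.
have DK : D `<=` K.
  by move=> x /Dh /squareP[x1 x2]; apply/squareP; split; rewrite (le_trans x1, le_trans x2)// ler_peMl ?ler1n// ltW.
pose E := K `\` square h; have mE : measurable E by apply: measurableD => //; exact: measurable_square.
pose psi : plane -> R := \1_E.
have mpsi : measurable_fun setT psi by exact: measurable_indic.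
have hpsi : inL2 mu2 K psi.
  apply: (@inL2_bounded _ K (2 * h) 1) => //; first exact: measurable_funTS.
  by move=> x _; rewrite /psi indicE; case: (_ \in _); rewrite ?normr1// normr0.
set c := (\int[mu2]_(x in K) psi x)%R.
have c0 : 0 < c.
  have muE : mu2 E = ((4 * h) ^+ 2 - (2 * h) ^+ 2)%:E.
    have s1 : mu2 K = ((2 * (2 * h)) ^+ 2)%:E by apply: leb2_square; rewrite mulr_ge0// ltW.
    have s2 : mu2 (square h) = ((2 * h) ^+ 2)%:E by apply: leb2_square; rewrite ltW.
    rewrite /E measureD//=; last 2 first.
    - exact: measurable_square.
    - by rewrite s1 ltry.
    rewrite setIidr; last first.
      by move=> x /squareP[x1 x2]; apply/squareP; split; rewrite (le_trans x1, le_trans x2)// ler_peMl ?ler1n// ltW.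
    by rewrite s1 s2 -EFinB; congr (_ - _)%:E; ring.
  have -> : c = (4 * h) ^+ 2 - (2 * h) ^+ 2.
    rewrite /c /Rintegral /psi integral_indic// setIidl ?muE//.
    by move=> x [].
  by rewrite subr_gt0 ltr_pXn2r ?nnegrE ?mulr_ge0 ?(ltW h0)// ltr_pM2r// ltr_nat.
set P := ip mu2 K psi psi; have P0 : 0 <= P by exact: ip_ge0.
pose H := 2 * (2 * h); have H0 : 0 < H by rewrite !mulr_gt0.
pose C := (4 * H ^+ 2 * P) * (2 * slob_const 0 H) / c ^+ 2.
have c2 : 0 < c ^+ 2 by rewrite exprn_gt0.
exists C.
  have H2 := sqr_ge0 H; have s0 : 0 <= slob_const 0 H by exact: sqr_ge0.
  by apply: divr_ge0; [|exact: ltW]; apply: mulr_ge0; [do 2! apply: mulr_ge0 => // | exact: mulr_ge0].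
move=> m w v hv wm; have hi := H0_Hint hv.
have sg := H0_strong_gradient hv wm DK.
have [hg hg0 hg1 _] := sg.
have hth : 0 <= (0 : R) < 1 by rewrite lexx ltr01.
have wp := weighted_poincare mK (fun x => id) (@diam_square _ (2 * h)) hg hpsi.
have ss := slob_strong mK (@convex_square _ (2 * h)) (@diam_square _ (2 * h)) H0 hth sg.
(* The zero extension vanishes where psi does not. *)
have a0 : ip mu2 K (wderiv D w v \_ D) psi = 0.
  rewrite /ip /Rintegral (eq_integral (fun=> 0%E)) ?integral0// => x _.
  rewrite patchE /psi indicE; case: (boolP (x \in D)) => xD; last by rewrite mul0r.
  rewrite memNset ?mulr0// => -[_]; apply; apply: Dh; exact: set_mem.
move: wp; rewrite a0 expr0n mulr0 mul0e adde0 -/c -/P.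
rewrite !(sqint_extension _ DK) in ss *.
have iw := sqintE mD (Hint_wderivL2 hi (ltnW wm)).
have r0 : (size (rcons w false) <= m)%N by rewrite size_rcons.
have r1 : (size (rcons w true) <= m)%N by rewrite size_rcons.
have i0 := sqintE mD (Hint_wderivL2 hi r0).
have i1 := sqintE mD (Hint_wderivL2 hi r1).
rewrite iw i0 i1 -EFinD -EFinM lee_fin in ss *.
move=> wp; have H2 := sqr_ge0 H.
have A0 : (0 <= (4 * H ^+ 2 * P)%:E)%E by rewrite lee_fin; do 2! apply: mulr_ge0 => //.
have := le_trans wp (lee_wpmul2l A0 ss).
rewrite -!EFinM !lee_fin => le1.
by rewrite /C mulrAC ler_pdivlMr// [leLHS]mulrC -[leRHS]mulrA.
Qed.

(** Iterate from the derivatives of order m down to those of lower order. *)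
Theorem friedrichs m : exists2 C : R, 0 <= C &
  forall v, H0 D m%:R v -> hform D m%:R v v <= C * aform D m v v.
Proof.
have [C C0 hC] := H0_poincare.
have key j w v : H0 D m%:R v -> (size w + j = m)%N ->
    ip mu2 D (wderiv D w v) (wderiv D w v) <= (2 * C) ^+ j * aform D m v v.
  move=> hv; have hi := H0_Hint hv; elim: j w => [|j IH] w wj.
    rewrite expr0 mul1r; have wm : size w == m by rewrite -wj addn0.
    rewrite /aform (bigD1 (Tuple wm))//= lerDl.
    by apply: sumr_ge0 => b _; exact: ip_ge0.
  have wm : (size w < m)%N by rewrite -wj addnS ltnS leq_addr.
  have r b : (size (rcons w b) <= m)%N by rewrite size_rcons.
  have := hC m w v hv wm.
  rewrite (sqintE mD (Hint_wderivL2 hi (ltnW wm))) !(sqintE mD (Hint_wderivL2 hi (r _))).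
  rewrite -EFinD -EFinM lee_fin => /le_trans; apply.
  have s b : (size (rcons w b) + j = m)%N by rewrite size_rcons addSnnS.
  apply: le_trans (ler_wpM2l C0 (lerD (IH _ (s false)) (IH _ (s true)))) _.
  by rewrite exprS; lra.
exists (\sum_(j < m.+1) \sum_(b : j.-tuple bool) (2 * C) ^+ (m - j)).
  by apply: sumr_ge0 => j _; apply: sumr_ge0 => b _; rewrite exprn_ge0// mulr_ge0.
move=> v hv; rewrite hform_nat mulr_suml; apply: ler_sum => j _.
rewrite mulr_suml; apply: ler_sum => b _; apply: key => //.
by rewrite size_tuple subnKC// -ltnS.
Qed.

Lemma ip_word_le m (X : seq bool -> R) (M : R) :
  (forall b : seq bool, (size b <= m)%N -> X b <= M) ->
  \sum_(j < m.+1) \sum_(b : j.-tuple bool) X b <=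
  (\sum_(j < m.+1) \sum_(b : j.-tuple bool) 1) * M.
Proof.
move=> hX; rewrite mulr_suml; apply: ler_sum => j _.
rewrite mulr_suml; apply: ler_sum => b _; rewrite mul1r; apply: hX.
by rewrite size_tuple -ltnS.
Qed.

(** All derivatives converge in L2 by the inequality of Friedrichs, and their
    limits are the derivatives of the limit. *)
Theorem H0_complete m (v : nat -> plane -> R) (K : R) : 0 <= K ->
  (forall n, H0 D m%:R (v n)) ->
  (forall n k, aform D m (v n \- v k)%R (v n \- v k)%R <= K * (4^-1 ^+ n + 4^-1 ^+ k)) ->
  exists2 z, H0 D m%:R z &
    exists C, forall n, aform D m (v n \- z)%R (v n \- z)%R <= C * 4^-1 ^+ n.
Proof.
move=> K0 hv cauchy; have [C C0 fr] := friedrichs m.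
have hi n : Hint D m (v n) by exact: H0_Hint.
have hd n k : H0 D m%:R (v n \- v k)%R by exact: (H0B (hv n) (hv k)).
have e4 n : 0 <= 4^-1 ^+ n :> R by rewrite exprn_ge0// invr_ge0.
have CK : 0 <= C * K by exact: mulr_ge0.
have wcauchy w n k : (size w <= m)%N ->
    (sqint mu2 D (wderiv D w (v n) \- wderiv D w (v k))%R <=
     (C * K * (4^-1 ^+ n + 4^-1 ^+ k))%:E)%E.
  move=> wm; have hi' := H0_Hint (hd n k).
  have [m1 _] := Hint_wderivL2 hi' wm.
  have [m2 _] := Hint_wderivL2 (hi n) wm; have [m3 _] := Hint_wderivL2 (hi k) wm.
  have e : ae_eq mu2 D (wderiv D w (v n \- v k)%R) (wderiv D w (v n) \- wderiv D w (v k))%R.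
    by rewrite !combB; exact: (wderiv_comb oD Dh 1 (-1) (hi n) (hi k) wm).
  rewrite -(sqint_ae mD m1 (measurable_funB m2 m3) e) (sqintE mD (Hint_wderivL2 hi' wm)) lee_fin.
  apply: le_trans (sqint_le_hform wm hi') _; apply: le_trans (fr _ (hd n k)) _.
  by rewrite -mulrA ler_wpM2l.
have lim w : (size w <= m)%N -> exists g, inL2 mu2 D g /\
    forall n, (sqint mu2 D (wderiv D w (v n) \- g)%R <= (C * K * 4^-1 ^+ n)%:E)%E.
  move=> wm; have [g hg lg] := L2_complete mD CK (fun n => Hint_wderivL2 (hi n) wm)
    (fun n k => wcauchy w n k wm).
  by exists g.
(* The default for long words makes g a function of all words. *)
have /choice[g hg] w : exists g, (size w <= m)%N -> inL2 mu2 D g /\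
    forall n, (sqint mu2 D (wderiv D w (v n) \- g)%R <= (C * K * 4^-1 ^+ n)%:E)%E.
  case: (leqP (size w) m) => [/lim[g hg]|_]; first by exists g.
  by exists (fun=> 0).
pose z := g [::]; have [hz lz] := hg [::] isT.
have small e : 0 < e -> exists n, C * K * 4^-1 ^+ n <= e.
  move=> e0; have : (fun n => C * K * 4^-1 ^+ n : R) @ \oo --> (C * K * 0 : R).
    apply: cvgM; first exact: cvg_cst.
    by apply: cvg_expr; rewrite ger0_norm ?invr_ge0// invf_lt1// ltr1n.
  rewrite mulr0 => /cvgrPdist_le /(_ e e0) [n _ /(_ n (leqnn n))].
  rewrite /= sub0r normrN ger0_norm ?mulr_ge0// => le; by exists n.
have wz w : (size w <= m)%N -> is_wderiv D w z (g w).
  move=> wm; have [hgw lgw] := hg w wm; apply: (is_wderiv_closed oD Dh) => // e e0.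
  have [n le] := small e e0.
  exists (wderiv D [::] (v n)), (wderiv D w (v n)).
  have h0n := Hint_wderivL2 (w := [::]) (hi n) isT.
  split => //.
  - apply: (is_wderiv_ae oD Dh (Hint_L2 (hi n)) h0n _ (Hint_wderiv (hi n) wm)).
    apply: ae_eq_sym; apply: (wderiv_ae oD Dh); exact: is_wderiv_nil (Hint_L2 (hi n)).
  - by apply: le_trans (lz n) _; rewrite lee_fin.
  - by apply: le_trans (lgw n) _; rewrite lee_fin.
have iz : Hint D m z by split => // w wm; exists (g w); exact: wz.
have diff n w : (size w <= m)%N ->
    ip mu2 D (wderiv D w (v n \- z)%R) (wderiv D w (v n \- z)%R) <= C * K * 4^-1 ^+ n.
  move=> wm; have hi' : Hint D m (v n \- z)%R by rewrite combB; exact: (Hint_linear oD Dh).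
  have [hgw lgw] := hg w wm; have [mg _] := hgw.
  have [m1 _] := Hint_wderivL2 hi' wm; have [m2 _] := Hint_wderivL2 (hi n) wm.
  have e : ae_eq mu2 D (wderiv D w (v n \- z)%R) (wderiv D w (v n) \- g w)%R.
    rewrite !combB; apply: (wderiv_ae oD Dh); apply: (is_wderiv_comb oD Dh) => //.
    + exact: Hint_L2 (hi n).
    + exact: Hint_wderiv (hi n) wm.
    + exact: wz.
  rewrite -lee_fin -(sqintE mD (Hint_wderivL2 hi' wm)).
  by rewrite (sqint_ae mD m1 (measurable_funB m2 mg) e); exact: lgw.
pose W : R := \sum_(j < m.+1) \sum_(b : j.-tuple bool) 1.
have W0 : 0 <= W by apply: sumr_ge0 => j _; exact: sumr_ge0.
have hdiff n : hform D m%:R (v n \- z)%R (v n \- z)%R <= W * (C * K * 4^-1 ^+ n).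
  rewrite hform_nat; apply: (@ip_word_le m (fun b => ip mu2 D (wderiv D b (v n \- z)%R) (wderiv D b (v n \- z)%R))).
  by move=> b bm; exact: diff.
exists z; last first.
  exists (W * (C * K)) => n; rewrite -mulrA; apply: le_trans (hdiff n).
  have hi' : Hint D m (v n \- z)%R by rewrite combB; exact: (Hint_linear oD Dh).
  rewrite hform_nat big_ord_recr/= -[leLHS]add0r lerD//.
  by apply: sumr_ge0 => j _; apply: sumr_ge0 => b _; exact: ip_ge0.
apply/H0P; split; first exact/(Hint_Hs oD).
move=> e e0; have e1 : 0 < e / (4 * (W + 1)) by rewrite divr_gt0// mulr_gt0//; lra.
have [n le] := small _ e1; have /H0P[_ app] := hv n.
have e2 : 0 < e / 4 by rewrite divr_gt0.
have [phi tp hp] := app _ e2; exists phi => //.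
have sp : Hs D m%:R phi by apply: Hs_smooth; exact: test_smooth tp.
have L := Hs_linear oD Dh (s := m%:R).
apply: le_trans (form_sub_le L (hform_psd oD Dh m%:R) (g := v n) _ _ sp) _.
- exact/(Hint_Hs oD).
- exact/(Hint_Hs oD).
have -> : hform D m%:R (z \- v n)%R (z \- v n)%R = hform D m%:R (v n \- z)%R (v n \- z)%R.
  have H1 : Hs D m%:R (v n \- z)%R by rewrite combB; apply: L; apply/(Hint_Hs oD).
  have -> : (z \- v n)%R = comb (-1) (v n \- z)%R 0 (v n \- z)%R.
    by apply/funext => x; rewrite /comb/=; ring.
  by rewrite (form_quad L (hform_psd oD Dh m%:R))// expr0n/= mulr0 mul0r; ring.
have h3 : W * (C * K * 4^-1 ^+ n) <= e / 4.
  apply: le_trans (ler_wpM2l W0 le) _.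
  have -> : W * (e / (4 * (W + 1))) = e / 4 * (W / (W + 1)) by field; lra.
  by rewrite ler_piMr ?(ltW e2)// ler_pdivrMr; lra.
have h4 := le_trans (hdiff n) h3; move: h4 hp; clear.
by move: (hform _ _ _ _) (hform _ _ _ _) => x y; lra.
Qed.

(** For m <= s < m + 1 the seminorm of the derivatives of order m is bounded
    by those of order m + 1. This embedding makes functionals on H^s_0 act on
    H^(m+1)_0. *)
Lemma H0_sub_bound m (s : R) : m.+1%:R - 1 <= s <= m.+1%:R -> exists2 C : R, 0 <= C &
  forall v, H0 D m.+1%:R v -> Hs D s v /\ hform D s v v <= C * hform D m.+1%:R v v.
Proof.
move=> /andP[s1 s2]; have [->|sm] := eqVneq s m.+1%:R.
  by exists 1 => // v hv; rewrite mul1r; split => //; exact: H0_Hs.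
have sm1 : s < m.+1%:R by rewrite lt_neqAle sm.
have ms : m%:R <= s by move: s1; rewrite -natr1 addrK.
have ks : Num.truncn s = m.
  by apply/eqP; rewrite truncn_eq ?ms//; apply: le_trans ms.
set theta := s - m%:R; have th0 : 0 <= theta by rewrite subr_ge0.
have th1 : theta < 1 by rewrite ltrBlDr -natr1 addrC in sm1 *.
have hth : 0 <= theta < 1 by rewrite th0.
pose c := 2 * slob_const theta (2 * h); have c0 : 0 <= c by apply: mulr_ge0 => //; exact: sqr_ge0.
pose W : R := \sum_(b : m.-tuple bool) 1.
have W0 : 0 <= W by exact: sumr_ge0.
exists (1 + W * (c * 2)).
  by apply: addr_ge0 => //; apply: mulr_ge0 => //; exact: mulr_ge0.
move=> v hv; have hi := H0_Hint hv; have hi' : Hint D m v by exact: Hint_le hi.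
set M := hform D m.+1%:R v v.
have sl (b : m.-tuple bool) : (slobodeckii_sq D theta (wderiv D b v) <= (c * 2 * M)%:E)%E.
  have bm : (size b < m.+1)%N by rewrite size_tuple.
  have r l : (size (rcons b l) <= m.+1)%N by rewrite size_rcons size_tuple.
  apply: le_trans (H0_slobodeckii hv bm hth) _.
  rewrite !(sqintE mD (Hint_wderivL2 hi (r _))) -EFinD -EFinM lee_fin -mulrA ler_wpM2l//.
  have := sqint_le_hform (r false) hi; have := sqint_le_hform (r true) hi; rewrite -/M; lra.
have hs : Hspace D m theta v.
  by split => // _ b; apply: le_lt_trans (sl b) _; rewrite ltry.
split; first by apply/(HsP oD); rewrite ks.
rewrite /hform ks -/theta /hform_of mulrDl mul1r; apply: lerD.
  rewrite /M hform_nat [leRHS]big_ord_recr/= lerDl.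
  by apply: sumr_ge0 => b _; exact: ip_ge0.
have [t0|t0] := boolP (0 < theta); last first.
  rewrite big_pred0//.
  have M0 : 0 <= M by exact: (form_ge0 (hform_psd oD Dh m.+1%:R) (H0_Hs hv)).
  by apply: mulr_ge0 => //; apply: mulr_ge0 => //; exact: mulr_ge0.
rewrite (eq_bigl xpredT)//= /W !mulr_suml; apply: ler_sum => b _; rewrite mul1r.
have mDD : measurable (D `*` D) by exact: measurableX.
rewrite -lee_fin -(sqintE mDD (Hspace_quotient oD b t0 hs)) -slobodeckii_sqint//.
by have [] := @Hint_wderivL2 _ D m v b hi'; rewrite ?size_tuple.
Qed.

Lemma H0_sub m (s : R) v : m.+1%:R - 1 <= s <= m.+1%:R -> H0 D m.+1%:R v -> H0 D s v.
Proof.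
move=> hs hv; have [C C0 hC] := H0_sub_bound hs.
have [Hv _] := hC v hv; apply/H0P; split => // e e0.
have /H0P[_ app] := hv.
have C1 : 0 < C + 1 by lra.
have [phi tp hp] := app _ (divr_gt0 e0 C1); exists phi => //.
have hd : H0 D m.+1%:R (v \- phi)%R.
  exact: (H0B hv (H0_smooth _ tp)).
have [_ le] := hC _ hd; apply: le_trans le _; apply: le_trans (ler_wpM2l C0 hp) _.
by rewrite mulrA ler_pdivrMr// mulrC ler_wpM2l ?(ltW e0)//; lra.
Qed.

(** The dual norm only tests the unit ball: scale v into it. If the norm of v
    vanishes, all multiples of v lie in the ball, which forces G v = 0. *)
Lemma dual_bound (s : R) G : Hdual D s G -> exists2 M : R, 0 <= M &
  forall v, H0 D s v -> G v ^+ 2 <= M * hform D s v v.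
Proof.
move=> [Gl Gb]; have hB := hform_psd oD Dh s; have hL := Hs_linear oD Dh (s := s).
pose M := `|fine (dualnorm D s G)|; have M0 : 0 <= M by exact: normr_ge0.
have up v : H0 D s v -> hform D s v v <= 1 -> `|G v| <= M.
  move=> hv n1; have : (`|G v|%:E <= dualnorm D s G)%E.
    apply: ereal_sup_ubound; exists v => //; split => //.
    by rewrite (HnormE oD (H0_Hs hv)) lee_fin -sqrtr1; exact: ler_wsqrtr.
  move: Gb; rewrite /M; case: (dualnorm D s G) => [r| |]//= _; rewrite lee_fin.
  by move=> /le_trans; apply; exact: ler_norm.
have scale t v : H0 D s v -> t ^+ 2 * hform D s v v <= 1 -> `|t| * `|G v| <= M.
  move=> hv le; have := up (comb t v 0 v) (H0_linear t 0 hv hv).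
  rewrite (Gl t 0 v v hv hv) mul0r addr0 normrM; apply.
  rewrite (form_quad hL hB)//; try exact: H0_Hs.
  by rewrite expr0n/= mulr0 !mul0r mulr0 mul0r !addr0.
exists (M ^+ 2); first exact: sqr_ge0.
move=> v hv; set n := hform D s v v.
have n0 : 0 <= n by exact: (form_ge0 hB (H0_Hs hv)).
(* The multiple (M + 1) / |G v| of v would violate the bound M on the unit ball. *)
have [nz|nz] := eqVneq n 0.
  have [->|Gv] := eqVneq (G v) 0; first by rewrite expr0n/= mulr_ge0// sqr_ge0.
  have Gp : 0 < `|G v| by rewrite normr_gt0.
  have := scale ((M + 1) / `|G v|) v hv; rewrite -/n nz mulr0 => /(_ ler01).
  rewrite ger0_norm; last by rewrite divr_ge0 ?addr_ge0.
  by rewrite divfK ?gt_eqF//; lra.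
have np : 0 < n by rewrite lt0r nz.
have sp : 0 < Num.sqrt n by rewrite sqrtr_gt0.
have := scale (Num.sqrt n)^-1 v hv; rewrite exprVn sqr_sqrtr// mulVf// => /(_ (lexx _)).
have -> : `|(Num.sqrt n)^-1| = (Num.sqrt n)^-1 by rewrite ger0_norm// invr_ge0 ltW.
rewrite ler_pdivrMl// => le.
rewrite -real_normK ?num_real// -[X in _ * X](sqr_sqrtr n0) -exprMn mulrC.
by rewrite ler_pXn2r// nnegrE// mulr_ge0// ltW.
Qed.

Theorem weak_solution_exists m (s : R) G : m.+1%:R - 1 <= s <= m.+1%:R ->
  Hdual D s G -> exists z, weak_solution D m.+1 G z.
Proof.
move=> hs hG; have [M M0 hM] := dual_bound hG.
have [C C0 hC] := H0_sub_bound hs; have [C' C'0 hC'] := friedrichs m.+1.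
have [Gl _] := hG; have sub v := @H0_sub m s v hs.
have ha : psd_form (H0 D m.+1%:R) (aform D m.+1).
  by apply: sub_psd_form (aform_psd oD Dh m.+1) => v; exact: H0_Hint.
have z0 : H0 D m.+1%:R (fun=> 0).
  apply: H0_smooth; split.
  - by apply: smooth_classP; exact: sc_cst.
  - rewrite (_ : [set x | _] = set0) ?closure0; first exact: compact0.
    by apply/seteqP; split => // x /=; rewrite eqxx.
  - rewrite (_ : [set x | _] = set0) ?closure0//.
    by apply/seteqP; split => // x /=; rewrite eqxx.
have Ml : 0 <= M * (C * C') by rewrite mulr_ge0// mulr_ge0.
have [z hz ez] := riesz_representation (@H0_linear m.+1%:R) ha z0
  (fun v K K0 hv cv => H0_complete K0 hv cv)
  (fun b c f g hf hg => Gl b c f g (sub f hf) (sub g hg))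
  (M := M * (C * C'))
  (fun v hv => ltac:(by apply: (le_trans (hM v (sub v hv))); rewrite -mulrA ler_wpM2l//;
     have [_ le] := hC v hv; apply: (le_trans le); rewrite -mulrA ler_wpM2l//; exact: hC'))
  Ml.
by exists z; split.
Qed.

End zero_boundary.

(** * Triangulated Lipschitz domains *)
Section geometry.
Context {R : realType}.
Local Notation plane := (plane R).
Local Notation mu2 := (mu2 R).

Lemma bounded_square (Om : set plane) : bounded_set Om ->
  exists2 h : R, 0 < h & Om `<=` square h.
Proof.
move=> [M [_ hM]]; exists (`|M| + 1); first by rewrite ltr_wpDl.
move=> x Ox; apply/squareP.
have : `|x| <= `|M| + 1 by apply: (hM (`|M| + 1)) => //; rewrite (le_lt_trans (ler_norm _))// ltrDl.
by rewrite prod_normE /= ge_max => /andP[].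
Qed.

Lemma interiorP2 (A : set plane) x : interior A x <->
  exists2 e : R, 0 < e & forall y : plane, `|y.1 - x.1| < e -> `|y.2 - x.2| < e -> A y.
Proof.
split.
  move=> Ax; have /open_planeP := @open_interior _ A.
  by move=> /(_ x Ax)[e e0 he]; exists e => // y y1 y2; apply: interior_subset; exact: he.
move=> [e e0 he]; pose U : set plane := [set y | `|y.1 - x.1| < e /\ `|y.2 - x.2| < e].
have oU : open U.
  apply/open_planeP => y [y1 y2].
  exists (Num.min (e - `|y.1 - x.1|) (e - `|y.2 - x.2|)).
    by rewrite lt_min !subr_gt0 y1 y2.
  move=> z; rewrite !lt_min => /andP[z1 _] /andP[_ z2]; split.
    by have := ler_distD (y.1 : R) z.1 x.1; lra.
  by have := ler_distD (y.2 : R) z.2 x.2; lra.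
have UA : U `<=` A by move=> y [y1 y2]; exact: he.
apply: (interiorS UA); rewrite ((interior_id _).1 oU).
by split; rewrite subrr normr0.
Qed.

Lemma closureP2 (A : set plane) x : closure A x -> forall e : R, 0 < e ->
  exists2 y, A y & `|y.1 - x.1| < e /\ `|y.2 - x.2| < e.
Proof.
move=> Ax e e0.
have : nbhs x [set y : plane | `|y.1 - x.1| < e /\ `|y.2 - x.2| < e].
  by apply/(interiorP2 _ x); exists e.
by move=> /Ax[y [Ay hy]]; exists y.
Qed.

Lemma eucl_dist_max (x y : plane) (e : R) : 0 <= e -> `|y.1 - x.1| <= e -> `|y.2 - x.2| <= e ->
  eucl_dist x y <= 2 * e.
Proof.
move=> e0 h1 h2; rewrite /eucl_dist -[leRHS]ger0_norm ?mulr_ge0// -sqrtr_sqr.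
rewrite ler_wsqrtr// -(opprB (y.1 : R)) -(opprB (y.2 : R)) !sqrrN.
rewrite -(real_normK (num_real (y.1 - x.1 : R))) -(real_normK (num_real (y.2 - x.2 : R))).
have n1 : 0 <= `|y.1 - x.1 : R| by []. have n2 : 0 <= `|y.2 - x.2 : R| by [].
move: h1 h2 n1 n2; move: (`|_|) (`|_|) => a b; nra.
Qed.

Lemma eucl_dist_ge (x y : plane) : `|x.1 - y.1| <= eucl_dist x y /\ `|x.2 - y.2| <= eucl_dist x y.
Proof.
by rewrite /eucl_dist -!sqrtr_sqr; split; rewrite ler_wsqrtr// (lerDl, lerDr) sqr_ge0.
Qed.

(** Near a boundary point x a Lipschitz domain lies above a graph. If the
    closure contained a neighbourhood of x, there would be points of the domain
    close to a point below x, and those lie below the graph. *)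
Lemma lipschitz_interior_closure (Om : set plane) : open Om -> lipschitz_boundary Om ->
  interior (closure Om) `<=` Om.
Proof.
move=> oOm lip x ix; apply: contrapT => nOx.
have bx : boundary Om x.
  by split; [exact: (interior_subset ix) | rewrite ((interior_id _).1 oOm)].
have [c [d [r [L [phi [cd r0 hphi hgraph]]]]]] := lip x bx.
have hL (a b : R) : `|phi a - phi b| <= L * `|a - b| by exact: (hphi (a, b) (conj I I)).
have L0 : 0 <= L by have := hL 1 0; rewrite subr0 normr1 mulr1; exact: le_trans.
have x0 : eucl_dist x x < r by rewrite /eucl_dist !subrr expr0n addr0 sqrtr0.
have below : c * x.2 - d * x.1 <= phi (c * x.1 + d * x.2).
  by rewrite leNgt; apply/negP => /(hgraph x x0).
have /interiorP2[e e0 he] := ix.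
have c2 := sqr_ge0 c; have d2 := sqr_ge0 d.
have c1 : `|c| <= 1 by rewrite ler_norml; apply/andP; split; nra.
have d1 : `|d| <= 1 by rewrite ler_norml; apply/andP; split; nra.
pose t := Num.min (e / 2) (r / 8).
have t0 : 0 < t by rewrite lt_min !divr_gt0.
have te : t < e by rewrite gt_min; apply/orP; left; lra.
have tr : t <= r / 8 by rewrite ge_min lexx orbT.
(* Down from x by t in the rotated coordinates, still in the interior of the
   closure. *)
pose y : plane := (x.1 + t * d, x.2 - t * c).
have cy : closure Om y.
  by apply: he => /=; rewrite addrC addKr ?normrN normrM (gtr0_norm t0);
    apply: le_lt_trans te; rewrite ler_piMr// ltW.
have L1 : 0 < 4 * (L + 1) by lra.
(* Within q of y, neither the height nor the graph changes by enough to
   compensate the descent t. *)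
pose q := Num.min (r / 8) (t / (4 * (L + 1))).
have q0 : 0 < q by rewrite lt_min !divr_gt0.
have [z Oz [z1 z2]] := closureP2 cy q0.
have qr : q <= r / 8 by rewrite ge_min lexx.
have qt : q * (4 * (L + 1)) <= t by rewrite -ler_pdivlMr// ge_min lexx orbT.
have yx1 : (y.1 : R) - x.1 = t * d by rewrite /y/=; ring.
have yx2 : (y.2 : R) - x.2 = - (t * c) by rewrite /y/=; ring.
have zr : eucl_dist x z < r.
  apply: (@le_lt_trans _ _ (2 * (t + q))); last lra.
  apply: eucl_dist_max; first by lra.
    have := ler_distD (y.1 : R) z.1 x.1; rewrite yx1 normrM (gtr0_norm t0).
    have := ler_piMr (ltW t0) d1; lra.
  have := ler_distD (y.2 : R) z.2 x.2; rewrite yx2 normrN normrM (gtr0_norm t0).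
  have := ler_piMr (ltW t0) c1; lra.
have := (hgraph z zr).1 Oz.
have := hL (c * x.1 + d * x.2) (c * z.1 + d * z.2).
have e1 : c * x.1 + d * x.2 - (c * z.1 + d * z.2) = - (c * (z.1 - y.1) + d * (z.2 - y.2)).
  by rewrite /y/=; ring.
have e2 : c * z.2 - d * z.1 = c * x.2 - d * x.1 - t + (c * (z.2 - y.2) - d * (z.1 - y.1)).
  have -> : t = t * (c ^+ 2 + d ^+ 2) by rewrite cd mulr1.
  by rewrite /y/=; ring.
rewrite e1 e2 normrN.
have b1 (a b p1 p2 : R) : `|a| <= 1 -> `|b| <= 1 -> `|p1| < q -> `|p2| < q -> `|a * p1 + b * p2| <= 2 * q.
  move=> a1 b1 h1 h2; apply: le_trans (ler_normD _ _) _; rewrite !normrM mulrDl !mul1r.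
  by apply: lerD; rewrite -[leRHS]mul1r; apply: ler_pM => //; exact: ltW.
have B1 := b1 c d _ _ c1 d1 z1 z2.
have B2 : c * (z.2 - y.2) - d * (z.1 - y.1) <= 2 * q.
  by rewrite -mulNr; apply: le_trans (ler_norm _) _; apply: b1 => //; rewrite normrN.
move=> h1 h2.
have h3 : phi (c * x.1 + d * x.2) - phi (c * z.1 + d * z.2) <= L * (2 * q).
  by apply: le_trans (ler_norm _) _; apply: le_trans h1 _; exact: ler_wpM2l.
have qL : L * (2 * q) + 2 * q <= t / 2 by nra.
move: below h2 B2 h3 qL t0.
move: (c * x.2 - d * x.1) (phi _) (phi _) (c * (z.2 - y.2) - d * (z.1 - y.1)) (L * (2 * q)).
move=> p1 p2 p3 p4 p5; lra.
Qed.

Definition cross (p q x : plane) : R :=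
  (q.1 - p.1) * (x.2 - p.2) - (q.2 - p.2) * (x.1 - p.1).

Section triangle.
Variable T : 'I_3 -> plane.
Hypothesis nT : nondegenerate_tri T.
Let A := T (inord 0%N).
Let B := T (inord 1%N).
Let C := T (inord 2%N).

(** The barycentric coordinates, as quotients of signed areas. *)
Definition bary (k : nat) (x : plane) : R :=
  (if k is 0 then cross B C x else if k is 1 then cross C A x else cross A B x) / cross A B C.

Lemma sum_ord3 (F : 'I_3 -> R) :
  \sum_k F k = F (inord 0%N) + F (inord 1%N) + F (inord 2%N).
Proof.
rewrite !big_ord_recl big_ord0 addr0 addrA; congr (F _ + F _ + F _);
  by apply: ord_inj; rewrite inordK.
Qed.

Let detT : cross A B C != 0 := nT.

Lemma triP x : tri T x <-> [/\ 0 <= bary 0 x, 0 <= bary 1 x & 0 <= bary 2 x].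
Proof.
split.
  move=> [c [c0 _ c1 ->]]; rewrite !sum_ord3 in c1 *.
  have key k : k \in [:: 0; 1; 2]%N -> bary k
      (c (inord 0) * A.1 + c (inord 1) * B.1 + c (inord 2) * C.1,
       c (inord 0) * A.2 + c (inord 1) * B.2 + c (inord 2) * C.2) = c (inord k).
    have e0 : c (inord 0) = 1 - c (inord 1) - c (inord 2) by rewrite -c1; ring.
    have dT := detT; rewrite !inE => /or3P[]/eqP->; rewrite /bary; apply: canLR (mulfK dT) _;
      by rewrite ?e0 /cross/=; ring.
  by split; rewrite (key _ _).
move=> [b0 b1 b2]; exists (fun k : 'I_3 => bary k x); split => //.
- by case=> [[|[|[|//]]] ?].
- by move=> k; case.
- by rewrite sum_ord3 !inordK// /bary; have := detT; rewrite /cross => dT; field.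
- rewrite !sum_ord3 !inordK// -/A -/B -/C [LHS]surjective_pairing; congr pair;
    by rewrite /bary; have := detT; rewrite /cross => dT; field.
Qed.

Lemma bary_affine k x y t :
  bary k (x.1 + t * (y.1 - x.1), x.2 + t * (y.2 - x.2)) = bary k x + t * (bary k y - bary k x).
Proof. by case: k => [|[|k]]; rewrite /bary /cross/=; ring. Qed.

Lemma bary_smooth k : smooth (bary k).
Proof.
have sc p q : smooth (fun x => cross p q x / cross A B C).
  apply: smooth_classP.
  rewrite (_ : (fun _ => _) = (fun x : plane => (q.1 - p.1) / cross A B C * coordinate true x +
     ((- (q.2 - p.2)) / cross A B C * coordinate false x +
      ((q.2 - p.2) * p.1 - (q.1 - p.1) * p.2) / cross A B C))); last first.
    by apply/funext => x; rewrite {1}/cross /coordinate; ring.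
  apply: sc_add; first by apply: sc_mul; [exact: sc_cst | exact: sc_coordinate].
  apply: sc_add; last exact: sc_cst.
  by apply: sc_mul; [exact: sc_cst | exact: sc_coordinate].
by case: k => [|[|k]]; exact: sc.
Qed.

Lemma tri_convex : convex2 (tri T).
Proof.
move=> x y t /triP[x0 x1 x2] /triP[y0 y1 y2] /andP[t0 t1]; apply/triP.
have key (a b : R) : 0 <= a -> 0 <= b -> 0 <= a + t * (b - a) by move=> ? ?; nra.
by rewrite !bary_affine; split; exact: key.
Qed.

Lemma otri_convex : convex2 (otri T).
Proof.
move=> x y t /interiorP2[e e0 he] /interiorP2[d d0 hd] ht; apply/interiorP2.
exists (Num.min e d); first by rewrite lt_min e0.
move=> z; rewrite !lt_min => /andP[z1 z1'] /andP[z2 z2'].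
pose v1 := z.1 - (x.1 + t * (y.1 - x.1)); pose v2 := z.2 - (x.2 + t * (y.2 - x.2)).
have hx : tri T (x.1 + v1, x.2 + v2) by apply: he; rewrite /= addrAC subrr add0r.
have hy : tri T (y.1 + v1, y.2 + v2) by apply: hd; rewrite /= addrAC subrr add0r.
have := tri_convex hx hy ht; rewrite [z]surjective_pairing /=.
by congr (tri T (_, _)); rewrite /v1 /v2; ring.
Qed.

Lemma otri_open : open (otri T).
Proof. exact: open_interior. Qed.

Lemma bary_gt0_otri x : 0 < bary 0 x -> 0 < bary 1 x -> 0 < bary 2 x -> otri T x.
Proof.
move=> b0 b1 b2; pose U k : set plane := bary k @^-1` [set t | 0 < t].
have oU k : open (U k).
  by move/continuousP: (smooth_continuous (bary_smooth k)); apply; exact: open_gt.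
have oI : open (U 0%N `&` U 1%N `&` U 2%N) by do 2! apply: openI => //.
have sub : U 0%N `&` U 1%N `&` U 2%N `<=` tri T.
  by move=> y [[y0 y1] y2]; apply/triP; split; exact: ltW.
by apply: (interiorS sub); rewrite ((interior_id _).1 oI).
Qed.

Lemma cross_null p q : (p.1 != q.1) || (p.2 != q.2) ->
  mu2.-negligible [set x : plane | cross p q x = 0].
Proof.
move=> pq; have h : (- (q.2 - p.2) != 0) || (q.1 - p.1 != 0).
  by rewrite oppr_eq0 !subr_eq0 orbC ![q.1 == _]eq_sym ![q.2 == _]eq_sym.
apply: negligibleS (line_null ((q.1 - p.1) * p.2 - (q.2 - p.2) * p.1) h) => x /=.
by rewrite /cross => e; apply/eqP; rewrite -subr_eq0 -e; apply/eqP; ring.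
Qed.

(** A point of the triangle outside the interior lies on one of three lines. *)
Lemma tri_boundary_null : mu2.-negligible (tri T `\` otri T).
Proof.
have neq p q : (forall x y : R, p = (x, y) -> q = (x, y) -> False) ->
    (p.1 != q.1 :> R) || (p.2 != q.2 :> R).
  move=> h; rewrite -negb_and; apply/negP => /andP[/eqP e1 /eqP e2].
  by apply: (h p.1 p.2); [case: (p) | rewrite e1 e2; case: (q)].
have dT := detT.
have nBC : mu2.-negligible [set x : plane | cross B C x = 0].
  apply: cross_null; apply: neq => x y e1 e2; move/eqP: dT; apply.
  by rewrite /cross e1 e2/=; ring.
have nCA : mu2.-negligible [set x : plane | cross C A x = 0].
  apply: cross_null; apply: neq => x y e1 e2; move/eqP: dT; apply.
  by rewrite /cross e1 e2/=; ring.
have nAB : mu2.-negligible [set x : plane | cross A B x = 0].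
  apply: cross_null; apply: neq => x y e1 e2; move/eqP: dT; apply.
  by rewrite /cross e1 e2/=; ring.
apply: negligibleS (negligibleU (negligibleU nBC nCA) nAB) => x [/triP[b0 b1 b2] nx].
apply: contrapT => /not_orP[/not_orP[/eqP h0 /eqP h1] /eqP h2]; apply: nx.
by apply: bary_gt0_otri; rewrite lt0r ?b0 ?b1 ?b2 andbT /bary mulf_neq0// invr_neq0.
Qed.

End triangle.

Lemma closure_square (Om : set plane) h : Om `<=` square h -> closure Om `<=` square h.
Proof.
move=> sub x cx; apply: contrapT => nx.
have [e e0 he] : exists2 e : R, 0 < e & `|x.1| >= h + e \/ `|x.2| >= h + e.
  have [h1|h1] := leP `|x.1| h; last by exists (`|x.1| - h); [rewrite subr_gt0 | left; lra].
  have [h2|h2] := leP `|x.2| h; last by exists (`|x.2| - h); [rewrite subr_gt0 | right; lra].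
  by exfalso; apply: nx; apply/squareP.
have [y /sub /squareP[y1 y2] [h1 h2]] := closureP2 cx e0.
have k1 := ler_distD (0 : R) (x.1) (y.1 : R); rewrite !subr0 in k1.
have := lerB_dist (x.1 : R) y.1; have := lerB_dist (x.2 : R) y.2.
by rewrite (distrC (x.1 : R)) (distrC (x.2 : R)); case: he => he; lra.
Qed.

Lemma diam_ge (S : set plane) h x y : S `<=` square h -> S x -> S y ->
  eucl_dist x y <= diam S.
Proof.
move=> sub Sx Sy; apply: ub_le_sup; last by exists x, y.
exists (4 * h) => _ [p [q [/sub/squareP[p1 p2] /sub/squareP[q1 q2] ->]]].
have h0 : 0 <= h by apply: le_trans p1.
have -> : 4 * h = 2 * (2 * h) by ring.
apply: eucl_dist_max; first by rewrite mulr_ge0.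
  by apply: le_trans (ler_normB _ _) _; lra.
by apply: le_trans (ler_normB _ _) _; lra.
Qed.

Lemma diam_le (S : set plane) h : 0 <= h -> S `<=` square h -> diam S <= 4 * h.
Proof.
move=> h0 sub; have [[x Sx]|/nonemptyPn S0] := pselect (S !=set0); last first.
  rewrite /diam (_ : [set d | _] = set0) ?sup0 ?mulr_ge0//.
  by apply/seteqP; split => // d [x [y []]]; rewrite S0.
apply: ge_sup; first by exists (eucl_dist x x), x, x.
move=> _ [p [q [/sub/squareP[p1 p2] /sub/squareP[q1 q2] ->]]].
have -> : 4 * h = 2 * (2 * h) by ring.
apply: eucl_dist_max; first by rewrite mulr_ge0.
  by apply: le_trans (ler_normB _ _) _; lra.
by apply: le_trans (ler_normB _ _) _; lra.
Qed.

(** Disjoint parts of D; they may leave out a set of positive measure, as the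
    products K x K do in D x D. *)
Lemma sum_integral_le d (X : measurableType d) (mu : {measure set X -> \bar R})
    (N : nat) (F : 'I_N -> set X) (D : set X) (f : X -> R) :
  (forall i, measurable (F i)) -> measurable D -> (forall i, F i `<=` D) ->
  (forall i j, i != j -> F i `&` F j = set0) -> measurable_fun D f ->
  (\sum_i sqint mu (F i) f <= sqint mu D f)%E.
Proof.
move=> mF mD sub dis mf; pose U := \big[setU/set0]_(i < N) F i.
have UE : U = \bigcup_i F i.
  by rewrite /U -bigcup_seq; apply: eq_bigcupl; split => i //= _; rewrite mem_index_enum.
have UD : U `<=` D by rewrite UE => x [i _]; exact: sub.
have mU : measurable U by exact: bigsetU_measurable.
have tF : trivIset [set` index_enum 'I_N] F.
  by apply/trivIsetP => i j _ _; exact: dis.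
rewrite -(ge0_integral_bigsetU mu mF (index_enum_uniq _) tF); last 2 first.
- by apply: measurable_sq; exact: measurable_funS mf.
- by move=> x _; rewrite lee_fin sqr_ge0.
apply: ge0_subset_integral => //; first exact: measurable_sq.
by move=> x _; rewrite lee_fin sqr_ge0.
Qed.

Lemma ip_partition d (X : measurableType d) (mu : {measure set X -> \bar R})
    (N : nat) (F : 'I_N -> set X) (D : set X) (f g : X -> R) :
  (forall i, measurable (F i)) -> measurable D -> (forall i, F i `<=` D) ->
  (forall i j, i != j -> F i `&` F j = set0) -> mu.-negligible (D `\` \bigcup_i F i) ->
  inL2 mu D f -> inL2 mu D g ->
  ip mu D f g = \sum_i ip mu (F i) f g.
Proof.
move=> mF mD sub dis [Z [mZ Z0 DZ]] hf hg; pose U := \big[setU/set0]_(i < N) F i.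
have UE : U = \bigcup_i F i.
  by rewrite /U -bigcup_seq; apply: eq_bigcupl; split => i //= _; rewrite mem_index_enum.
have UD : U `<=` D by rewrite UE => x [i _]; exact: sub.
have mU : measurable U by exact: bigsetU_measurable.
have tF : trivIset [set` index_enum 'I_N] F.
  by apply/trivIsetP => i j _ _; exact: dis.
have iD := integrable_prod mD hf hg.
have iF i : mu.-integrable (F i) (EFin \o (fun x => f x * g x)).
  exact: integrableS iD.
have iU : mu.-integrable U (EFin \o (fun x => f x * g x)) by exact: integrableS iD.
rewrite /ip /Rintegral (negligible_integral mZ mD iD Z0).
have DUZ : D `\` Z = U `\` Z.
  apply/seteqP; split => x [h1 h2]; split => //; last exact: UD.
  by apply: contrapT => nU; apply: h2; apply: DZ; split; rewrite -?UE.
rewrite DUZ -(negligible_integral mZ mU iU Z0).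
rewrite (integral_bigsetU_EFin mu mF (index_enum_uniq _) tF); last first.
  by case/integrableP: iU.
by rewrite sum_fine// => i _; apply: integrable_fin_num.
Qed.

End geometry.

Arguments otri_open {R} T [t] _.

Section mesh.
Context {R : realType}.
Local Notation plane := (plane R).
Local Notation mu2 := (mu2 R).
Variables (Om : set plane) (N : nat) (T : 'I_N -> 'I_3 -> plane) (h : R).
Hypotheses (oOm : open Om) (lip : lipschitz_boundary Om) (Omh : Om `<=` square h).
Hypothesis hT : triangulation Om T.

Lemma tri_sub_closure i : tri (T i) `<=` closure Om.
Proof. by case: hT => _ -> _ _ x Tx; exists i. Qed.

Lemma otri_sub i : otri (T i) `<=` Om.
Proof.
move=> x Tx; apply: (lipschitz_interior_closure oOm lip).
by apply: interiorS Tx; exact: tri_sub_closure.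
Qed.

Lemma otri_disjoint i j : i != j -> otri (T i) `&` otri (T j) = set0.
Proof. by case: hT => _ _ dis _; exact: dis. Qed.

Lemma tri_square i : tri (T i) `<=` square h.
Proof. by move=> x /tri_sub_closure; exact: closure_square. Qed.

Lemma otri_tri i : otri (T i) `<=` tri (T i).
Proof. exact: interior_subset. Qed.

Lemma otri_square i : otri (T i) `<=` square h.
Proof. by move=> x /otri_tri; exact: tri_square. Qed.

Lemma measurable_otri i : measurable (otri (T i)).
Proof. by apply: open_measurable2; exact: otri_open. Qed.

Lemma diam_bound_otri i : diam_bound (otri (T i)) (diam (tri (T i))).
Proof.
move=> x y /otri_tri Tx /otri_tri Ty.
have [h1 h2] := eucl_dist_ge x y; have := diam_ge (@tri_square i) Tx Ty.
by move=> hd; split; [exact: le_trans h1 hd | exact: le_trans h2 hd].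
Qed.

(** The skeleton is the union of the boundaries of finitely many triangles. *)
Lemma mesh_null : mu2.-negligible (Om `\` \bigcup_i otri (T i)).
Proof.
case: hT => nd cl _ _.
have := @negligible_bigcup _ _ _ mu2 (fun n => if insub n is Some i then tri (T i) `\` otri (T i) else set0).
move=> /(_ _) H; apply: negligibleS (H _).
  move=> x [Ox nx]; have : closure Om x by exact: subset_closure.
  rewrite cl => -[i _ Tx]; exists (val i) => //; rewrite valK; split => // ox.
  by apply: nx; exists i.
move=> n; case: insubP => [i _ _|_]; last exact: negligible_set0.
exact: tri_boundary_null.
Qed.

Lemma ip_mesh f g : inL2 mu2 Om f -> inL2 mu2 Om g ->
  ip mu2 Om f g = \sum_i ip mu2 (otri (T i)) f g.
Proof.
apply: ip_partition.
- exact: measurable_otri.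
- exact: open_measurable2.
- exact: otri_sub.
- exact: otri_disjoint.
- exact: mesh_null.
Qed.

Lemma wderiv_restrict m i v w : Hint Om m v -> (size w <= m)%N ->
  is_wderiv (otri (T i)) w v (wderiv Om w v) /\
  ae_eq mu2 (otri (T i)) (wderiv (otri (T i)) w v) (wderiv Om w v).
Proof.
move=> hv wm; have hw : is_wderiv (otri (T i)) w v (wderiv Om w v).
  by apply: (is_wderiv_sub oOm _ (@otri_sub i) (Hint_wderiv hv wm)); exact: otri_open.
by split => //; apply: (wderiv_ae (otri_open (T i)) (@otri_square i)).
Qed.

Lemma inL2_restrict i f : inL2 mu2 Om f -> inL2 mu2 (otri (T i)) f.
Proof.
move=> [mf lf]; split; first exact: measurable_funS (open_measurable2 oOm) (@otri_sub i) mf.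
apply: le_lt_trans lf; apply: ge0_subset_integral => //.
- exact: measurable_otri.
- exact: open_measurable2.
- exact: measurable_sq.
- by move=> x _; rewrite lee_fin sqr_ge0.
- exact: otri_sub.
Qed.

Lemma Hint_restrict m i v : Hint Om m v -> Hint (otri (T i)) m v.
Proof.
move=> hv; split; first by apply: inL2_restrict; exact: Hint_L2 hv.
by move=> w wm; exists (wderiv Om w v); have [] := wderiv_restrict i hv wm.
Qed.

(** The skeleton is null, and weak derivatives on Om restrict to triangles. *)
Lemma apw_aform m v w : Hint Om m v -> Hint Om m w -> apw T m v w = aform Om m v w.
Proof.
move=> hv hw; rewrite /apw /aform exchange_big/=; apply: eq_bigr => b _.
have bm : (size b <= m)%N by rewrite size_tuple.
rewrite -[RHS]/(ip mu2 Om (wderiv Om b v) (wderiv Om b w)) (ip_mesh (Hint_wderivL2 hv bm) (Hint_wderivL2 hw bm)).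
apply: eq_bigr => i _; apply: ip_ae.
- exact: measurable_otri.
- exact: Hint_wderivL2 (Hint_restrict i hv) bm.
- by apply: inL2_restrict; exact: Hint_wderivL2 hv bm.
- exact: Hint_wderivL2 (Hint_restrict i hw) bm.
- by apply: inL2_restrict; exact: Hint_wderivL2 hw bm.
- by have [] := wderiv_restrict i hv bm.
- by have [] := wderiv_restrict i hw bm.
Qed.

(** For the seminorms, the products K x K are disjoint parts of Om x Om. The
    interaction of different triangles is dropped, whence an inequality. *)
Lemma Hsq_restrict s v : Hs Om s v ->
  (forall i, Hs (otri (T i)) s v) /\
  \sum_i hform (otri (T i)) s v v <= hform Om s v v.
Proof.
set k := Num.truncn s; set theta := s - k%:R.
move=> /(HsP oOm)[hi hsl]; rewrite -/k -/theta in hi hsl.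
have mOm := open_measurable2 oOm.
have wr i (b : seq bool) (bk : (size b <= k)%N) := wderiv_restrict i hi bk.
have mw b : (size b <= k)%N -> measurable_fun Om (wderiv Om b v).
  by move=> bk; case: (Hint_wderivL2 hi bk).
have mwi i b : (size b <= k)%N -> measurable_fun (otri (T i)) (wderiv (otri (T i)) b v).
  by move=> bk; case: (Hint_wderivL2 (Hint_restrict i hi) bk).
have mq i b : (size b <= k)%N -> measurable_fun (otri (T i) `*` otri (T i)) (quotient theta (wderiv Om b v)).
  move=> bk; apply: measurable_quotient; first exact: measurable_otri.
  exact: measurable_funS mOm (@otri_sub i) (mw b bk).
have sle (b : k.-tuple bool) : (\sum_i slobodeckii_sq (otri (T i)) theta (wderiv (otri (T i)) b v) <=
    slobodeckii_sq Om theta (wderiv Om b v))%E.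
  have bk : (size b <= k)%N by rewrite size_tuple.
  rewrite slobodeckii_sqint//; last exact: mw.
  rewrite (eq_bigr (fun i => sqint mu4 (otri (T i) `*` otri (T i)) (quotient theta (wderiv Om b v)))); last first.
    move=> i _; have mi := measurable_otri i.
    rewrite slobodeckii_sqint//; last exact: mwi.
    apply: sqint_ae.
    - exact: measurableX.
    - by apply: measurable_quotient => //; exact: mwi.
    - exact: mq.
    - by apply: quotient_ae; have [] := wr i b bk.
  apply: sum_integral_le.
  - by move=> i; apply: measurableX; exact: measurable_otri.
  - exact: measurableX.
  - by move=> i z [/= /otri_sub h1 /otri_sub h2].
  - move=> i j ij; apply/seteqP; split => // z [[/= h1 _] [h2 _]].
    by have : (otri (T i) `&` otri (T j)) z.1 by []; rewrite otri_disjoint.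
  - by apply: measurable_quotient => //; exact: mw.
have hs i : Hspace (otri (T i)) k theta v.
  split; first exact: Hint_restrict.
  move=> th0 b; apply: le_lt_trans (hsl th0 b); apply: le_trans (sle b).
  rewrite (bigD1 i)//= leeDl// sume_ge0// => j _.
  rewrite slobodeckii_sqint ?sqint_ge0//; first exact: measurable_otri.
  by apply: mwi; rewrite size_tuple.
split=> [i|]; first by apply/(HsP (otri_open _)).
rewrite /hform -/k -/theta /hform_of big_split/=; apply: lerD.
  rewrite exchange_big/=; apply: ler_sum => j _.
  rewrite exchange_big/=; apply: ler_sum => b _.
  have bk : (size b <= k)%N by rewrite size_tuple -ltnS.
  rewrite (ip_mesh (Hint_wderivL2 hi bk) (Hint_wderivL2 hi bk)).
  rewrite le_eqVlt; apply/orP; left; apply/eqP.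
  apply: eq_bigr => i _; apply: ip_ae.
  - exact: measurable_otri.
  - exact: Hint_wderivL2 (Hint_restrict i hi) bk.
  - by apply: inL2_restrict; exact: Hint_wderivL2 hi bk.
  - exact: Hint_wderivL2 (Hint_restrict i hi) bk.
  - by apply: inL2_restrict; exact: Hint_wderivL2 hi bk.
  - by have [] := wr i b bk.
  - by have [] := wr i b bk.
rewrite exchange_big/=; apply: ler_sum => b th0.
have bk : (size b <= k)%N by rewrite size_tuple.
have Hv : Hspace Om k theta v by split.
have mDD : measurable (Om `*` Om) by exact: measurableX.
have mDi i : measurable (otri (T i) `*` otri (T i)) by apply: measurableX; exact: measurable_otri.
rewrite -lee_fin -(sqintE mDD (Hspace_quotient oOm b th0 Hv)) -sumEFin.
rewrite -slobodeckii_sqint//; last exact: mw.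
apply: le_trans (sle b); rewrite le_eqVlt; apply/orP; left; apply/eqP.
apply: eq_bigr => i _; rewrite -(sqintE (mDi i) (Hspace_quotient (otri_open (T i)) b th0 (hs i))).
by rewrite -slobodeckii_sqint//; [exact: measurable_otri | exact: mwi].
Qed.

End mesh.

(** * Scaled inequalities on one triangle *)
Section local.
Context {R : realType}.
Local Notation plane := (plane R).
Local Notation mu2 := (mu2 R).

Definition box (c : plane) (r : R) : set plane :=
  (`[c.1 - r, c.1 + r] `*` `[c.2 - r, c.2 + r])%classic.

Lemma boxP c r (x : plane) : box c r x <-> `|x.1 - c.1| <= r /\ `|x.2 - c.2| <= r.
Proof. by rewrite /box/= !in_itv/= !ler_distl. Qed.

Lemma measurable_box c r : measurable (box c r).
Proof. by apply: measurableX; exact: measurable_itv. Qed.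

Lemma mu2_box c r : 0 <= r -> mu2 (box c r) = ((2 * r) ^+ 2)%:E.
Proof.
move=> r0; have e (a : R) : lebesgue_measure (`[a - r, a + r]%classic : set (measurableTypeR R)) = (2 * r)%:E.
  rewrite lebesgue_measure_itv/= lte_fin; case: ifPn => [_|].
    by rewrite -EFinB; congr EFin; ring.
  by rewrite -leNgt => h; congr EFin; lra.
pose I (a : R) : set (measurableTypeR R) := `[a - r, a + r]%classic.
have -> : mu2 (box c r) = (lebesgue_measure (I c.1) * lebesgue_measure (I c.2))%E.
  by apply: leb2X; exact: measurable_itv.
by rewrite /I !e -EFinM expr2.
Qed.

Lemma mu2_diam (K : set plane) H c : measurable K -> diam_bound K H -> K c -> 0 <= H ->
  (mu2 K <= ((2 * H) ^+ 2)%:E)%E.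
Proof.
move=> mK dK Kc H0; rewrite -(mu2_box c H0); apply: le_measure; rewrite ?inE//.
  exact: measurable_box.
by move=> x Kx; apply/boxP; exact: dK.
Qed.

Definition bump : plane -> R := cutoff (- 2^-1, - 2^-1) (2^-1, 2^-1) 1.

Lemma test_bump : test_function setT bump.
Proof. exact: test_cutoff. Qed.

Lemma bump_derivatives m : exists2 M : R, 0 <= M &
  forall b x, (size b <= m)%N -> `|pderiv b bump x| <= M.
Proof.
have /choice[M hM] b : exists M, 0 <= M /\ forall x, `|pderiv b bump x| <= M.
  by have [M M0 hM] := test_bounded (test_pderiv b test_bump); exists M.
exists (\sum_(j < m.+1) \sum_(b : j.-tuple bool) M b).
  by apply: sumr_ge0 => j _; apply: sumr_ge0 => b _; case: (hM b).
move=> b x bm; have [_ hb] := hM b; apply: le_trans (hb x) _.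
have bm' : (size b < m.+1)%N by [].
rewrite (bigD1 (Ordinal bm'))//= (bigD1 (in_tuple b))//= -addrA lerDl addr_ge0//.
  by apply: sumr_ge0 => c _; case: (hM c).
by apply: sumr_ge0 => j _; apply: sumr_ge0 => c _; case: (hM c).
Qed.

Lemma flat0_ge (t : R) : 4^-1 <= t -> expR (- 4) <= flat 0 t.
Proof.
move=> ht; have t0 : 0 < t by apply: lt_le_trans ht; rewrite invr_gt0.
rewrite /flat t0 expr0 mul1r ler_expR lerN2.
by rewrite -[leRHS]invrK lef_pV2// posrE invr_gt0.
Qed.

Lemma bump_ge (x : plane) : `|x.1| <= 4^-1 -> `|x.2| <= 4^-1 -> expR (- 16) <= bump x.
Proof.
rewrite !ler_norml => /andP[h1 h2] /andP[h3 h4].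
have -> : (- 16 : R) = - 4 + - 4 + (- 4 + - 4) by ring.
rewrite !expRD /bump /cutoff; apply: ler_pM.
- by rewrite mulr_ge0// expR_ge0.
- by rewrite mulr_ge0// expR_ge0.
- by apply: ler_pM; rewrite ?expR_ge0//; apply: flat0_ge => /=; lra.
- by apply: ler_pM; rewrite ?expR_ge0//; apply: flat0_ge => /=; lra.
Qed.

Lemma approximable_strong_gradient (K : set plane) m (w : plane -> R) b : open K -> approximable K m w -> (size b < m)%N ->
  strong_gradient K (wderiv K b w) (wderiv K (rcons b false) w) (wderiv K (rcons b true) w).
Proof.
move=> oK [hw app] bm; have r l : (size (rcons b l) <= m)%N by rewrite size_rcons.
split.
- exact: Hint_wderivL2 hw (ltnW bm).
- exact: Hint_wderivL2 hw (r false).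
- exact: Hint_wderivL2 hw (r true).
move=> e e0; have [f sf hf] := app e e0; exists (pderiv (rev b) f); split.
- exact: smooth_pderiv.
- by apply: hf; exact: ltnW.
- by have := hf _ (r false); rewrite rev_rcons.
- by have := hf _ (r true); rewrite rev_rcons.
Qed.

Section convex_set.
Variables (gam : R) (m : nat).

(** The mean of D^b w against a bump is, up to sign, the mean of w against the
    derivative of the bump, and this loses only powers of 1/H. The bump is the
    dilation of a fixed function to the box of half-width rho, and H is at most
    a multiple of rho: all constants depend on gam and m only. *)
Lemma local_step : 0 < gam -> exists2 C0 : R, 0 <= C0 &
  forall (K : set plane) (h H rho : R) (c : plane) (w : plane -> R) (b : seq bool),
  open K -> K `<=` square h -> convex2 K -> diam_bound K H -> 0 < H ->
  H <= 8 * gam * rho -> box c rho `<=` K -> approximable K m w -> (size b < m)%N ->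
  ip mu2 K (wderiv K b w) (wderiv K b w) <= C0 *
    (H ^+ 2 * (ip mu2 K (wderiv K (rcons b false) w) (wderiv K (rcons b false) w) +
               ip mu2 K (wderiv K (rcons b true) w) (wderiv K (rcons b true) w)) +
     (H^-1) ^+ (2 * size b) * ip mu2 K w w).
Proof.
move=> g0; have [M M0 hM] := bump_derivatives m.
(* c1 H^2 bounds the integral of the bump from below: it is at least exp(-16)
   on a box of area rho^2. The factor q compares (2 rho)^-1 with H^-1, in
   powers up to 2m. *)
pose c1 : R := expR (- 16) / (8 * gam) ^+ 2.
have g8 : 0 < 8 * gam by rewrite mulr_gt0.
have c10 : 0 < c1 by rewrite divr_gt0 ?expR_gt0// exprn_gt0.
pose q := (1 + 4 * gam) ^+ (2 * m); have q0 : 0 <= q by rewrite exprn_ge0// addr_ge0// mulr_ge0// ltW.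
exists (c1^-1 ^+ 2 * (128 + 32 * (M ^+ 2 * q))).
  by apply: mulr_ge0; [exact: sqr_ge0 | rewrite addr_ge0// !mulr_ge0// sqr_ge0].
move=> K h H rho c w b oK Kh cK dK H0 Hrho boxK aw bm.
have mK := open_measurable2 oK; have [hw _] := aw.
have rho0 : 0 < rho by rewrite -(pmulr_rgt0 _ g8); apply: lt_le_trans Hrho.
have r20 : 0 < 2 * rho by rewrite mulr_gt0.
pose psi : plane -> R := bump \o dilate c (2 * rho).
have spsi : smooth psi by exact: smooth_cutoff_dilate.
have Kc : K c by apply: boxK; apply/boxP; rewrite !subrr normr0 ltW.
have out x : ~ box c rho x -> psi x = 0.
  move=> nx; apply: cutoff_outside => // -[]; rewrite /= !in_itv/= /dilate/=.
  rewrite !ler_pdivlMr// !ler_pdivrMr// => /andP[h1 h2] /andP[h3 h4]; apply: nx; apply/boxP.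
  by rewrite !ler_norml; split; apply/andP; split; lra.
have tpsi : test_function K psi.
  have cb : closed (box c rho) by exact: (@closed_rect R (c.1 - rho, c.2 - rho) (c.1 + rho, c.2 + rho)).
  have sub : closure [set x | psi x != 0] `<=` box c rho by exact: closure_support_sub.
  split => //.
  - apply: (subclosed_compact _ (@compact_square R h)); first exact: closed_closure.
    by move=> x /sub /boxK /Kh.
  - by move=> x /sub /boxK.
have psi0 x : 0 <= psi x by exact: cutoff_ge0.
have psi1 x : psi x <= 1 by exact: cutoff_le1.
have hpsi : inL2 mu2 K psi by exact: (inL2_testD oK Kh [::] tpsi).
have hdpsi : inL2 mu2 K (pderiv b psi) by exact: (inL2_testD oK Kh b tpsi).
have muK := mu2_diam mK dK Kc (ltW H0).
have sq_bound (f : plane -> R) (B : R) : inL2 mu2 K f -> 0 <= B -> (forall x, `|f x| <= B) ->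
    ip mu2 K f f <= B ^+ 2 * (2 * H) ^+ 2.
  move=> hf B0 fB; rewrite -lee_fin -(sqintE mK hf).
  apply: (@le_trans _ _ (\int[mu2]_(x in K) (B ^+ 2)%:E)%E).
    apply: ge0_le_integral => //.
    - by move=> x _; rewrite lee_fin sqr_ge0.
    - by apply: measurable_sq; case: hf.
    - by move=> x _; rewrite lee_fin -real_normK ?num_real// lerXn2r ?nnegrE.
  rewrite (_ : (\int[mu2]_(x in K) _)%E = ((B ^+ 2)%:E * mu2 K)%E); last first.
    exact: (@integral_cst _ _ _ mu2 K mK (B ^+ 2)%:E).
  by rewrite [leRHS]EFinM lee_wpmul2l// lee_fin sqr_ge0.
set P := ip mu2 K psi psi.
have hP : P <= 4 * H ^+ 2.
  have := sq_bound psi 1 hpsi ler01; rewrite expr1n mul1r exprMn -natrX; apply.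
  by move=> x; rewrite ger0_norm.
set S := (\int[mu2]_(x in K) psi x)%R.
have hS : c1 * H ^+ 2 <= S.
  have ipsi : mu2.-integrable K (EFin \o psi) by exact: inL2_integrable mK Kh hpsi.
  pose Q := box c (rho / 2).
  have QK : Q `<=` K.
    by move=> x /boxP[x1 x2]; apply: boxK; apply/boxP; split; lra.
  have mQ : measurable Q by exact: measurable_box.
  have leQ : ((expR (- 16) * rho ^+ 2)%:E <= S%:E)%E.
    rewrite /S /Rintegral fineK; last exact: integrable_fin_num.
    apply: (@le_trans _ _ (\int[mu2]_(x in Q) (psi x)%:E)%E); last first.
      apply: ge0_subset_integral => //; first by case/integrableP: ipsi.
      by move=> x _; rewrite lee_fin.
    apply: (@le_trans _ _ (\int[mu2]_(x in Q) (expR (- 16))%:E)%E).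
      rewrite (_ : (\int[mu2]_(x in Q) _)%E = ((expR (- 16))%:E * mu2 Q)%E); last first.
        exact: (@integral_cst _ _ _ mu2 Q mQ (expR (- 16))%:E).
      rewrite mu2_box ?divr_ge0 ?(ltW rho0)// -EFinM lee_fin.
      by rewrite (_ : 2 * (rho / 2) = rho)//; field.
    apply: ge0_le_integral; [exact: mQ | by move=> x _; rewrite lee_fin expR_ge0 |
      exact: measurable_cst | by apply/measurable_EFinP; exact: smooth_measurable |].
    move=> x /boxP[x1 x2]; rewrite lee_fin; apply: bump_ge; rewrite /dilate/= normrM.
      rewrite (ger0_norm (_ : 0 <= (2 * rho)^-1)) ?invr_ge0 ?(ltW r20)// ler_pdivrMr//; lra.
    rewrite (ger0_norm (_ : 0 <= (2 * rho)^-1)) ?invr_ge0 ?(ltW r20)// ler_pdivrMr//; lra.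
  rewrite lee_fin in leQ; apply: le_trans leQ; rewrite /c1 mulrAC -mulrA ler_wpM2l ?expR_ge0//.
  rewrite ler_pdivrMr ?exprn_gt0// -exprMn [rho * _]mulrC lerXn2r ?nnegrE ?(ltW H0)//.
  by rewrite mulr_ge0 ?(ltW g8) ?(ltW rho0).
have hgL := Hint_wderivL2 hw (ltnW bm).
have r l : (size (rcons b l) <= m)%N by rewrite size_rcons.
have sg := approximable_strong_gradient oK aw bm.
have hth : 0 <= (0 : R) < 1 by rewrite lexx ltr01.
have wp := weighted_poincare mK Kh dK hgL hpsi.
have ss := slob_strong mK cK dK H0 hth sg.
set X := ip mu2 K (wderiv K b w) (wderiv K b w).
set Y := ip mu2 K (wderiv K (rcons b false) w) (wderiv K (rcons b false) w) +
         ip mu2 K (wderiv K (rcons b true) w) (wderiv K (rcons b true) w).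
set W := ip mu2 K w w.
have W0 : 0 <= W by exact: ip_ge0.
have X0 : 0 <= X by exact: ip_ge0.
have Y0 : 0 <= Y by rewrite addr_ge0// ip_ge0.
have P0 : 0 <= P by exact: ip_ge0.
have hslob : (slobodeckii_sq K 0 (wderiv K b w) <= (8 * H ^+ 2 * Y)%:E)%E.
  apply: le_trans ss _; rewrite !(sqintE mK (Hint_wderivL2 hw (r _))) -EFinD -EFinM lee_fin.
  rewrite -/Y ler_wpM2r// /slob_const subr0 invr1 mulr1 powRr1 ?(ltW H0)//.
  by rewrite le_eqVlt; apply/orP; left; apply/eqP; ring.
set a := ip mu2 K (wderiv K b w) psi in wp.
have ha : a ^+ 2 <= W * (M ^+ 2 * ((2 * rho)^-1 ^+ (2 * size b)) * (4 * H ^+ 2)).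
  have /is_wderivE[_ /(_ psi tpsi) e] := Hint_wderiv hw (ltnW bm).
  have -> : a ^+ 2 = ip mu2 K w (pderiv b psi) ^+ 2.
    by rewrite e -/a exprMn exprAC sqrrN expr1n expr1n mul1r.
  apply: le_trans (ip_CS mK (Hint_L2 hw) hdpsi) _; rewrite -/W ler_wpM2l//.
  pose B := M * (2 * rho)^-1 ^+ size b.
  have B0 : 0 <= B by rewrite mulr_ge0// exprn_ge0// invr_ge0 ltW.
  have := sq_bound (pderiv b psi) B hdpsi B0; rewrite /B !exprMn -exprM mulnC -natrX; apply.
  move=> x; rewrite /psi pderiv_dilate; last exact: test_smooth test_bump.
  rewrite normrM ger0_norm ?exprn_ge0 ?invr_ge0 ?(ltW r20)// mulrC ler_wpM2r ?exprn_ge0 ?invr_ge0 ?(ltW r20)//.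
  by apply: hM; exact: ltnW.
have hr : (2 * rho)^-1 ^+ (2 * size b) <= q * H^-1 ^+ (2 * size b).
  have i1 : (2 * rho)^-1 <= (1 + 4 * gam) * H^-1.
    rewrite ler_pdivlMr// mulrC ler_pdivrMr//; nra.
  apply: (@le_trans _ _ (((1 + 4 * gam) * H^-1) ^+ (2 * size b))).
    by rewrite lerXn2r ?nnegrE ?invr_ge0 ?(ltW r20)// mulr_ge0 ?invr_ge0 ?(ltW H0)// addr_ge0// mulr_ge0// ltW.
  rewrite exprMn ler_wpM2r ?exprn_ge0 ?invr_ge0 ?(ltW H0)// /q.
  by apply: ler_weXn2l; [rewrite lerDl mulr_ge0// ltW | rewrite leq_mul2l/= ltnW].
set t := H^-1 ^+ (2 * size b) in hr *.
have t0 : 0 <= t by rewrite exprn_ge0// invr_ge0 ltW.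
have main : S ^+ 2 * X <= 4 * H ^+ 2 * P * (8 * H ^+ 2 * Y) + 2 * a ^+ 2 * (2 * H) ^+ 2.
  rewrite -lee_fin EFinM -(sqintE mK hgL); apply: le_trans wp _.
  rewrite EFinD; apply: leeD.
    rewrite [leRHS]EFinM lee_wpmul2l// lee_fin; apply: mulr_ge0 => //.
    by apply: mulr_ge0 => //; exact: sqr_ge0.
  rewrite [leRHS]EFinM lee_wpmul2l// lee_fin; apply: mulr_ge0 => //; exact: sqr_ge0.
pose H2 := H ^+ 2; have H20 : 0 < H2 by rewrite exprn_gt0.
have ha2 : a ^+ 2 <= W * (M ^+ 2 * (q * t) * (4 * H2)).
  apply: le_trans ha _; apply: ler_wpM2l => //; apply: ler_wpM2r.
    by apply: mulr_ge0 => //; exact: ltW.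
  by apply: ler_wpM2l => //; exact: sqr_ge0.
have SX : (c1 * H2) ^+ 2 * X <= S ^+ 2 * X.
  rewrite ler_wpM2r// lerXn2r ?nnegrE//; first by rewrite mulr_ge0// ltW.
  by apply: le_trans hS; rewrite mulr_ge0// ltW.
have c2 : 0 < (c1 * H2) ^+ 2 by rewrite exprn_gt0// mulr_gt0.
have -> : X = ((c1 * H2) ^+ 2)^-1 * ((c1 * H2) ^+ 2 * X) by rewrite mulKf// gt_eqF.
apply: (@le_trans _ _ (((c1 * H2) ^+ 2)^-1 * (4 * H2 * (4 * H2) * (8 * H2 * Y) +
   2 * (W * (M ^+ 2 * (q * t) * (4 * H2))) * (4 * H2)))).
  rewrite ler_wpM2l ?invr_ge0 ?(ltW c2)//; apply: le_trans SX _; apply: le_trans main _.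
  have e2 : (2 * H) ^+ 2 = 4 * H2 by rewrite /H2; ring.
  rewrite e2; apply: lerD.
    apply: ler_wpM2r; first by do 2! (apply: mulr_ge0 => //); exact: ltW.
    by apply: ler_wpM2l => //; apply: mulr_ge0 => //; exact: ltW.
  apply: ler_wpM2r; first by apply: mulr_ge0 => //; exact: ltW.
  exact: ler_wpM2l.
have -> : ((c1 * H2) ^+ 2)^-1 * (4 * H2 * (4 * H2) * (8 * H2 * Y) +
   2 * (W * (M ^+ 2 * (q * t) * (4 * H2))) * (4 * H2)) =
   c1^-1 ^+ 2 * (128 * (H2 * Y) + 32 * (M ^+ 2 * q) * (t * W)).
  by field; rewrite !gt_eqF.
rewrite -[leRHS]mulrA; apply: ler_wpM2l; first exact: sqr_ge0.
rewrite -/H2.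
have Mq : 0 <= 32 * (M ^+ 2 * q) by rewrite mulr_ge0// mulr_ge0// sqr_ge0.
have z1 : 0 <= H2 * Y by rewrite mulr_ge0// ltW.
have z2 : 0 <= t * W by rewrite mulr_ge0.
move: Mq z1 z2; move: (32 * (M ^+ 2 * q)) (H2 * Y) (t * W) => x y z; nra.
Qed.

(** Iterate from the derivatives of order m down to those of order |b|. *)
Theorem local_estimate : 0 < gam -> exists2 C : R, 0 <= C &
  forall (K : set plane) (h H rho : R) (c : plane) (w : plane -> R) (b : seq bool),
  open K -> K `<=` square h -> convex2 K -> diam_bound K H -> 0 < H ->
  H <= 8 * gam * rho -> box c rho `<=` K -> approximable K m w -> (size b <= m)%N ->
  H ^+ (2 * size b) * ip mu2 K (wderiv K b w) (wderiv K b w) <=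
    C * (ip mu2 K w w + H ^+ (2 * m) * aform K m w w).
Proof.
move=> g0; have [C0 C00 hC0] := local_step g0.
exists ((1 + 3 * C0) ^+ m); first by rewrite exprn_ge0// addr_ge0// mulr_ge0.
move=> K h H rho c w b oK Kh cK dK H0 Hrho boxK aw bm.
have mK := open_measurable2 oK; have [hw _] := aw.
set E := ip mu2 K w w + _.
have A0 : 0 <= aform K m w w by exact: (form_ge0 (aform_psd oK Kh m) hw).
have W0 : 0 <= ip mu2 K w w by exact: ip_ge0.
have E0 : 0 <= E by rewrite addr_ge0// mulr_ge0// exprn_ge0// ltW.
have D1 : 1 <= 1 + 3 * C0 by rewrite lerDl mulr_ge0.
have key j b' : (size b' + j = m)%N ->
    H ^+ (2 * size b') * ip mu2 K (wderiv K b' w) (wderiv K b' w) <= (1 + 3 * C0) ^+ j * E.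
  elim: j b' => [|j IH] b' bj.
    have bm' : size b' == m by rewrite -bj addn0.
    rewrite expr0 mul1r (eqP bm'); apply: (@le_trans _ _ (H ^+ (2 * m) * aform K m w w)).
      rewrite ler_wpM2l ?exprn_ge0 ?(ltW H0)//.
      rewrite /aform (bigD1 (Tuple bm'))//= lerDl.
      by apply: sumr_ge0 => d _; exact: ip_ge0.
    by rewrite /E lerDr.
  have bm' : (size b' < m)%N by rewrite -bj addnS ltnS leq_addr.
  have s l : (size (rcons b' l) + j = m)%N by rewrite size_rcons addSnnS.
  have h0 := IH _ (s false); have h1 := IH _ (s true).
  rewrite !size_rcons in h0 h1.
  have st := hC0 K h H rho c w b' oK Kh cK dK H0 Hrho boxK aw bm'.
  have Hp : 0 <= H ^+ (2 * size b') by rewrite exprn_ge0// ltW.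
  apply: le_trans (ler_wpM2l Hp st) _.
  set X0 := ip _ _ (wderiv K (rcons b' false) w) _ in h0 *.
  set X1 := ip _ _ (wderiv K (rcons b' true) w) _ in h1 *.
  have e1 : H ^+ (2 * (size b').+1) = H ^+ (2 * size b') * H ^+ 2 by rewrite mulnS addnC exprD.
  have e2 : H ^+ (2 * size b') * H^-1 ^+ (2 * size b') = 1.
    by rewrite -exprMn divff ?expr1n// gt_eqF.
  rewrite e1 in h0 h1.
  have -> : H ^+ (2 * size b') * (C0 * (H ^+ 2 * (X0 + X1) + H^-1 ^+ (2 * size b') * ip mu2 K w w)) =
     C0 * (H ^+ (2 * size b') * H ^+ 2 * X0 + H ^+ (2 * size b') * H ^+ 2 * X1 +
       (H ^+ (2 * size b') * H^-1 ^+ (2 * size b')) * ip mu2 K w w) by ring.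
  rewrite e2 mul1r [(1 + 3 * C0) ^+ j.+1]exprS.
  have D0 : 1 <= (1 + 3 * C0) ^+ j by exact: exprn_ege1.
  have WE : ip mu2 K w w <= E by rewrite /E lerDl mulr_ge0// exprn_ge0// ltW.
  apply: (@le_trans _ _ (C0 * ((1 + 3 * C0) ^+ j * E + (1 + 3 * C0) ^+ j * E + E))).
    by rewrite ler_wpM2l// lerD// lerD.
  have : E <= (1 + 3 * C0) ^+ j * E by rewrite ler_peMl.
  rewrite -mulrA; move: ((1 + 3 * C0) ^+ j * E) => Z hZ.
  have h2 : C0 * E <= C0 * Z by rewrite ler_wpM2l.
  have := le_trans E0 hZ; lra.
have := key (m - size b)%N b; rewrite subnKC// => /(_ erefl) /le_trans; apply.
by rewrite ler_wpM2r//; apply: ler_weXn2l => //; exact: leq_subr.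
Qed.

End convex_set.
End local.

(** * The H^s norm on shape-regular meshes *)

Section broken.
Context {R : realType}.
Local Notation plane := (plane R).
Local Notation mu2 := (mu2 R).

Lemma smooth_sum (I : Type) (r : seq I) (P : pred I) (F : I -> plane -> R) :
  (forall i, smooth (F i)) -> smooth (fun x => \sum_(i <- r | P i) F i x).
Proof.
move=> sF; elim: r => [|i r IH].
  rewrite (_ : (fun _ => _) = (fun=> 0)); first by apply: smooth_classP; exact: sc_cst.
  by apply/funext => x; rewrite big_nil.
rewrite (_ : (fun _ => _) = (fun x => (if P i then F i x else 0) + \sum_(i <- r | P i) F i x)).
  apply: smooth_classP; apply: sc_add; last exact: sc_smooth.
  by case: (P i); [exact: sc_smooth | exact: sc_cst].
by apply/funext => x; rewrite big_cons; case: (P i); rewrite ?add0r.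
Qed.

Lemma smooth_coordX b n : smooth (fun x : plane => coordinate b x ^+ n).
Proof.
apply: smooth_classP; elim: n => [|n IH].
  rewrite (_ : (fun _ => _) = (fun=> 1)); first exact: sc_cst.
  by apply/funext => x; rewrite expr0.
rewrite (_ : (fun _ => _) = (fun x => coordinate b x * coordinate b x ^+ n)).
  by apply: sc_mul => //; exact: sc_coordinate.
by apply/funext => x; rewrite exprS.
Qed.

Lemma smooth_poly k (c : nat -> nat -> R) : smooth (fun x : plane =>
  \sum_(p < k.+1) \sum_(q < k.+1 | (p + q <= k)%N) c p q * x.1 ^+ p * x.2 ^+ q).
Proof.
apply: smooth_sum => p; apply: smooth_sum => q; apply: smoothM; last exact: (smooth_coordX true).
apply: smoothM; last exact: (smooth_coordX false).
by apply: smooth_classP; exact: sc_cst.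
Qed.

Lemma approximable_sub (K : set plane) h m v u p : open K -> K `<=` square h ->
  approximable K m v -> smooth p -> measurable_fun K u -> ae_eq mu2 K u p ->
  approximable K m (v \- u)%R.
Proof.
move=> oK Kh [hv app] sp mu up; have mK := open_measurable2 oK.
have hp := inL2_smooth mK Kh sp.
have hu : inL2 mu2 K u by apply: (inL2_ae mK mu _ hp); exact: ae_eq_sym.
have Hp : Hint K m p by exact: (Hint_smooth oK Kh m sp).
have Hvp : Hint K m (v \- p)%R by rewrite combB; exact: (Hint_linear oK Kh).
have L1 : inL2 mu2 K (v \- u)%R by exact: (inL2B mK (Hint_L2 hv) hu).
have ae1 : ae_eq mu2 K (v \- p)%R (v \- u)%R.
  by apply: ae_eq_sub; [exact: ae_eq_refl | exact: ae_eq_sym].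
split; first exact: (Hint_ae oK Kh L1 ae1 Hvp).
move=> e e0; have [f sf hf] := app e e0; exists (f \- p)%R.
  by rewrite combB; exact: smooth_comb.
move=> b bm; have sb g : smooth g -> measurable_fun K (pderiv (rev b) g).
  by move=> sg; apply: smooth_measurable; exact: smooth_pderiv.
rewrite -(wderiv_ae_eq oK Kh b (Hint_L2 Hvp) L1 ae1).
have e1 : ae_eq mu2 K (wderiv K b (v \- p)%R) (wderiv K b v \- pderiv (rev b) p)%R.
  apply: (wderiv_ae oK Kh); rewrite !combB; apply: (is_wderiv_comb oK Kh).
  + exact: Hint_L2 hv.
  + exact: hp.
  + exact: Hint_wderiv hv bm.
  + exact: (is_wderiv_smooth oK Kh).
have [m1 _] := Hint_wderivL2 Hvp bm; have [m2 _] := Hint_wderivL2 hv bm.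
have e2 : pderiv (rev b) (f \- p)%R = (pderiv (rev b) f \- pderiv (rev b) p)%R.
  by rewrite !combB pderiv_comb.
apply: le_trans (hf b bm); rewrite le_eqVlt; apply/orP; left; apply/eqP.
apply: (sqint_ae mK).
- apply: measurable_funB => //; rewrite e2; apply: measurable_funB; exact: sb.
- apply: measurable_funB => //; exact: sb.
apply: filterS e1 => x hx Kx /=; rewrite hx// e2 /=; ring.
Qed.

(** Derivatives of order j < s come with a higher power of H than needed. It is
    split into the power m - s and one which is bounded on a bounded domain. *)
Lemma diam_power (s d H : R) (m j : nat) : 0 < H -> H <= d -> 1 <= d ->
  j%:R <= s -> s <= m%:R ->
  H ^+ (2 * m) <= d ^+ (2 * m) * (H `^ (m%:R - s)) ^+ 2 * H ^+ (2 * j).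
Proof.
move=> H0 Hd d1 js sm; have d0 : 0 < d by apply: lt_le_trans d1.
have -> : H ^+ (2 * m) = (H `^ (m%:R - s)) ^+ 2 * (H `^ (s - j%:R)) ^+ 2 * H ^+ (2 * j).
  rewrite -exprMn -powRD; last by rewrite (gt_eqF H0) implybT.
  rewrite [(2 * j)%N]mulnC [(2 * m)%N]mulnC !exprM -exprMn; congr (_ ^+ 2).
  rewrite -!powR_mulrn ?(ltW H0)// -powRD; last by rewrite (gt_eqF H0) implybT.
  by congr (_ `^ _); ring.
rewrite [d ^+ _ * _]mulrC ler_wpM2r ?exprn_ge0 ?(ltW H0)// ler_wpM2l ?sqr_ge0//.
rewrite mulnC exprM lerXn2r ?nnegrE ?powR_ge0 ?exprn_ge0 ?(ltW d0)//.
rewrite -powR_mulrn ?(ltW d0)//.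
apply: (@le_trans _ _ (d `^ (s - j%:R))).
  by apply: ge0_ler_powR; rewrite ?nnegrE ?subr_ge0 ?(ltW H0) ?(ltW d0).
by apply: ler_powR => //; rewrite lerBlDr; apply: le_trans sm _; rewrite lerDl.
Qed.

(** Derivatives of order at most k are bounded by the intermediate estimate.
    If s has a fractional part then k + 1 is the highest order, and the
    seminorm of the derivatives of order k is bounded by the energy with the
    right power of H, because 1 - theta = m + 1 - s. *)
Theorem local_Hs_estimate (s gam h : R) (m : nat) : 0 < gam -> 0 < h ->
  m.+1%:R - 1 <= s <= m.+1%:R -> exists2 C : R, 0 <= C &
  forall (K : set plane) (H rho : R) (c : plane) (w : plane -> R),
  open K -> K `<=` square h -> convex2 K -> diam_bound K H -> 0 < H -> H <= 4 * h ->
  H <= 8 * gam * rho -> box c rho `<=` K -> approximable K m.+1 w ->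
  Hs K s w /\ hform K s w w <= C * (H `^ (m.+1%:R - s)) ^+ 2 *
    (H^-1 ^+ (2 * m.+1) * ip mu2 K w w + aform K m.+1 w w).
Proof.
move=> g0 h0 /andP[s1 s2]; have [C1 C10 hC1] := @local_estimate R gam m.+1 g0.
have ms : m%:R <= s by move: s1; rewrite -natr1 addrK.
have s0 : 0 <= s by apply: le_trans ms.
set k := Num.truncn s; set theta := s - k%:R.
have ks : k%:R <= s by have /andP[] := truncn_itv s0.
have km : (k <= m.+1)%N by rewrite -(ler_nat R); exact: le_trans s2.
(* A bound for the diameters, at least 1 so that its powers increase. *)
pose d := 1 + 4 * h; have d1 : 1 <= d by rewrite lerDl mulr_ge0// ltW.
pose W1 : R := \sum_(j < k.+1) \sum_(b : j.-tuple bool) 1.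
pose W2 : R := \sum_(b : k.-tuple bool) 1.
have W10 : 0 <= W1 by apply: sumr_ge0 => j _; exact: sumr_ge0.
have W20 : 0 <= W2 by exact: sumr_ge0.
pose D := C1 * d ^+ (2 * m.+1).
have D0 : 0 <= D by rewrite mulr_ge0// exprn_ge0// (le_trans _ d1).
pose D2 := 4 * (2 / (1 - theta)) ^+ 2.
have D20 : 0 <= D2 by apply: mulr_ge0 => //; exact: sqr_ge0.
exists (W1 * D + W2 * D2); first by rewrite addr_ge0// mulr_ge0.
move=> K H rho c w oK Kh cK dK H0 Hh Hrho boxK aw.
have [hw _] := aw; have mK := open_measurable2 oK.
set P := (H `^ (m.+1%:R - s)) ^+ 2; set A := aform K m.+1 w w.
set E := _ + A.
have A0 : 0 <= A by exact: (form_ge0 (aform_psd oK Kh m.+1) hw).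
have P0 : 0 <= P by exact: sqr_ge0.
have Q0 : 0 <= H^-1 ^+ (2 * m.+1) * ip mu2 K w w.
  by apply: mulr_ge0; [rewrite exprn_ge0// invr_ge0 ltW | exact: ip_ge0].
have E0 : 0 <= E by exact: addr_ge0.
have AE : A <= E by rewrite lerDr.
have Hd : H <= d by apply: le_trans Hh _; rewrite lerDr.
have word b : (size b <= k)%N -> ip mu2 K (wderiv K b w) (wderiv K b w) <= D * P * E.
  move=> bk; have bm : (size b <= m.+1)%N by exact: leq_trans km.
  have le1 := hC1 K h H rho c w b oK Kh cK dK H0 Hrho boxK aw bm.
  have bs : (size b)%:R <= s by apply: le_trans ks; rewrite ler_nat.
  have dp := @diam_power s d H m.+1 (size b) H0 Hd d1 bs s2.
  have Hj : 0 < H ^+ (2 * size b) by rewrite exprn_gt0.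
  have Hm : 0 < H ^+ (2 * m.+1) by rewrite exprn_gt0.
  have e1 : ip mu2 K w w + H ^+ (2 * m.+1) * A = H ^+ (2 * m.+1) * E.
    by rewrite /E mulrDr mulrA -exprMn divff ?gt_eqF// expr1n mul1r.
  rewrite -(ler_pM2l Hj); apply: le_trans le1 _; rewrite -/A e1.
  rewrite -/P in dp.
  have -> : H ^+ (2 * size b) * (D * P * E) = C1 * (d ^+ (2 * m.+1) * P * H ^+ (2 * size b) * E).
    by rewrite /D; ring.
  by rewrite ler_wpM2l// ler_wpM2r.
have slob (b : k.-tuple bool) : 0 < theta ->
    (slobodeckii_sq K theta (wderiv K b w) <= (D2 * P * E)%:E)%E.
  move=> th0; have kE : k = m.
    apply/eqP; rewrite eqn_leq; apply/andP; split.
      rewrite -ltnS; rewrite ltn_neqAle km andbT; apply/eqP => e.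
      by move: th0; rewrite /theta e subr_gt0 ltNge s2.
    by rewrite -ltnS -(ltr_nat R); apply: le_lt_trans ms (truncnS_gt s).
  have hth : 0 <= theta < 1 := truncn_theta th0.
  have bm : (size b < m.+1)%N by rewrite size_tuple kE.
  apply: le_trans (slob_strong mK cK dK H0 hth (approximable_strong_gradient oK aw bm)) _.
  have r l : (size (rcons b l) <= m.+1)%N by rewrite size_rcons.
  rewrite !(sqintE mK (Hint_wderivL2 hw (r _))) -EFinD -EFinM lee_fin.
  have top l : ip mu2 K (wderiv K (rcons b l) w) (wderiv K (rcons b l) w) <= E.
    apply: le_trans AE; have sz : size (rcons b l) == m.+1 by rewrite size_rcons size_tuple kE.
    by rewrite /A /aform (bigD1 (Tuple sz))//= lerDl; apply: sumr_ge0 => ? _; exact: ip_ge0.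
  have e2 : 1 - theta = m.+1%:R - s by rewrite /theta kE -natr1; ring.
  have -> : 2 * slob_const theta H = 2 * ((2 / (1 - theta)) ^+ 2 * P).
    by rewrite /slob_const /P -e2 -exprMn; congr (_ * _ ^+ 2); ring.
  set q := (2 / (1 - theta)) ^+ 2; have q0 : 0 <= q by exact: sqr_ge0.
  rewrite (_ : D2 * P * E = 2 * (q * P) * (E + E)); last by rewrite /D2 -/q; ring.
  by rewrite ler_wpM2l ?lerD// mulr_ge0// mulr_ge0.
have hs : Hspace K k theta w.
  split; first exact: Hint_le hw.
  by move=> th0 b; apply: le_lt_trans (slob b th0) _; rewrite ltry.
split; first exact/(HsP oK).
have -> : (W1 * D + W2 * D2) * P * E = W1 * (D * P * E) + W2 * (D2 * P * E) by ring.
rewrite /hform -/k -/theta /hform_of; apply: lerD.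
  by apply: (@ip_word_le R k (fun b => ip mu2 K (wderiv K b w) (wderiv K b w))) => b; exact: word.
have [t0|t0] := boolP (0 < theta); last first.
  by rewrite big_pred0//; do ! apply: mulr_ge0 => //.
rewrite (eq_bigl xpredT)//= /W2 mulr_suml; apply: ler_sum => b _; rewrite mul1r.
have mDD : measurable (K `*` K) by exact: measurableX.
rewrite -lee_fin -(sqintE mDD (Hspace_quotient oK b t0 hs)) -slobodeckii_sqint//.
  exact: slob.
by have [] := @Hint_wderivL2 _ K m.+1 w b hw; rewrite ?size_tuple.
Qed.

End broken.

Section mesh_estimate.
Context {R : realType}.
Local Notation plane := (plane R).
Local Notation mu2 := (mu2 R).

Lemma approximable_restrict (Om : set plane) N (T : 'I_N -> 'I_3 -> plane) h m v i :
  open Om -> lipschitz_boundary Om -> Om `<=` square h -> triangulation Om T ->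
  approximable Om m v -> approximable (otri (T i)) m v.
Proof.
move=> oOm lip Omh hT [hv app]; split; first exact: (Hint_restrict oOm lip Omh hT).
move=> e e0; have [f sf hf] := app e e0; exists f => // b bm; apply: le_trans (hf b bm).
have mOm := open_measurable2 oOm; have mi := measurable_otri T i.
have [mw _] := Hint_wderivL2 hv bm.
have [mw' _] := Hint_wderivL2 (Hint_restrict oOm lip Omh hT i hv) bm.
have [_ ae] := wderiv_restrict oOm lip Omh hT i hv bm.
have mf E : measurable_fun E (pderiv (rev b) f) by apply: smooth_measurable; exact: smooth_pderiv.
have sub := @otri_sub _ _ _ _ oOm lip hT i.
have mwi : measurable_fun (otri (T i)) (wderiv Om b v) by exact: measurable_funS mOm sub mw.
apply: (@le_trans _ _ (sqint mu2 (otri (T i)) (pderiv (rev b) f \- wderiv Om b v)%R)).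
  rewrite le_eqVlt; apply/orP; left; apply/eqP; apply: (sqint_ae mi).
  - exact: measurable_funB.
  - exact: measurable_funB.
  by apply: ae_eq_sub => //; exact: ae_eq_refl.
apply: ge0_subset_integral => //.
- by apply: measurable_sq; exact: measurable_funB.
- by move=> x _; rewrite lee_fin sqr_ge0.
Qed.

(** A quarter of the radius leaves room to be in the interior. *)
Lemma shape_regular_box (S : 'I_3 -> plane) (h : R) (c : plane) (r : R) : 0 < r -> tri S `<=` square h ->
  [set x | eucl_dist c x <= r] `<=` tri S ->
  0 < diam (tri S) /\ box c (r / 4) `<=` otri S.
Proof.
move=> r0 Sh sub; have r00 := ltW r0; split.
  apply: (lt_le_trans r0); have dc x : `|x.1 - c.1| <= r / 2 -> `|x.2 - c.2| <= r / 2 -> tri S x.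
    move=> h1 h2; apply: sub => /=; rewrite (_ : r = 2 * (r / 2)); last by field.
    by apply: eucl_dist_max; rewrite ?divr_ge0.
  have T1 : tri S (c.1 + r, c.2).
    apply: sub => /=; rewrite /eucl_dist/= subrr expr0n addr0 opprD addNKr sqrrN.
    by rewrite sqrtr_sqr ger0_norm.
  have T2 : tri S c by apply: dc; rewrite subrr normr0 divr_ge0.
  apply: le_trans (diam_ge Sh T1 T2); apply: le_trans (eucl_dist_ge (c.1 + r, c.2) c).1.
  by rewrite /= addrC addKr ler_norm.
move=> x /boxP[x1 x2]; apply/interiorP2; exists (r / 4); first by rewrite divr_gt0.
move=> y y1 y2; apply: sub => /=; rewrite (_ : r = 2 * (r / 2)); last by field.
apply: eucl_dist_max; first by rewrite divr_ge0.
  by have := ler_distD (x.1 : R) y.1 c.1; lra.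
by have := ler_distD (x.2 : R) y.2 c.2; lra.
Qed.

(** The local constant is chosen before the mesh, so that it depends on the
    mesh only through its shape regularity. *)
Theorem broken_Hs_estimate (s gam h : R) (m : nat) (Om : set plane) : 0 < h ->
  open Om -> lipschitz_boundary Om -> Om `<=` square h ->
  m.+1%:R - 1 <= s <= m.+1%:R -> exists2 C : R, 0 <= C &
  forall N (T : 'I_N -> 'I_3 -> plane) (w : plane -> R),
  triangulation Om T -> shape_regular gam T ->
  (forall i, approximable (otri (T i)) m.+1 w) ->
  (forall i, Hs (otri (T i)) s w) /\
  \sum_i hform (otri (T i)) s w w <= C * (hmax T `^ (m.+1%:R - s)) ^+ 2 *
    (\sum_i (diam (tri (T i)))^-1 ^+ (2 * m.+1) * ip mu2 (otri (T i)) w w + apw T m.+1 w w).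
Proof.
move=> h0 oOm lip Omh hs; have /andP[s1 s2] := hs.
have [C C0 hC] : exists2 C : R, 0 <= C & forall N (T : 'I_N -> 'I_3 -> plane) i (w : plane -> R),
    triangulation Om T -> shape_regular gam T -> approximable (otri (T i)) m.+1 w ->
    Hs (otri (T i)) s w /\ hform (otri (T i)) s w w <=
      C * (diam (tri (T i)) `^ (m.+1%:R - s)) ^+ 2 *
      ((diam (tri (T i)))^-1 ^+ (2 * m.+1) * ip mu2 (otri (T i)) w w + aform (otri (T i)) m.+1 w w).
  (* For gam <= 0 no triangle satisfies the condition of shape regularity. *)
  have [g0|g0] := ltP 0 gam; last first.
    exists 0 => // N T i w hT sr; have [c [r [r0 sub le]]] := sr i.
    have [d0 _] := shape_regular_box r0 (@tri_square _ _ _ _ _ Omh hT i) sub.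
    by have := lt_le_trans d0 le; rewrite pmulr_lgt0 ?mulr_gt0// ltNge g0.
  have [C C0 hC] := local_Hs_estimate g0 h0 hs; exists C => // N T i w hT sr aw.
  have [c [r [r0 sub le]]] := sr i; have Th := @tri_square _ _ _ _ _ Omh hT i.
  have [d0 bx] := shape_regular_box r0 Th sub.
  apply: (hC (otri (T i)) (diam (tri (T i))) (r / 4) c w) => //.
  - exact: otri_open.
  - exact: (@otri_square _ _ _ _ _ Omh hT i).
  - by apply: otri_convex; case: hT.
  - exact: (diam_bound_otri Omh hT).
  - by apply: diam_le => //; exact: ltW.
  - by rewrite (_ : 8 * gam * (r / 4) = gam * (2 * r))//; field.
exists C => // N T w hT sr aw; split; first by move=> i; case: (hC N T i w hT sr (aw i)).
rewrite /apw -big_split/= mulr_sumr; apply: ler_sum => i _.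
have [_ le] := hC N T i w hT sr (aw i); apply: le_trans le _.
have [c [r [r0 sub _]]] := sr i; have Th := @tri_square _ _ _ _ _ Omh hT i.
have [d0 _] := shape_regular_box r0 Th sub.
have oi := otri_open (T i); have hi := @otri_square _ _ _ _ _ Omh hT i.
have [hw _] := aw i.
apply: ler_wpM2r.
  apply: addr_ge0; last exact: (form_ge0 (aform_psd oi hi m.+1) hw).
  by apply: mulr_ge0; [rewrite exprn_ge0// invr_ge0 ltW | exact: ip_ge0].
apply: ler_wpM2l => //; rewrite lerXn2r ?nnegrE ?powR_ge0//.
have dh : diam (tri (T i)) <= hmax T by exact: le_bigmax.
by apply: ge0_ler_powR; rewrite ?nnegrE ?subr_ge0 ?(ltW d0)//; exact: le_trans (ltW d0) dh.
Qed.

End mesh_estimate.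

(** * The nonconforming method *)
Section method.
Context {R : realType}.
Local Notation plane := (plane R).
Local Notation mu2 := (mu2 R).
Variables (Om : set plane) (h : R) (N : nat) (T : 'I_N -> 'I_3 -> plane) (m : nat).
Hypotheses (oOm : open Om) (lip : lipschitz_boundary Om) (Omh : Om `<=` square h).
Hypothesis hT : triangulation Om T.
Let mOm := open_measurable2 oOm.

Definition Hint_pw (v : plane -> R) := forall i, Hint (otri (T i)) m v.

Let hti i : otri (T i) `<=` square h := @otri_square _ _ _ _ _ Omh hT i.

Lemma Hint_pw_linear : linear_set (Hint_pw : set (plane -> R)).
Proof. by move=> a b f g hf hg i; exact: (Hint_linear (otri_open (T i)) (@hti i) a b (hf i) (hg i)). Qed.

Lemma apw_psd : psd_form (Hint_pw : set (plane -> R)) (apw T m).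
Proof.
apply: (@psd_form_sum _ _ _ _ _ _ (fun i => aform (otri (T i)) m)) => i _.
have hp := aform_psd (otri_open (T i)) (@hti i) m.
by apply: (sub_psd_form _ hp) => v; exact.
Qed.

Lemma H0_pw v : H0 Om m%:R v -> Hint_pw v.
Proof. by move=> hv i; apply: (Hint_restrict oOm lip Omh hT); exact: (H0_Hint oOm hv). Qed.

Lemma Ppw_smooth v i : Ppw T Om m v -> measurable_fun (otri (T i)) v /\
  exists2 p, smooth p & ae_eq mu2 (otri (T i)) v p.
Proof.
move=> [mv hv]; split; first exact: measurable_funS mOm (@otri_sub _ _ _ _ oOm lip hT i) mv.
by have [c hc] := hv i; eexists; last exact: hc; exact: smooth_poly.
Qed.

Lemma Ppw_L2 v i : Ppw T Om m v -> inL2 mu2 (otri (T i)) v.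
Proof.
move=> hv; have [mv [p sp vp]] := Ppw_smooth i hv.
have mi := measurable_otri T i.
apply: (inL2_ae mi mv (ae_eq_sym vp)); exact: (inL2_smooth mi (@hti i) sp).
Qed.

Lemma Ppw_pw v : Ppw T Om m v -> Hint_pw v.
Proof.
move=> hv i; have [mv [p sp vp]] := Ppw_smooth i hv.
exact: (Hint_ae (otri_open (T i)) (@hti i) (Ppw_L2 i hv) (ae_eq_sym vp) (Hint_smooth (otri_open (T i)) (@hti i) m sp)).
Qed.

Lemma ae_otri (v v' : plane -> R) i : ae_eq mu2 Om v v' -> ae_eq mu2 (otri (T i)) v v'.
Proof. by apply: filterS => x hx Tx; apply: hx; exact: (@otri_sub _ _ _ _ oOm lip hT i). Qed.

Lemma apw_ae v v' w : Hint_pw v -> Hint_pw v' -> ae_eq mu2 Om v v' ->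
  apw T m v w = apw T m v' w.
Proof.
move=> hv hv' vv'; apply: eq_bigr => i _; rewrite /aform; apply: eq_bigr => b _.
by rewrite (wderiv_ae_eq (otri_open (T i)) (@hti i) b (Hint_L2 (hv i)) (Hint_L2 (hv' i)) (ae_otri i vv')).
Qed.

Local Opaque apw aform.

Lemma enorm_ge0 v : 0 <= enorm T m v.
Proof. exact: sqrtr_ge0. Qed.

Lemma sqr_enorm v : Hint_pw v -> enorm T m v ^+ 2 = apw T m v v.
Proof. by move=> hv; rewrite sqr_sqrtr//; exact: (form_ge0 apw_psd hv). Qed.

Lemma pwB v w : Hint_pw v -> Hint_pw w -> Hint_pw (v \- w)%R.
Proof. by move=> hv hw; rewrite combB; exact: (Hint_pw_linear 1 (-1) hv hw). Qed.

Lemma apwBl v w z : Hint_pw v -> Hint_pw w -> Hint_pw z ->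
  apw T m (v \- w)%R z = apw T m v z - apw T m w z.
Proof.
by move=> hv hw hz; rewrite combB (form_combl apw_psd 1 (-1) hv hw hz) mul1r mulN1r.
Qed.

Lemma apwC v w : Hint_pw v -> Hint_pw w -> apw T m v w = apw T m w v.
Proof. exact: (form_sym apw_psd). Qed.

Lemma apwBr v w z : Hint_pw v -> Hint_pw w -> Hint_pw z ->
  apw T m z (v \- w)%R = apw T m z v - apw T m z w.
Proof.
move=> hv hw hz.
by rewrite (apwC hz (pwB hv hw)) (apwBl hv hw hz) (apwC hv hz) (apwC hw hz).
Qed.

Lemma enormB v w : Hint_pw v -> Hint_pw w -> enorm T m (v \- w)%R = enorm T m (w \- v)%R.
Proof.
move=> hv hw; have vw := pwB hv hw; rewrite /enorm.
have -> : (w \- v)%R = comb (-1) (v \- w)%R 0 (v \- w)%R.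
  by apply/funext => x; rewrite /comb /=; ring.
rewrite (form_quad Hint_pw_linear apw_psd (-1) 0 vw vw).
by move: (apw T m _ _) => q; congr Num.sqrt; ring.
Qed.

Lemma enorm_triangle v w z : Hint_pw v -> Hint_pw w -> Hint_pw z ->
  enorm T m (v \- z)%R <= enorm T m (v \- w)%R + enorm T m (w \- z)%R.
Proof.
move=> hv hw hz; have -> : (v \- z)%R = ((v \- w) \+ (w \- z))%R.
  by apply/funext => x /=; ring.
by apply: (form_triangle Hint_pw_linear apw_psd); exact: pwB.
Qed.

Lemma apw_CS v w : Hint_pw v -> Hint_pw w -> `|apw T m v w| <= enorm T m v * enorm T m w.
Proof. exact: (form_CS_abs Hint_pw_linear apw_psd). Qed.

Local Opaque enorm.

Section companion.
Variables (Vnc : set (plane -> R)) (Inc J : (plane -> R) -> plane -> R) (LamJ : R).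
Hypotheses (VP : Vnc `<=` Ppw T Om m) (hInc : operator Om (H0 Om m%:R) Vnc Inc).
Hypothesis orth : forall v wm, H0 Om m%:R v -> Ppw T Om m wm -> apw T m (v \- Inc v)%R wm = 0.
Hypothesis hJ : forall v, Vnc v -> H0 Om m%:R (J v).
Hypothesis IncJ : forall vnc, Vnc vnc -> ae_eq mu2 Om (Inc (J vnc)) vnc.
Hypothesis quasi : forall vnc v, Vnc vnc -> H0 Om m%:R v ->
  enorm T m (vnc \- J vnc)%R <= LamJ * enorm T m (vnc \- v)%R.

Lemma Vnc_pw v : Vnc v -> Hint_pw v.
Proof. by move=> /VP; exact: Ppw_pw. Qed.

Lemma J_pw v : Vnc v -> Hint_pw (J v).
Proof. by move=> /hJ; exact: H0_pw. Qed.

Lemma Inc_Vnc v : H0 Om m%:R v -> Vnc (Inc v).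
Proof. by case: hInc => + _; exact. Qed.

(** The interpolation error of J v is J v - v. *)
Lemma J_orthogonal v w : Vnc v -> Vnc w -> apw T m (J v) w = apw T m v w.
Proof.
move=> hv hw; have Jv := J_pw hv; have Iv := Inc_Vnc (hJ hv).
have := orth (hJ hv) (VP hw).
rewrite (apwBl Jv (Vnc_pw Iv) (Vnc_pw hw)).
rewrite (apw_ae w (Vnc_pw Iv) (Vnc_pw hv) (IncJ hv)).
by move/eqP; rewrite subr_eq0 => /eqP.
Qed.

Lemma quasi_abs v w : Vnc v -> H0 Om m%:R w ->
  enorm T m (v \- J v)%R <= `|LamJ| * enorm T m (v \- w)%R.
Proof.
move=> hv hw; apply: le_trans (quasi hv hw) _; apply: ler_wpM2r; first exact: enorm_ge0.
exact: ler_norm.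
Qed.

(** The two equations give a(u, J v) = a_pw(unc, v) for v = Inc z, and J v - v
    is orthogonal to piecewise polynomials. Hence every factor of the product
    can be replaced by an error of interpolation, of J, or of the method. *)
Theorem second_order F u unc z : weak_solution Om m F u ->
  Vnc unc -> (forall vnc, Vnc vnc -> apw T m unc vnc = F (J vnc)) -> H0 Om m%:R z ->
  `|apw T m (u \- J unc)%R z| <= ((1 + `|LamJ|) ^+ 2 + `|LamJ| ^+ 2) *
     (enorm T m (u \- unc)%R * enorm T m (z \- Inc z)%R).
Proof.
move=> [hu eu] hunc eunc hz; set L : R := `|LamJ|; have L0 : 0 <= L by exact: normr_ge0.
have hzi := Inc_Vnc hz; set zi := Inc z in hzi *.
have Xu := H0_pw hu; have Xz := H0_pw hz; have Xn := Vnc_pw hunc; have Xi := Vnc_pw hzi.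
have XJn := J_pw hunc; have XJi := J_pw hzi.
(* Both sides equal F (J zi). *)
have uJ : apw T m u (J zi) = apw T m unc zi.
  rewrite (eunc _ hzi) -(eu _ (hJ hzi)).
  by apply: (apw_aform oOm lip Omh hT); apply: (H0_Hint oOm); [exact: hu | exact: (hJ hzi)].
have id : apw T m (u \- J unc)%R z =
    apw T m (u \- J unc)%R (z \- J zi)%R - apw T m (J unc \- unc)%R (J zi \- zi)%R.
  rewrite (apwBl Xu XJn Xz) (apwBl Xu XJn (pwB Xz XJi)) (apwBl XJn Xn (pwB XJi Xi)).
  rewrite (apwBr Xz XJi Xu) (apwBr Xz XJi XJn) (apwBr XJi Xi XJn) (apwBr XJi Xi Xn).
  rewrite uJ (J_orthogonal hunc hzi) (apwC Xn XJi) (J_orthogonal hzi hunc) (apwC Xi Xn).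
  by move: (apw T m u z) (apw T m (J unc) z) (apw T m unc zi) (apw T m (J unc) (J zi)) => p q r t; ring.
set a := enorm T m (u \- unc)%R; set b := enorm T m (z \- zi)%R.
have a0 : 0 <= a by exact: enorm_ge0.
have b0 : 0 <= b by exact: enorm_ge0.
have j1 : enorm T m (J unc \- unc)%R <= L * a.
  by rewrite (enormB XJn Xn) /a (enormB Xu Xn); exact: quasi_abs.
have j2 : enorm T m (J zi \- zi)%R <= L * b.
  by rewrite (enormB XJi Xi) /b (enormB Xz Xi); exact: quasi_abs.
have tri (p q c : R) : p <= c + q -> q <= L * c -> p <= (1 + L) * c.
  by move=> h1 h2; apply: (le_trans h1); rewrite mulrDl mul1r lerD2l.
have k1 : enorm T m (u \- J unc)%R <= (1 + L) * a.
  have := enorm_triangle Xu Xn XJn; rewrite (enormB Xn XJn) -/a.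
  by move=> t; exact: tri t j1.
have k2 : enorm T m (z \- J zi)%R <= (1 + L) * b.
  have := enorm_triangle Xz Xi XJi; rewrite (enormB Xi XJi) -/b.
  by move=> t; exact: tri t j2.
rewrite id; apply: le_trans (ler_normB _ _) _.
have c1 := apw_CS (pwB Xu XJn) (pwB Xz XJi).
have c2 := apw_CS (pwB XJn Xn) (pwB XJi Xi).
have d1 := le_trans c1 (ler_pM (enorm_ge0 _) (enorm_ge0 _) k1 k2).
have d2 := le_trans c2 (ler_pM (enorm_ge0 _) (enorm_ge0 _) j1 j2).
apply: le_trans (lerD d1 d2) _; rewrite le_eqVlt; apply/orP; left; apply/eqP; ring.
Qed.

Lemma hmesh_otri i x : otri (T i) x -> hmesh T x = diam (tri (T i)).
Proof.
move=> Tx; rewrite /hmesh (bigD1 i)//= indicE mem_set// mulr1 big1 ?addr0// => j ji.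
rewrite indicE memNset ?mulr0// => Tj.
have : (otri (T j) `&` otri (T i)) x by [].
by rewrite (otri_disjoint hT ji).
Qed.

Lemma measurable_hmesh_inv E : measurable_fun E (fun x => hmesh T x ^- m).
Proof.
have hm0 x : 0 <= hmesh T x.
  apply: sumr_ge0 => i _; apply: mulr_ge0 => //.
  rewrite /diam; have [[y Ty]|e] := pselect (tri (T i) !=set0).
    apply: le_trans (diam_ge (@tri_square _ _ _ _ _ Omh hT i) Ty Ty); exact: sqrtr_ge0.
  rewrite (_ : [set d | _] = set0) ?sup0//; apply/seteqP; split => // d [p [q [Tp _ _]]].
  by apply: e; exists p.
(* The inverse is 0 on the skeleton, like the power with exponent -1. *)
rewrite (_ : (fun x => _) = (fun x => (hmesh T x `^ (-1)) ^+ m)); last first.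
  by apply/funext => x; rewrite powR_inv1// exprVn.
apply: measurable_funX; apply: (measurableT_comp (measurable_powR _)).
apply: measurable_sum => i; apply: measurable_funM => //.
by apply: measurable_indic; exact: measurable_otri.
Qed.

Lemma sqrte_le (x : \bar R) (c : R) : (0 <= x)%E -> (sqrte x <= c%:E)%E -> (x <= (c ^+ 2)%:E)%E.
Proof.
case: x => [r| |]//; rewrite !lee_fin => r0 le.
by rewrite -(sqr_sqrtr r0) lerXn2r// nnegrE ?sqrtr_ge0// (le_trans _ le)// sqrtr_ge0.
Qed.

(** The interpolation error of J v is J v - v almost everywhere, and the weight
    is constant on each triangle. *)
Lemma weighted_companion kappa v : Vnc v ->
  (L2norm Om (fun x => (hmesh T x ^- m * (J v x - Inc (J v) x))%R)
    <= (kappa * enorm T m (J v \- Inc (J v)))%R%:E)%E ->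
  (forall i, 0 < diam (tri (T i))) ->
  \sum_i (diam (tri (T i)))^-1 ^+ (2 * m) * ip mu2 (otri (T i)) (J v \- v)%R (J v \- v)%R <=
  kappa ^+ 2 * apw T m (J v \- v)%R (J v \- v)%R.
Proof.
move=> hv le d0; have hI := Inc_Vnc (hJ hv).
have [mI _] := VP hI; have [mv _] := VP hv.
have [mJ _] : inL2 mu2 Om (J v) by exact: Hint_L2 (H0_Hint oOm (hJ hv)).
have XJ := J_pw hv; have Xv := Vnc_pw hv; have XI := Vnc_pw hI.
have ae1 : ae_eq mu2 Om (J v \- Inc (J v))%R (J v \- v)%R.
  by apply: ae_eq_sub; [exact: ae_eq_refl | exact: IncJ].
have energy : apw T m (J v \- Inc (J v))%R (J v \- Inc (J v))%R = apw T m (J v \- v)%R (J v \- v)%R.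
  have X1 := pwB XJ XI; have X2 := pwB XJ Xv.
  by rewrite (apw_ae _ X1 X2 ae1) (apwC X2 X1) (apw_ae _ X1 X2 ae1).
pose f x := hmesh T x ^- m * (J v x - Inc (J v) x).
have mf : measurable_fun Om f.
  by apply: measurable_funM; [exact: measurable_hmesh_inv | exact: measurable_funB].
have := sqrte_le (sqint_ge0 mu2 Om f) le.
rewrite exprMn (sqr_enorm (pwB XJ XI)) energy => le2; rewrite -lee_fin; apply: le_trans le2.
have := sum_integral_le mu2 (measurable_otri T) mOm (fun i => @otri_sub _ _ _ _ oOm lip hT i)
  (fun i j => @otri_disjoint _ _ _ _ hT i j) mf.
apply: le_trans; rewrite -sumEFin le_eqVlt; apply/orP; left; apply/eqP; apply: eq_bigr => i _.
have mi := measurable_otri T i.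
have L2w : inL2 mu2 (otri (T i)) (J v \- v)%R by exact: Hint_L2 (pwB XJ Xv i).
pose g x := (diam (tri (T i)))^-1 ^+ m * (J v x - v x).
have L2g : inL2 mu2 (otri (T i)) g by exact: (inL2Z mi _ L2w).
have sub := @otri_sub _ _ _ _ oOm lip hT i.
have -> : sqint mu2 (otri (T i)) f = sqint mu2 (otri (T i)) g.
  apply: (sqint_ae mi).
  - exact: measurable_funS mOm sub mf.
  - by case: L2g.
  apply: filterS (IncJ hv) => x hx Tx; rewrite /f /g (hmesh_otri Tx) exprVn; congr (_ * (_ - _)).
  by apply: hx; exact: sub.
rewrite (sqintE mi L2g); congr EFin.
have -> : g = comb ((diam (tri (T i)))^-1 ^+ m) (J v \- v)%R 0 (J v \- v)%R.
  by apply/funext => x; rewrite /g /comb /=; ring.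
rewrite (form_quad (inL2_linear mi) (ip_psd _ mi) _ 0 L2w L2w).
rewrite [(2 * m)%N]mulnC exprM; move: (ip _ _ _ _) (_ ^+ m) => p q; ring.
Qed.

End companion.
End method.

Section constants.
Context {R : realType}.
Local Notation plane := (plane R).

(** The inner product with e, divided by the norm of e. *)
Lemma norm_by_duality (Om : set plane) (h s : R) (e : plane -> R) :
  open Om -> Om `<=` square h ->
  H0 Om s e -> 0 < hform Om s e e -> exists G, [/\ Hdual Om s G,
    (dualnorm Om s G <= 1)%E & G e = Num.sqrt (hform Om s e e)].
Proof.
move=> oOm Omh he n0; set n := Num.sqrt _.
have np : 0 < n by rewrite sqrtr_gt0.
have hB := hform_psd oOm Omh s; have hL := Hs_linear oOm Omh (s := s).
have He := H0_Hs he.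
pose G v := hform Om s v e / n.
have Gl a b f g : H0 Om s f -> H0 Om s g -> G (lincomb a f b g) = a * G f + b * G g.
  move=> /H0_Hs hf /H0_Hs hg; rewrite /G.
  rewrite -[lincomb a f b g]/(comb a f b g) (form_combl hB a b hf hg He).
  by rewrite mulrDl !mulrA.
have G1 : (dualnorm Om s G <= 1)%E.
  apply: ge_ereal_sup => _ [v [/H0_Hs hv v1] <-]; rewrite lee_fin /G normrM normfV.
  rewrite (gtr0_norm np) ler_pdivrMr// mul1r.
  apply: (le_trans (form_CS_abs hL hB hv He)).
  move: v1; rewrite (HnormE oOm hv) lee_fin => v1.
  by apply: (@le_trans _ _ (1 * n)); [apply: ler_wpM2r => //; exact: ltW | rewrite mul1r].
exists G; split => //.
  by split => //; apply: le_lt_trans G1 _; rewrite ltry.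
have e1 : hform Om s e e = n * n by rewrite -expr2 sqr_sqrtr// ltW.
by rewrite /G e1 mulfK// gt_eqF.
Qed.

End constants.

Theorem theorem4p1 (R : realType) (m : nat) (m_gt0 : (0 < m)%N)
    (Om : set (plane R)) (hOm : polygonal_lipschitz_domain Om)
    (s kappa LamJ creg cint gam : R) :
  exists C2 C3 : R, 0 < C2 /\ 0 < C3 /\
  forall (N : nat) (T : 'I_N -> 'I_3 -> plane R),
    triangulation Om T -> shape_regular gam T ->
  forall Vnc : set (plane R -> R),
    linear_subspace Vnc ->
    Vnc `<=` Ppw T Om m ->
    (exists2 v, Vnc v & ~ ae_eq (mu2 R) Om v (fun=> 0)) ->
    norm_on Om Vnc (enorm T m) ->
  forall Inc : (plane R -> R) -> plane R -> R,
    operator Om (H0 Om m%:R) Vnc Inc ->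
    0 < kappa ->
    (forall v wm, H0 Om m%:R v -> Ppw T Om m wm -> apw T m (v \- Inc v) wm = 0) ->
    (forall v, H0 Om m%:R v ->
       (L2norm Om (fun x => (hmesh T x ^- m * (v x - Inc v x))%R)
        <= (kappa * enorm T m (v \- Inc v))%R%:E)%E) ->
  forall J : (plane R -> R) -> plane R -> R,
    linear_operator Om Vnc (H0 Om m%:R) J ->
    (forall vnc, Vnc vnc -> ae_eq (mu2 R) Om (Inc (J vnc)) vnc) ->
    (forall vnc v, Vnc vnc -> H0 Om m%:R v ->
       enorm T m (vnc \- J vnc) <= LamJ * enorm T m (vnc \- v)) ->
  forall (sigma : R) (Creg Cint : R -> R),
    0 < sigma <= 1 ->
    (forall t, m%:R - sigma <= t <= m%:R -> 0 < Creg t /\ 0 < Cint t) ->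
    (forall t, m%:R - sigma <= t <= m%:R ->
     forall G z, Hdual Om t G -> weak_solution Om m G z ->
       [/\ Hs Om (2 * m%:R - t) z,
           (Hnorm Om (2 * m%:R - t)%R z <= (Creg t)%:E * dualnorm Om t G)%E &
           ((enorm T m (z \- Inc z))%R%:E
            <= (Cint t * hmax T `^ (m%:R - t))%R%:E
               * Hnorm Om (2 * m%:R - t)%R z)%E]) ->
    m%:R - sigma <= s <= m%:R -> Creg s = creg -> Cint s = cint ->
  forall (F : (plane R -> R) -> R) (u unc : plane R -> R),
    Hdual Om s F ->
    weak_solution Om m F u ->
    Vnc unc -> (forall vnc, Vnc vnc -> apw T m unc vnc = F (J vnc)) ->
    (Hnorm Om s (u \- J unc)%R
       <= (C2 * hmax T `^ (m%:R - s) * enorm T m (u \- unc))%R%:E)%E /\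
    (Hnorm_pw T s (u \- unc)%R
       <= (C3 * hmax T `^ (m%:R - s) * enorm T m (u \- unc))%R%:E)%E.
Proof.
case: m m_gt0 => [//|m] _.
have [oOm _ _ bOm [lip _]] := hOm; have [h h0 Omh] := bounded_square bOm.
(* Outside this range no sigma <= 1 admits s, and any constants do. *)
have [hs|hs] := boolP (m.+1%:R - 1 <= s <= m.+1%:R); last first.
  exists 1, 1; do 2! split => //.
  move=> N T _ _ Vnc _ _ _ _ Inc _ _ _ _ J _ _ _ sigma Creg Cint /andP[_ s1] _ _ /andP[ms sm].
  by exfalso; move/negP : hs; apply; rewrite sm andbT; lra.
have [C C0 hC] := broken_Hs_estimate gam h0 oOm lip Omh hs.
set L : R := (1 + `|LamJ|) ^+ 2 + `|LamJ| ^+ 2.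
pose C2 := 1 + L * `|cint * creg|.
have L0 : 0 <= L by rewrite addr_ge0// sqr_ge0.
have C20 : 0 < C2 by rewrite ltr_pwDl// mulr_ge0.
(* The two terms come from e = u - J unc and from w = J unc - unc. *)
pose C3sq := 2 * C2 ^+ 2 + 2 * (C * ((kappa ^+ 2 + 1) * LamJ ^+ 2)).
have C3sq0 : 0 <= C3sq.
  apply: addr_ge0; apply: mulr_ge0 => //; first exact: sqr_ge0.
  by apply: mulr_ge0 => //; apply: mulr_ge0; [rewrite addr_ge0// sqr_ge0 | exact: sqr_ge0].
pose C3 := 1 + Num.sqrt C3sq.
have C30 : 0 < C3 by rewrite ltr_pwDl// sqrtr_ge0.
exists C2, C3; do 2! split => //.
move=> N T hT sr Vnc _ VP _ _ Inc hInc k0 orth hkap J [[hJ _] _] IncJ quasi sigma Creg Cint _ pos reg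
  hss eCreg eCint F u unc hF hu hunc eunc.
have [cr0 ci0] := pos s hss; rewrite eCreg eCint in cr0 ci0.
set P := hmax T `^ (m.+1%:R - s); have P0 : 0 <= P by exact: powR_ge0.
set E := enorm T m.+1 (u \- unc)%R; have E0 : 0 <= E by exact: enorm_ge0.
have [hu0 eu] := hu.
have he0 : H0 Om m.+1%:R (u \- J unc)%R by exact: (H0B oOm Omh h0 hu0 (hJ _ hunc)).
have he : H0 Om s (u \- J unc)%R by exact: (H0_sub oOm Omh h0 hs he0).
have He := H0_Hs he; set e := (u \- J unc)%R in he0 he He *.
have n0 : 0 <= hform Om s e e by exact: (form_ge0 (hform_psd oOm Omh s) He).
have parta : Num.sqrt (hform Om s e e) <= C2 * P * E.
  (* For e = 0 the inner product with e cannot be normalised. *)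
  have [nz|nz] := eqVneq (hform Om s e e) 0.
    by rewrite nz sqrtr0; apply: mulr_ge0 => //; apply: mulr_ge0 => //; exact: ltW.
  have np : 0 < hform Om s e e by rewrite lt0r nz.
  have [G [hG G1 Ge]] := norm_by_duality oOm Omh he np.
  have [z hz] := weak_solution_exists oOm Omh h0 hs hG; have [hz0 ez] := hz.
  have [_ r1 r2] := reg s hss G z hG hz; rewrite eCreg eCint -/P in r1 r2.
  have zI : enorm T m.+1 (z \- Inc z)%R <= cint * P * creg.
    rewrite -lee_fin; apply: (le_trans r2); rewrite [leRHS]EFinM; apply: lee_wpmul2l.
      by rewrite lee_fin mulr_ge0// ltW.
    apply: (le_trans r1); rewrite -[leRHS]mule1; apply: lee_wpmul2l => //.
    by rewrite lee_fin ltW.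
  have so := second_order oOm lip Omh hT VP hInc orth hJ IncJ quasi hu hunc eunc hz0.
  have Ae : G e = apw T m.+1 e z.
    have hie := H0_Hint oOm he0; have hiz := H0_Hint oOm hz0.
    by rewrite -(ez _ he0) (apw_aform oOm lip Omh hT hie hiz) (form_sym (aform_psd oOm Omh m.+1) hie hiz).
  rewrite -Ge Ae; apply: (le_trans (ler_norm _)); apply: (le_trans so); rewrite -/E -/L.
  apply: (@le_trans _ _ (L * (E * (cint * P * creg)))).
    by apply: ler_wpM2l => //; apply: ler_wpM2l.
  rewrite /C2 (ger0_norm (_ : 0 <= cint * creg)); last by rewrite mulr_ge0// ltW.
  have -> : L * (E * (cint * P * creg)) = L * (cint * creg) * P * E by ring.
  apply: ler_wpM2r => //; apply: ler_wpM2r => //; by rewrite lerDr.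
split; first by rewrite (HnormE oOm He) lee_fin.
pose w := (J unc \- unc)%R.
have aw i : approximable (otri (T i)) m.+1 w.
  have [mn [p sp np]] := Ppw_smooth oOm lip hT i (VP _ hunc).
  apply: (approximable_sub (otri_open (T i)) (@otri_square _ _ _ _ _ Omh hT i) _ sp mn np).
  apply: (approximable_restrict i oOm lip Omh hT); exact: (H0_approximable oOm Omh h0 (hJ _ hunc)).
have [hw le] := hC N T w hT sr aw.
have [heT leT] := Hsq_restrict oOm lip Omh hT He.
have d0 i : 0 < diam (tri (T i)).
  have [c [r [r0 sub _]]] := sr i.
  by have [] := shape_regular_box r0 (@tri_square _ _ _ _ _ Omh hT i) sub.
have XJ := J_pw oOm lip Omh hT hJ hunc.
have Xn := Vnc_pw oOm lip Omh hT VP hunc.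
have Xu := H0_pw oOm lip Omh hT hu0.
have Aw : apw T m.+1 w w <= LamJ ^+ 2 * E ^+ 2.
  rewrite -(sqr_enorm Omh hT (pwB Omh hT XJ Xn)) -exprMn.
  have q := quasi unc u hunc hu0.
  rewrite (enormB Omh hT Xn XJ) (enormB Omh hT Xn Xu) -/E in q.
  rewrite lerXn2r ?nnegrE ?enorm_ge0//; exact: le_trans (enorm_ge0 _ _ _) q.
have wc := weighted_companion oOm lip Omh hT VP hInc hJ IncJ hunc (hkap _ (hJ _ hunc)) d0.
have bound : \sum_i hform (otri (T i)) s (u \- unc)%R (u \- unc)%R <= (C3 * P * E) ^+ 2.
  have split i : hform (otri (T i)) s (u \- unc)%R (u \- unc)%R <=
      2 * hform (otri (T i)) s e e + 2 * hform (otri (T i)) s w w.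
    have oi := otri_open (T i); have hi := @otri_square _ _ _ _ _ Omh hT i.
    have -> : (u \- unc)%R = comb 1 e 1 w by apply/funext => x; rewrite /comb /e /w/=; ring.
    have := form_comb_le (Hs_linear oi hi (s := s)) (hform_psd oi hi s) 1 1 (heT i) (hw i).
    by rewrite expr1n !mulr1.
  have sumle (a b c : 'I_N -> R) : (forall i, a i <= 2 * b i + 2 * c i) ->
      \sum_i a i <= 2 * \sum_i b i + 2 * \sum_i c i.
    by move=> abc; rewrite !mulr_sumr -big_split/=; apply: ler_sum => i _; exact: abc.
  apply: (le_trans (sumle _ _ _ split)).
  have t1 : \sum_i hform (otri (T i)) s e e <= C2 ^+ 2 * P ^+ 2 * E ^+ 2.
    apply: (le_trans leT); rewrite -(sqr_sqrtr n0) -!exprMn lerXn2r ?nnegrE ?sqrtr_ge0//.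
    by apply: mulr_ge0 => //; apply: mulr_ge0 => //; exact: ltW.
  have t2 : \sum_i hform (otri (T i)) s w w <= C * ((kappa ^+ 2 + 1) * LamJ ^+ 2) * P ^+ 2 * E ^+ 2.
    apply: (le_trans le); rewrite -/P.
    have -> : C * ((kappa ^+ 2 + 1) * LamJ ^+ 2) * P ^+ 2 * E ^+ 2 =
       C * P ^+ 2 * ((kappa ^+ 2 + 1) * (LamJ ^+ 2 * E ^+ 2)) by ring.
    apply: ler_wpM2l; first by apply: mulr_ge0 => //; exact: sqr_ge0.
    apply: (@le_trans _ _ ((kappa ^+ 2 + 1) * apw T m.+1 w w)).
      by rewrite mulrDl mul1r; apply: lerD.
    by apply: ler_wpM2l => //; rewrite addr_ge0// sqr_ge0.
  apply: (@le_trans _ _ (C3sq * P ^+ 2 * E ^+ 2)).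
    have -> : C3sq * P ^+ 2 * E ^+ 2 = 2 * (C2 ^+ 2 * P ^+ 2 * E ^+ 2) +
      2 * (C * ((kappa ^+ 2 + 1) * LamJ ^+ 2) * P ^+ 2 * E ^+ 2) by rewrite /C3sq; ring.
    by apply: lerD; apply: ler_wpM2l.
  rewrite !exprMn; apply: ler_wpM2r; first exact: sqr_ge0.
  apply: ler_wpM2r; first exact: sqr_ge0.
  rewrite -(sqr_sqrtr C3sq0) lerXn2r ?nnegrE ?sqrtr_ge0 ?(ltW C30)//.
  by rewrite /C3 lerDr.
have HT i : Hs (otri (T i)) s (u \- unc)%R.
  have -> : (u \- unc)%R = comb 1 e 1 w by apply/funext => x; rewrite /comb /e /w/=; ring.
  exact: (Hs_linear (otri_open (T i)) (@otri_square _ _ _ _ _ Omh hT i) (s := s) 1 1 (heT i) (hw i)).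
rewrite /Hnorm_pw (eq_bigr (fun i => (hform (otri (T i)) s (u \- unc)%R (u \- unc)%R)%:E)); last first.
  by move=> i _; exact: (HsqE (otri_open (T i)) ((HsP (otri_open (T i)) s _).1 (HT i))).
rewrite sumEFin /= lee_fin.
have R0 : 0 <= C3 * P * E by apply: mulr_ge0 => //; apply: mulr_ge0 => //; exact: ltW.
by rewrite -[leRHS]ger0_norm// -sqrtr_sqr ler_wsqrtr.
Qed.
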